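(* Let $X$ be a separable reflexive Banach space, $(\Omega,\beta,\mu)$ a finite measure space, $\{T_t,\,t\ge 0\}$ a strongly continuous semigroup of linear $L_1$-$L_\infty$ contractions on $L_1(\Omega,X)$, and $F_s\uparrow F_\infty$ an increasing family of sub-$\sigma$-algebras of $\beta$. Assume that $\{T_t,t\ge0\}$ is positively dominated by some strongly continuous semigroup $\{P_t,t\ge0\}$ of linear $L_1$-$L_\infty$ contractions on $L_1=L_1(\Omega,\mathbb{R})$. Let $f\in L_1(\Omega,X)$. Then: (1) If $\sup_{t>0}\|A_tf\|_X\in L_1$, then $E(A_tf|F_s)\to f^*$ a.e. as $t,s\to\infty$ ($t>0$, $s\ge0$). (2) If $\sup_{s\ge0}\|E(f|F_s)\|_X\in L_1$, then $A_tE(f|F_s)\to f_*$ a.e. as $t,s\to\infty$.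
   Context: $L_p(\Omega,X)$, $1\le p<\infty$, is the Banach space of $X$-valued (strongly) measurable functions $f$ on $\Omega$ with $\|f\|_p=\left(\int_\Omega\|f(\omega)\|_X^p\,d\mu\right)^{1/p}<\infty$; one writes $L_p$ when $X=\mathbb{R}$; $\|f\|_\infty=\inf\{\lambda:\|f(\omega)\|_X\le\lambda\text{ a.e.}\}$. A linear operator $T$ on $L_1(\Omega,X)$ is an $L_1$-$L_\infty$ contraction if $\|Tf\|_1\le\|f\|_1$ and $\|Tf\|_\infty\le\|f\|_\infty$. A family $\{T_t,t\ge0\}$ of linear operators on $L_1(\Omega,X)$ is a strongly continuous semigroup if $T_0=\mathrm{id}$, $T_{t_1}T_{t_2}=T_{t_1+t_2}$ for all $t_1,t_2>0$, and $\lim_{t_1\to t_2}\|T_{t_1}f-T_{t_2}f\|_1=0$ for every $f\in L_1(\Omega,X)$ and $t_2>0$. The flow $\{T_t,t\ge0\}$ in $L_1(\Omega,X)$ is positively dominated by the flow $\{P_t,t\ge0\}$ in $L_1$ if for every $f\in L_1(\Omega,X)$ and $t\ge0$ one has $\|T_tf\|_X\le P_t(\|f\|_X)$ a.e., where $\|f\|_X$ denotes the function $\omega\mapsto\|f(\omega)\|_X$. The ergodic average is $A_tf(\omega)=\frac1t\int_0^tT_\tau f(\omega)\,d\tau$, $t>0$. $E(\cdot|F)$ is the (Bochner) conditional expectation operator with respect to the sub-$\sigma$-algebra $F$. $F_s\uparrow F_\infty$ means $F_{s_1}\subset F_{s_2}$ for $s_1<s_2$ and $F_\infty$ is the $\sigma$-algebra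 generated by $\bigcup_sF_s$. The limit functions are $$f_\infty(\omega)=\lim_{t\to\infty}A_tf(\omega),\qquad f^*(\omega)=\lim_{s\to\infty}E(f_\infty|F_s)(\omega),\qquad f_*(\omega)=\lim_{t\to\infty}A_tE(f|F_\infty)(\omega).$$ Limits as $t,s\to\infty$ are joint limits with $t$ and $s$ tending to infinity independently. *)

(* Defs.v *)
From HB Require Import structures.
From mathcomp Require Import all_boot all_order all_algebra.
From mathcomp Require Import all_classical all_reals all_analysis.
Set Implicit Arguments.
Unset Strict Implicit.
Unset Printing Implicit Defensive.
Import Order.TTheory GRing.Theory Num.Theory.
Import numFieldNormedType.Exports.
Local Open Scope classical_set_scope.
Local Open Scope ring_scope.

Definition separable (X : topologicalType) :=
  exists2 A : set X, countable A & dense A.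

Section Reflexive.
Variables (R : realType) (X : normedModType R).

Definition dual : set (X -> R) :=
  [set l | (forall (a : R) x y, l (a *: x + y) = a * l x + l y) /\
           continuous l].

Definition dual_norm (l : X -> R) : R :=
  sup [set `|l x| | x in [set x : X | `|x| <= 1]].

(* Elements of the bidual are maps on all functions [X -> R], of which only
   the values on [dual] matter. *)
Definition bidual : set ((X -> R) -> R) :=
  [set phi |
    (forall a l m, dual l -> dual m ->
       phi (fun x => a * l x + m x) = a * phi l + phi m) /\
    (exists C : R, forall l, dual l -> `|phi l| <= C * dual_norm l)].

Definition reflexive_space :=
  forall phi, bidual phi -> exists x : X, forall l, dual l -> phi l = l x.

End Reflexive.

(* [G] is a sigma-algebra, possibly smaller than the ambient one. *)
Definition strongly_measurable (R : realType) (X : normedModType R) (T : Type)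
    (G : set (set T)) (f : T -> X) :=
  exists s_ : nat -> {fimfun T >-> X},
    (forall n x, G (s_ n @^-1` [set x])) /\
    (forall w, s_ n w @[n --> \oo] --> f w).

Section Bochner.
Context d (T : measurableType d) (R : realType) (X : normedModType R).
Variable mu : {measure set T -> \bar R}.

Definition simple_integral (D : set T) (s : {fimfun T >-> X}) : X :=
  \sum_(x \in range s) fine (mu (D `&` s @^-1` [set x])) *: x.

(* [f] is Bochner integrable on [D], with integral [I]. *)
Definition is_bochner_integral (D : set T) (f : T -> X) (I : X) :=
  exists s_ : nat -> {fimfun T >-> X},
    [/\ forall n x, measurable (s_ n @^-1` [set x]),
        forall n x, x != 0 -> (mu (D `&` s_ n @^-1` [set x]) < +oo)%E,
        {ae mu, forall w, D w -> s_ n w @[n --> \oo] --> f w},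
        (\int[mu]_(w in D) (`|f w - s_ n w|)%:E)%E @[n --> \oo] --> 0%E &
        simple_integral D (s_ n) @[n --> \oo] --> I].

(* The value is 0 when [f] is not Bochner integrable on [D]. *)
Definition bochner_integral (D : set T) (f : T -> X) : X :=
  xget 0 (is_bochner_integral D f).

End Bochner.

Section Operators.
Context d (T : measurableType d) (R : realType) (X : normedModType R).
Variable mu : {measure set T -> \bar R}.

Definition Lnorm_vector (p : \bar R) (f : T -> X) : \bar R :=
  'N[mu]_p[(fun w => (`|f w|)%:E)]%E.

(* Elements of L_1(T,X) are represented by functions; equality in L_1(T,X) is
   equality almost everywhere. *)
Definition L1 : set (T -> X) :=
  [set f | strongly_measurable measurable f /\
           (Lnorm_vector 1%E f < +oo)%E].

(* [g] represents, as an element of L_1(T,X), the conditional expectation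
   E(f|G). It need only be equal almost everywhere to a [G]-measurable function,
   because [G] is not assumed to contain the null sets. *)
Definition is_cond_exp (G : set (set T)) (f g : T -> X) :=
  [/\ L1 g,
      exists2 g' : T -> X, strongly_measurable G g' & g = g' %[ae mu] &
      forall B, G B ->
        exists2 I : X, is_bochner_integral mu B f I &
                       is_bochner_integral mu B g I].

(* A linear operator on L_1(T,X), acting on representatives. *)
Definition L1_linear_operator (U : (T -> X) -> (T -> X)) :=
  [/\ forall f, L1 f -> L1 (U f),
      forall f g, L1 f -> L1 g -> f = g %[ae mu] -> U f = U g %[ae mu] &
      forall (a : R) f g, L1 f -> L1 g ->
        U (fun w => a *: f w + g w) = (fun w => a *: U f w + U g w) %[ae mu]].

Definition L1_Linf_contraction (U : (T -> X) -> (T -> X)) :=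
  L1_linear_operator U /\
  forall f, L1 f ->
    (Lnorm_vector 1%E (U f) <= Lnorm_vector 1%E f)%E /\
    (Lnorm_vector +oo%E (U f) <= Lnorm_vector +oo%E f)%E.

(* Only the operators [U t] with [0 <= t] are relevant. *)
Definition strongly_continuous_semigroup (U : R -> (T -> X) -> (T -> X)) :=
  [/\ forall t, 0 <= t -> L1_linear_operator (U t),
      forall f, L1 f -> U 0 f = f %[ae mu],
      forall t1 t2 f, 0 < t1 -> 0 < t2 -> L1 f ->
        U t1 (U t2 f) = U (t1 + t2) f %[ae mu] &
      forall f t2, L1 f -> 0 < t2 ->
        Lnorm_vector 1%E (fun w => U t1 f w - U t2 f w) @[t1 --> t2] --> 0%E].

(* [g (tau, w)] is a jointly measurable representation of [U tau f w]; any two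
   of them agree almost everywhere for the product measure. *)
Definition is_joint_representation (U : R -> (T -> X) -> (T -> X))
    (f : T -> X) (g : measurableTypeR R * T -> X) :=
  strongly_measurable measurable g /\
  forall tau, 0 < tau -> (fun w => g (tau, w)) = U tau f %[ae mu].

Definition joint_representation (U : R -> (T -> X) -> (T -> X)) (f : T -> X) :
    measurableTypeR R * T -> X :=
  xget (fun=> 0) (is_joint_representation U f).

(* Up to a null set of [w], independent of [t], this does not depend on the
   joint representation that is chosen, and [t |-> ergodic_average U f t w] is
   continuous on the positive reals. *)
Definition ergodic_average (U : R -> (T -> X) -> (T -> X)) (f : T -> X)
    (t : R) (w : T) : X :=
  t^-1 *: bochner_integral (@lebesgue_measure R) `]0, t]
    (fun tau => joint_representation U f (tau, w)).

(* Almost everywhere convergence of a family of elements of L_1(T,X), where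
   [V i] is the set of representatives of the [i]-th one. For an uncountable
   index set such as the half-line, convergence of the values depends on the
   representatives. Some choice of them converges almost everywhere exactly
   when, for every choice, the family converges almost everywhere along every
   countable set of indices (for a filter [Fi] with a countable basis). *)
Definition cvg_ae_versions (I : Type) (D : set I) (Fi : set_system I)
    (V : I -> set (T -> X)) (l : T -> X) :=
  exists h : I -> T -> X,
    (forall i, D i -> V i (h i)) /\
    {ae mu, forall w, h i w @[i --> Fi] --> l w}.

End Operators.

Definition positively_dominated d (T : measurableType d) (R : realType)
    (X : normedModType R) (mu : {measure set T -> \bar R})
    (U : R -> (T -> X) -> (T -> X)) (P : R -> (T -> R^o) -> (T -> R^o)) :=
  forall f t, L1 mu f -> 0 <= t ->
    {ae mu, forall w, `|U t f w| <= P t (fun w' => `|f w'|) w}.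

Definition filtration d (T : measurableType d) (R : realType)
    (F : R -> set (set T)) :=
  [/\ forall s, 0 <= s -> sigma_algebra setT (F s),
      forall s, 0 <= s -> F s `<=` measurable &
      forall s1 s2, 0 <= s1 -> s1 < s2 -> F s1 `<=` F s2].

Definition filtration_limit (T : Type) (R : realType) (F : R -> set (set T)) :=
  <<s \bigcup_(s in [set s | 0 <= s]) F s >>.

(* Main.v *)
(** Almost everywhere convergence is replaced by almost uniform convergence
(au), modulo null sets that may depend on the index: by Egorov an a.e. convergent
average converges au, a martingale converges au by Doob's maximal inequality and
the density of the union of the L1(F s) in L1(F_oo), and an au convergent family
has versions that converge a.e.

If A_t f -> f_oo au and the supremum of |A_t f| is integrable, then for large t
the function |A_t f - f_oo| is at most lam + v with v of small integral, so that
|E(A_t f - f_oo | F s)| <= lam + E(v | F s), and Doob's inequality makes E(v | F s)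
small for all s at once off a small set.  Symmetrically |A_t (M_s - M_oo)| is at
most lam plus the average of v under the dominating flow, which the
Hopf maximal inequality makes small for all t >= 1 at once.

Convergence of A_t f itself comes from the discrete averages of V = T_1 acting on
I = int_0^1 T_r f dr, since Riemann sums show that V^k I = int_k^(k+1) T_r f dr.  For
these the maximal inequality reduces the claim to functions that are L1-close to
h + (g - V g) with V h = h and g bounded.  Such an approximation of a bounded f
exists because of reflexivity: take almost V-invariant functions g_k in the coset
of f modulo coboundaries that almost minimise int sum_j 2^-j (l_j g)^2, where the
l_j are norming functionals.  The parallelogram identity makes
l_j (g_k) converge a.e. along a subsequence, hence g_k converges weakly in X a.e., to
some h.  Functionals on L1(X) are represented pointwise by functionals on X, so
they see this convergence, and the Hahn-Banach theorem gives V h = h and puts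
f - h in the closure of the coboundaries. *)

From HB Require Import structures.
Require Import Defs.
From mathcomp Require Import all_boot all_order all_algebra.
From mathcomp Require Import all_classical all_reals all_analysis.
From mathcomp Require Import finmap measurable_realfun ring lra.
Set Implicit Arguments.
Unset Strict Implicit.
Unset Printing Implicit Defensive.
Import Order.TTheory GRing.Theory Num.Theory.
Import numFieldNormedType.Exports.
Local Open Scope classical_set_scope.
Local Open Scope ring_scope.


(** * Hahn-Banach and separable duals *)

(** The obstacle in the mean ergodic step is that L1(X) is in general not reflexive: weak
    compactness is available only in X, one point w at a time, and would yield subsequences that
    depend on w. Minimising an energy removes this dependence, since it produces one sequence along
    which countably many scalar functions converge almost everywhere; reflexivity then only has to
    supply the weak limit at each point. Operators act on classes of functions, so every identity
    carries its own null set, and a continuum of null sets cannot be united. Hence exceptional sets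
    of uncountable families become essential unions, and time integrals are compared through
    Tonelli's theorem, which gives one null set for all intervals. Measurability, Bochner integrals
    and conditional expectations are all tested by continuous functionals. For separable X this
    reduces them to scalar statements, and it makes pointwise weak limits measurable at once.
    Passing from integer to real times uses that P_1^n u / n tends to 0 almost everywhere; this
    again comes from the ergodic theorem, applied to the dominating flow. *)

Section HahnBanach.
Variables (R : realType) (V : lmodType R) (S : set V) (p : V -> R).
Hypothesis S_lin : forall (a : R) u v, S u -> S v -> S (a *: u + v).
Hypothesis p_add : forall u v, S u -> S v -> p (u + v) <= p u + p v.
Hypothesis p_scale : forall (a : R) u, 0 <= a -> S u -> p (a *: u) = a * p u.

(** A partial linear functional is encoded as a relation, so that the upper bound of a chain is its
    union. Domination by [p] forces it to be single-valued: two values at one point differ by a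
    value at [0], and [p 0 = 0]. *)
Definition dominated_graph (G : set (V * R)) :=
  [/\ forall z, G z -> S z.1 /\ z.2 <= p z.1 &
      forall (a : R) y z, G y -> G z -> G (a *: y.1 + z.1, a * y.2 + z.2)].

Lemma dominated_graph_fun G u a b :
  dominated_graph G -> G (u, a) -> G (u, b) -> a <= b.
Proof.
move=> [Gp Gl] Ga Gb; have Gu := (Gp _ Ga).1.
have := Gl (-1) _ _ Gb Ga; rewrite /= !scaleN1r addNr => /Gp[/= _].
by rewrite -(scale0r u) p_scale // mul0r; lra.
Qed.

Lemma dominated_graph_extension G u :
  dominated_graph G -> (exists z, G z) -> S u ->
  exists2 G', dominated_graph G' & G `<=` G' /\ exists a, G' (u, a).
Proof.
move=> [Gp Gl] [z0 Gz0] Su.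
have G0 : G (0, 0).
  by have := Gl (-1) _ _ Gz0 Gz0; rewrite scaleN1r mulN1r !addNr.
have S0 : S 0 by have [] := Gp _ G0.
have S1 v w : S v -> S w -> S (v + w).
  by move=> Sv Sw; rewrite -(scale1r v); exact: S_lin.
have SN v : S v -> S (- v).
  by move=> Sv; rewrite -[- v]addr0 -scaleN1r; exact: S_lin.
(* A value at [u] is admissible when it lies above all of [E] and below every [p (z.1 + u) - z.2].
   Subadditivity places the first bounds below the second, so the supremum of [E] will do. *)
pose E := [set y | exists2 z, G z & y = z.2 - p (z.1 - u)].
have Eub z : G z -> forall y, E y -> y <= p (z.1 + u) - z.2.
  move=> Gz y [z' Gz' ->].
  have [Sz _] := Gp _ Gz; have [Sz' _] := Gp _ Gz'.
  have := Gl 1 _ _ Gz Gz' => /Gp[/= _]; rewrite scale1r mul1r => h.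
  have := p_add (S1 _ _ Sz Su) (S1 _ _ Sz' (SN _ Su)).
  by rewrite addrACA subrr addr0; lra.
have E0 : E !=set0 by exists (z0.2 - p (z0.1 - u)), z0.
pose al := sup E.
have al_le z : G z -> z.2 + al <= p (z.1 + u).
  move=> Gz; have : al <= p (z.1 + u) - z.2 by apply: ge_sup => // y /(Eub _ Gz).
  by lra.
have le_al z : G z -> z.2 - al <= p (z.1 - u).
  move=> Gz; have : z.2 - p (z.1 - u) <= al.
    apply: ub_le_sup; last by exists z.
    by exists (p (z0.1 + u) - z0.2) => y /(Eub _ Gz0).
  by lra.
have Gsc c z : G z -> G (c *: z.1, c * z.2).
  by move=> Gz; have := Gl c _ _ Gz G0; rewrite /= !addr0.
pose G' := [set y : V * R | exists z c, G z /\ y = (z.1 + c *: u, z.2 + c * al)].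
exists G'; last split.
- split=> [_ [z [c [Gz ->]]] /=|a _ _ [z [c [Gz ->]]] [z' [c' [Gz' ->]]] /=].
    have [Sz zp] := Gp _ Gz; split; first by rewrite addrC; exact: S_lin.
    have [c0|c0|->] := ltgtP c 0; last by rewrite scale0r mul0r !addr0.
    + have cN0 : - c != 0 by rewrite oppr_eq0 lt_eqF.
      have /(_ _ (Gsc ((- c)^-1) _ Gz)) /= h := le_al.
      have -> : z.1 + c *: u = (- c) *: ((- c)^-1 *: z.1 - u).
        by rewrite scalerBr scalerA mulfV // scale1r scaleNr opprK.
      rewrite p_scale; [|lra|].
        have : 0 <= - c by lra.
        move=> /ler_wpM2l/(_ _ _ h); rewrite mulrBr mulrA mulfV //; lra.
      by apply: S1; [have [] := Gp _ (Gsc ((- c)^-1) _ Gz)|exact: SN].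
    + have cN0 : c != 0 by rewrite gt_eqF.
      have /(_ _ (Gsc (c^-1) _ Gz)) /= h := al_le.
      have -> : z.1 + c *: u = c *: (c^-1 *: z.1 + u).
        by rewrite scalerDr scalerA mulfV // scale1r.
      rewrite p_scale; [|lra|].
        have /ler_wpM2l/(_ _ _ h) : 0 <= c by lra.
        by rewrite mulrDr mulrA mulfV //; lra.
      by apply: S1 => //; have [] := Gp _ (Gsc (c^-1) _ Gz).
  exists (a *: z.1 + z'.1, a * z.2 + z'.2), (a * c + c'); split; first exact: Gl.
  congr (_, _) => /=; last by ring.
  by rewrite scalerDr scalerDl addrACA scalerA.
- by move=> [v b] Gz; exists (v, b), 0; rewrite /= scale0r mul0r !addr0.
- by exists al, (0, 0), 1; rewrite /= scale1r mul1r !add0r.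
Qed.

(** The subspace [S] is a parameter because the main application takes [V] to be all functions
    [T -> X] and [S] to be [L1 mu], on which alone the seminorm is sublinear. *)
Theorem hahn_banach (v0 : V) : S v0 ->
  exists phi : V -> R,
    [/\ forall a u v, S u -> S v -> phi (a *: u + v) = a * phi u + phi v,
        forall u, S u -> phi u <= p u & phi v0 = p v0].
Proof.
move=> Sv0.
(* Zorn's lemma is asked about the empty chain too, whose union is the empty graph; hence the
   implication instead of a plain membership. *)
pose P (G : set (V * R)) :=
  dominated_graph G /\ ((exists z, G z) -> G (v0, p v0)).
pose G0 := [set z : V * R | exists c, z = (c *: v0, c * p v0)].
have S0 : S 0.
  by have := S_lin (-1) Sv0 Sv0; rewrite scaleN1r addNr.
have p0 : p 0 = 0 by rewrite -(scale0r v0) p_scale // mul0r.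
have PG0 : P G0.
  split; last by move=> _; exists 1; rewrite scale1r mul1r.
  split=> [_ [c ->] /=|a _ _ [c ->] [c' ->] /=]; last first.
    by exists (a * c + c'); rewrite scalerDl scalerA; congr (_, _); ring.
  have SZ c' : S (c' *: v0) by rewrite -[_ *: _]addr0; exact: S_lin.
  split; first exact: SZ.
  have [c0|c0] := leP 0 c; first by rewrite p_scale.
  have := p_add (SZ c) (SZ (- c)).
  by rewrite -scalerDl subrr scale0r p0 [p (- c *: _)]p_scale //; lra.
have [F FP Ftot|A [[Ad Av0] Amax]] := @Zorn_bigcup _ P.
  split; last first.
    by move=> [z [G FG Gz]]; exists G => //; apply: (FP _ FG).2; exists z.
  split=> [z [G FG Gz]|a y z [G FG Gy] [G' FG' Gz]].
    exact: (FP _ FG).1.1.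
  have [GG'|GG'] := Ftot _ _ FG FG'.
    by exists G' => //; apply: (FP _ FG').1.2 => //; exact: GG'.
  by exists G => //; apply: (FP _ FG).1.2 => //; exact: GG'.
have A0 : exists z, A z.
  apply: contrapT => nA; apply: (Amax G0) => //; split; last first.
    by move=> h; apply: nA; exists (0, 0); apply: h; exists 0; rewrite scale0r mul0r.
  by move=> z Az; exfalso; apply: nA; exists z.
have Adom u : S u -> exists a, A (u, a).
  move=> Su; have [G' G'd [AG' [a G'a]]] := dominated_graph_extension Ad A0 Su.
  exists a; apply: contrapT => nAa; apply: (Amax G'); last first.
    by split=> // _; apply/AG'/Av0.
  by split=> // /(_ _ G'a).
pose phi u := xget 0 [set a | A (u, a)].
have phiP u : S u -> A (u, phi u).
  by move=> /Adom[a Aa]; rewrite /phi; case: xgetP => [b _ //|/(_ a)].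
have Afun u a b : A (u, a) -> A (u, b) -> a = b.
  by move=> Aa Ab; apply/eqP; rewrite eq_le !(dominated_graph_fun Ad Aa Ab,
    dominated_graph_fun Ad Ab Aa).
exists phi; split.
- move=> a u v Su Sv; apply: Afun (phiP _ (S_lin _ Su Sv)) _.
  exact: Ad.2 (phiP _ Su) (phiP _ Sv).
- by move=> u Su; apply: (Ad.1 _ (phiP _ Su)).2.
- by apply: Afun (phiP _ Sv0) (Av0 A0).
Qed.

End HahnBanach.


(** * Continuous functionals and norming sequences *)

Section Dual.
Variables (R : realType) (X : normedModType R).
Implicit Types (l : X -> R) (x y : X).

Lemma dualD l x y : dual l -> l (x + y) = l x + l y.
Proof. by case=> /(_ 1 x y); rewrite scale1r mul1r. Qed.

Lemma dual0 l : dual l -> l 0 = 0.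
Proof. by move=> lX; have := dualD 0 0 lX; rewrite addr0; lra. Qed.

Lemma dualZ l a x : dual l -> l (a *: x) = a * l x.
Proof. by move=> lX; case: (lX) => /(_ a x 0) + _; rewrite !addr0 dual0// addr0. Qed.

Lemma dualN l x : dual l -> l (- x) = - l x.
Proof. by move=> lX; rewrite -scaleN1r dualZ// mulN1r. Qed.

Lemma dualB l x y : dual l -> l (x - y) = l x - l y.
Proof. by move=> lX; rewrite dualD// dualN. Qed.

Lemma dual_sum l (I : Type) (r : seq I) (P : pred I) (F : I -> X) : dual l ->
  l (\sum_(i <- r | P i) F i) = \sum_(i <- r | P i) l (F i).
Proof.
move=> lX; apply: (big_morph l) => [x y|]; [exact: dualD|exact: dual0].
Qed.

Lemma dual_bound l : dual l -> exists2 C, 0 <= C & forall x, `|l x| <= C * `|x|.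
Proof.
move=> lX; have [_ /(_ 0)] := lX.
rewrite /continuous_at dual0// => /cvgrPdist_lt/(_ 1 ltr01).
move=> /nbhs_norm0P[e /= e0 He].
exists (2 / e) => [|x]; first by rewrite divr_ge0// ltW.
have [->|x0] := eqVneq x 0; first by rewrite dual0// !normr0 mulr0.
have x0' : 0 < `|x| by rewrite normr_gt0.
have /He : `|(e / 2 / `|x|) *: x| < e.
  rewrite normrZ gtr0_norm ?divr_gt0// divfK ?gt_eqF//.
  by rewrite ltr_pdivrMr// ltr_pMr// ltr1n.
rewrite /= sub0r normrN dualZ// normrM gtr0_norm ?divr_gt0// => h.
have -> : `|l x| = (2 / e * `|x|) * (e / 2 / `|x| * `|l x|) by field; rewrite !gt_eqF.
by rewrite ler_piMr ?(ltW h)// mulr_ge0// divr_ge0// ltW.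
Qed.

Lemma dual_of_bound l (C : R) :
  (forall a x y, l (a *: x + y) = a * l x + l y) ->
  (forall x, `|l x| <= C * `|x|) -> dual l.
Proof.
move=> llin lC; split=> // x; apply/cvgrPdist_lt => e e0.
have C1 : 0 < `|C| + 1 by rewrite ltr_wpDl.
have lB y z : l (y - z) = l y - l z.
  by rewrite addrC -scaleN1r llin mulN1r addrC.
near=> y; rewrite -lB (le_lt_trans (lC _))//.
rewrite (@le_lt_trans _ _ ((`|C| + 1) * `|x - y|))//.
  by rewrite ler_wpM2r// (le_trans (ler_norm _))// lerDl.
rewrite -ltr_pdivlMl//; near: y.
by apply: cvgr_dist_lt => //; rewrite mulr_gt0// invr_gt0.
Unshelve. all: by end_near. Qed.

Lemma norming_functional x :
  exists l, [/\ dual l, forall y, `|l y| <= `|y| & l x = `|x|].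
Proof.
have [||||] := @hahn_banach R X setT (fun y => `|y|) _ _ _ x => //.
- by move=> u v _ _; exact: ler_normD.
- by move=> a u a0 _; rewrite normrZ ger0_norm.
move=> l [llin lp lx].
have lN y : l (- y) = - l y.
  have l00 : l 0 = 0 by have := llin (-1) 0 0 Logic.I Logic.I; rewrite scaleN1r oppr0 addr0; lra.
  by have := llin (-1) y 0 Logic.I Logic.I; rewrite scaleN1r addr0 l00 addr0 mulN1r.
have lb y : `|l y| <= `|y|.
  by rewrite ler_norml lp// andbT; have := lp (- y) Logic.I; rewrite lN normrN; lra.
exists l; split=> //; apply: (@dual_of_bound _ 1) => [a u v|u].
  exact: llin.
by rewrite mul1r.
Qed.

Lemma dual_separated x y : (forall l, dual l -> l x = l y) -> x = y.
Proof.
move=> h; apply/eqP; rewrite -subr_eq0 -normr_eq0; apply/eqP.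
have [l [lX _ <-]] := norming_functional (x - y).
by rewrite dualB// h// subrr.
Qed.

Lemma dual_comb l m a : dual l -> dual m -> dual (fun x => a * l x + m x).
Proof.
move=> lX mX; have [C C0 lC] := dual_bound lX; have [D D0 mD] := dual_bound mX.
apply: (@dual_of_bound _ (`|a| * C + D)) => [b x y|x].
  by rewrite !dualD// !dualZ//; ring.
rewrite (le_trans (ler_normD _ _))// normrM mulrDl lerD// -mulrA.
by rewrite ler_wpM2l.
Qed.

Lemma dense_sequence : separable X ->
  exists x_ : nat -> X, forall x e, 0 < e -> exists i, `|x - x_ i| < e.
Proof.
move=> [A /countable_injP[f finj] dA].
exists (fun n => xget 0 [set a | A a /\ f a = n]) => x e e0.
have [|a [/= xa Aa]] := dA (ball x e) _ (ball_open x _).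
  by exists x; exact: ballxx.
exists (f a); case: xgetP => [b _ [Ab fab]|/(_ a)]; last by case.
rewrite -ball_normE in xa.
by have <- : a = b by apply: finj => //; exact/mem_set.
Qed.

(** Take functionals that norm the points of a dense sequence: the one belonging to [x_ i] differs
    from the norm at [x] by at most twice [|x - x_ i|]. The last clause lets a norm be bounded
    almost everywhere by countably many scalar inequalities. *)
Lemma norming_sequence : separable X ->
  exists l_ : nat -> X -> R,
    [/\ forall j, dual (l_ j), forall j x, `|l_ j x| <= `|x| &
        forall x r, (forall j, l_ j x <= r) -> `|x| <= r].
Proof.
move=> /dense_sequence[x_ xd].
have /choice[l_ lP] j := norming_functional (x_ j).
exists l_; split=> [j|j x|x r lr]; [by case: (lP j)|by case: (lP j)|].
apply/ler_addgt0Pr => e e0.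
have [|i xi] := xd x (e / 2); first by rewrite divr_gt0.
have [liX lib lixi] := lP i.
have := lib (x - x_ i); rewrite dualB// lixi => h.
have := lr i; have := ler_norm (`|x_ i| - l_ i x); rewrite distrC.
by have := ler_distD (x_ i) x 0; rewrite !subr0; lra.
Qed.

End Dual.

(** * Weak measurability and the Bochner integral *)

Section DualMeasurable.
Variables (R : realType) (X : normedModType R).
Hypothesis X_separable : separable X.
Context d (T : measurableType d).
Implicit Types f g : T -> X.

(* For separable [X] this is strong measurability (Pettis). *)
Definition dmeas f := forall l : X -> R, dual l -> measurable_fun setT (l \o f).

Lemma dmeas_cst x : dmeas (fun=> x).
Proof. by move=> l _; exact: measurable_cst. Qed.

Lemma dmeas_lin a f g : dmeas f -> dmeas g -> dmeas (fun w => a *: f w + g w).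
Proof.
move=> fm gm l lX.
rewrite (_ : _ \o _ = (fun w => a * (l \o f) w + (l \o g) w)); last first.
  by apply/funext => w /=; rewrite dualD// dualZ.
by apply: measurable_funD; [apply: measurable_funM => //; exact: fm|exact: gm].
Qed.

Lemma dmeasD f g : dmeas f -> dmeas g -> dmeas (fun w => f w + g w).
Proof.
by move=> fm gm; rewrite (_ : (fun w => _) = (fun w => 1 *: f w + g w));
  [exact: dmeas_lin|apply/funext => w; rewrite scale1r].
Qed.

Lemma dmeasZ a f : dmeas f -> dmeas (fun w => a *: f w).
Proof.
by move=> fm; rewrite (_ : (fun w => _) = (fun w => a *: f w + 0));
  [apply: dmeas_lin => //; exact: dmeas_cst|apply/funext => w; rewrite addr0].
Qed.

Lemma dmeasB f g : dmeas f -> dmeas g -> dmeas (fun w => f w - g w).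
Proof.
move=> fm gm; apply: dmeasD => //.
rewrite (_ : (fun w => - g w) = (fun w => (-1) *: g w)); first exact: dmeasZ.
by apply/funext => w; rewrite scaleN1r.
Qed.

Lemma dmeas_sum (I : Type) (r : seq I) (P : pred I) (F : I -> T -> X) :
  (forall i, P i -> dmeas (F i)) -> dmeas (fun w => \sum_(i <- r | P i) F i w).
Proof.
move=> Fm; elim: r => [|i r IH].
  by under eq_fun do rewrite big_nil; exact: dmeas_cst.
under eq_fun do rewrite big_cons.
case: (boolP (P i)) => Pi; last exact: IH.
by apply: dmeasD; [exact: Fm|exact: IH].
Qed.

Lemma dmeasZf (u : T -> R) f : measurable_fun setT u -> dmeas f ->
  dmeas (fun w => u w *: f w).
Proof.
move=> um fm l lX; rewrite (_ : _ \o _ = u \* (l \o f)); last first.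
  by apply/funext => w /=; rewrite dualZ.
by apply: measurable_funM => //; exact: fm.
Qed.

(** The norm is the supremum of the countably many functionals of a norming sequence. *)
Lemma measurable_norm_dmeas f : dmeas f -> measurable_fun setT (fun w => `|f w|).
Proof.
move=> fm; have [l_ [lX lb ln]] := norming_sequence X_separable.
have sb w : has_ubound (range (fun j => l_ j (f w))).
  by exists `|f w| => _ [j _ <-]; rewrite (le_trans (ler_norm _)).
rewrite (_ : (fun w => _) = (fun w => sups (fun j => l_ j (f w)) 0)).
  by apply: (@measurable_fun_sups _ _ _ _ (fun j w => l_ j (f w))) => [w _|j];
    [exact: sb|exact: (fm _ (lX j))].
apply/funext => w; apply/eqP; rewrite eq_le; apply/andP; split.
  apply: ln => j; apply: ub_le_sup; last by exists j.
  by exists `|f w| => _ [k _ <-]; rewrite (le_trans (ler_norm _)).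
apply: ge_sup; first by exists (l_ 0 (f w)), 0.
by move=> _ [j _ <-]; rewrite (le_trans (ler_norm _)).
Qed.

Lemma measurable_dist_dmeas f g : dmeas f -> dmeas g ->
  measurable_fun setT (fun w => `|f w - g w|).
Proof. by move=> fm gm; apply: measurable_norm_dmeas; exact: dmeasB. Qed.

Lemma dmeas_if (A : set T) f g : measurable A -> dmeas f -> dmeas g ->
  dmeas (fun w => if w \in A then f w else g w).
Proof.
move=> Am fm gm l lX.
rewrite (_ : _ \o _ = (fun w => if w \in A then l (f w) else l (g w))); last first.
  by apply/funext => w /=; case: ifP.
apply: measurable_fun_ifT; [|exact: fm|exact: gm].
by apply: (measurable_fun_bool true); rewrite setTI preimage_mem_true.
Qed.

Lemma dmeas_lim (f_ : nat -> T -> X) f : (forall n, dmeas (f_ n)) ->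
  (forall w, f_ n w @[n --> \oo] --> f w) -> dmeas f.
Proof.
move=> fm fl l lX.
apply: (@measurable_fun_cvg _ _ _ _ (fun n => l \o f_ n)) => [n|w _].
  exact: fm.
by apply: continuous_cvg => //; exact: lX.2.
Qed.

Lemma dmeas_fin f : finite_set (range f) -> (forall x, measurable (f @^-1` [set x])) ->
  dmeas f.
Proof.
move=> ff fm l lX _ B _; rewrite setTI.
rewrite (_ : _ @^-1` _ = \bigcup_(x in range f `&` l @^-1` B) (f @^-1` [set x])).
  by apply: fin_bigcup_measurable => //; exact: finite_setIl.
apply/seteqP; split=> [w /= Bw|w [x [_ Bx] /= ->]//].
by exists (f w).
Qed.

Lemma strongly_measurable_dmeas f : strongly_measurable measurable f -> dmeas f.
Proof.
move=> [s_ [sm sf]]; apply: (dmeas_lim _ sf) => n.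
by apply: dmeas_fin.
Qed.

(* The simple function [s_ n w] is a nearest point to [f w] in a finite set that
   contains [0], so that [|f - s_ n| <= |f|]. *)
Lemma dmeas_simple f : dmeas f -> exists s_ : nat -> {fimfun T >-> X},
  [/\ forall n x, measurable (s_ n @^-1` [set x]),
      forall w, s_ n w @[n --> \oo] --> f w &
      forall n w, `|f w - s_ n w| <= `|f w|].
Proof.
move=> fm; have [y_ yd] := dense_sequence X_separable.
pose s := fix s n w {struct n} := if n is m.+1 then
  if `|f w - y_ m| < `|f w - s m w| then y_ m else s m w else 0.
have sfin n : finite_set (range (s n)).
  elim: n => [|n IH].
    by apply: (@sub_finite_set _ _ [set 0]) => // _ [w _ <-].
  apply: (@sub_finite_set _ _ ([set y_ n] `|` range (s n))).
    by move=> _ [w _ <-] /=; case: ifP => _; [left|right; exists w].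
  by rewrite finite_setU; split.
have sm n x : measurable (s n @^-1` [set x]).
  elim: n x => [|n IH] x.
    have [<-|x0] := eqVneq 0 x.
      by rewrite (_ : _ @^-1` _ = setT)//; apply/seteqP; split.
    rewrite (_ : _ @^-1` _ = set0)//; apply/seteqP; split => // w /= x0'.
    by rewrite x0' eqxx in x0.
  pose A := [set w | `|f w - y_ n| < `|f w - s n w|].
  have Am : measurable A.
    have := measurable_fun_ltr (measurable_dist_dmeas fm (dmeas_cst (y_ n)))
      (measurable_dist_dmeas fm (dmeas_fin (sfin n) IH)).
    by move=> /(_ measurableT [set true]); rewrite setTI; exact.
  have -> : s n.+1 @^-1` [set x] =
      (A `&` [set w | y_ n = x]) `|` (~` A `&` s n @^-1` [set x]).
    apply/seteqP; split=> [w /=|w /=].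
      by rewrite /A /=; case: ifP => [h|/negP h] ->; [left|right].
    by rewrite /A /=; case: ifP => [h|/negP h] [[]|[]].
  apply: measurableU; apply: measurableI => //; last exact: measurableC.
  have [->|yx] := eqVneq (y_ n) x.
    by rewrite (_ : [set _ | _] = setT)//; apply/seteqP; split.
  rewrite (_ : [set _ | _] = set0)//; apply/seteqP; split => // w /= h.
  by rewrite h eqxx in yx.
have sle n w : `|f w - s n.+1 w| <= `|f w - s n w|.
  by rewrite /=; case: ifP => // /ltW.
have sle2 n m w : (n <= m)%N -> `|f w - s m w| <= `|f w - s n w|.
  move=> /subnK <-; elim: (m - n)%N => [//|k IH].
  by rewrite addSn (le_trans (sle _ _)).
pose S n := fimfun_Sub (mem_set (sfin n)).
exists S; split=> [n x|w|n w].
- exact: sm.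
- apply/cvgrPdist_lt => e e0; have [i fi] := yd (f w) e e0.
  near=> n; have ni : (i < n)%N by near: n; exact: nbhs_infty_gt.
  apply: le_lt_trans (sle2 _ _ w ni) _; apply: le_lt_trans fi.
  by rewrite /=; case: ifPn => //; rewrite -leNgt.
- by rewrite (le_trans (sle2 0%N n w _))//= subr0.
Unshelve. all: by end_near. Qed.

Lemma dmeas_strongly_measurable f : dmeas f -> strongly_measurable measurable f.
Proof. by move=> /dmeas_simple[s_ [? ? _]]; exists s_. Qed.

End DualMeasurable.

(** * The L1 seminorm of vector-valued functions *)

Section IntegralNorm.
Local Open Scope ereal_scope.
Context (R : realType) d (T : measurableType d).
Variable mu : {measure set T -> \bar R}.

Definition nrm (X : normedModType R) (D : set T) (f : T -> X) : \bar R :=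
  \int[mu]_(w in D) (`|f w|%R)%:E.

Lemma le_mu (A B : set T) : measurable A -> measurable B -> A `<=` B -> mu A <= mu B.
Proof. by move=> mA mB AB; apply: le_measure => //; exact: mem_set. Qed.

Lemma nrm_ge0 (X : normedModType R) D (f : T -> X) : 0 <= nrm D f.
Proof. by apply: integral_ge0 => w _; rewrite lee_fin. Qed.

Section VectorNorm.
Variable X : normedModType R.
Hypothesis X_separable : separable X.
Variable D : set T.
Hypothesis mD : measurable D.
Implicit Types f g : T -> X.

Lemma measurable_EFin_norm f : dmeas f -> measurable_fun D (fun w => (`|f w|%R)%:E).
Proof.
move=> fm; apply/measurable_EFinP; apply: measurable_funTS.
exact: measurable_norm_dmeas.
Qed.

Lemma le_nrm_ae f (u : T -> R) : dmeas f -> measurable_fun setT u ->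
  {ae mu, forall w, D w -> (`|f w| <= u w)%R} -> nrm D f <= \int[mu]_(w in D) (u w)%:E.
Proof.
move=> fm um fu; rewrite /nrm.
rewrite (@le_trans _ _ (\int[mu]_(w in D) (`|u w|%R)%:E))//.
  apply: ae_ge0_le_integral => //.
  - exact: measurable_EFin_norm.
  - by apply/measurable_EFinP/measurable_funTS; exact: measurableT_comp.
  - apply: filterS fu => w fu Dw; rewrite lee_fin.
    by rewrite (le_trans (fu Dw))// ler_norm.
rewrite le_eqVlt; apply/orP; left; apply/eqP.
apply: ae_eq_integral => //.
- by apply/measurable_EFinP/measurable_funTS; exact: measurableT_comp.
- by apply/measurable_EFinP/measurable_funTS.
- apply: filterS fu => w fu Dw; rewrite ger0_norm//.
  by rewrite (le_trans _ (fu Dw)).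
Qed.

Lemma nrmD f g : dmeas f -> dmeas g ->
  nrm D (fun w => (f w + g w)%R) <= nrm D f + nrm D g.
Proof.
move=> fm gm; rewrite /nrm -ge0_integralD//; try exact: measurable_EFin_norm.
  apply: ge0_le_integral => //; first by apply: measurable_EFin_norm; exact: dmeasD.
    by apply: emeasurable_funD; exact: measurable_EFin_norm.
  by move=> w _; rewrite -EFinD lee_fin ler_normD.
Qed.

Lemma nrmZ (a : R) f : dmeas f ->
  nrm D (fun w => (a *: f w)%R) = `|a|%:E * nrm D f.
Proof.
move=> fm; rewrite /nrm -ge0_integralZl//; last first.
- exact: measurable_EFin_norm.
by apply: eq_integral => w _; rewrite normrZ EFinM.
Qed.

Lemma nrm_distC f g : nrm D (fun w => (f w - g w)%R) = nrm D (fun w => (g w - f w)%R).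
Proof. by apply: eq_integral => w _; rewrite distrC. Qed.

Lemma nrmB f g : dmeas f -> dmeas g ->
  nrm D (fun w => (f w - g w)%R) <= nrm D f + nrm D g.
Proof.
move=> fm gm.
have -> : (fun w => f w - g w)%R = (fun w => f w + (-1) *: g w)%R.
  by apply/funext => w; rewrite scaleN1r.
apply: le_trans (nrmD fm (dmeasZ (-1)%R gm)) _.
by rewrite nrmZ// normrN1 mul1e.
Qed.

Lemma nrm_dist_trans f g h : dmeas f -> dmeas g -> dmeas h ->
  nrm D (fun w => (f w - h w)%R) <=
  nrm D (fun w => (f w - g w)%R) + nrm D (fun w => (g w - h w)%R).
Proof.
move=> fm gm hm; apply: le_trans (nrmD (dmeasB fm gm) (dmeasB gm hm)).
by under [X in _ <= nrm _ X]eq_fun do rewrite addrA subrK.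
Qed.

Lemma nrm_sum (I : Type) (r : seq I) (F : I -> T -> X) :
  (forall i, dmeas (F i)) ->
  nrm D (fun w => (\sum_(i <- r) F i w)%R) <= \sum_(i <- r) nrm D (F i).
Proof.
move=> Fm; elim: r => [|i r IH].
  rewrite big_nil /nrm; under eq_integral do rewrite big_nil normr0.
  by rewrite integral0.
rewrite big_cons; under eq_fun do rewrite big_cons.
apply: le_trans (@nrmD _ _ (Fm i) (dmeas_sum r (fun i (_ : xpredT i) => Fm i))) _.
by rewrite leeD2l.
Qed.

Lemma eq_nrm_ae f g : dmeas f -> dmeas g ->
  {ae mu, forall w, D w -> f w = g w} -> nrm D f = nrm D g.
Proof.
move=> fm gm fg; apply: ae_eq_integral => //; try exact: measurable_EFin_norm.
by apply: filterS fg => w fg Dw; rewrite fg.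
Qed.

Lemma integrable_dual f (l : X -> R) : dmeas f -> nrm D f < +oo -> dual l ->
  mu.-integrable D (EFin \o (l \o f)).
Proof.
move=> fm foo lX; have [C C0 lC] := dual_bound lX.
apply/integrableP; split.
  by apply/measurable_EFinP/measurable_funTS; exact: fm.
apply: (@le_lt_trans _ _ (C%:E * nrm D f)).
  rewrite /nrm -ge0_integralZl//; last exact: measurable_EFin_norm.
  apply: ge0_le_integral => //.
  - have fl : measurable_fun D (EFin \o (l \o f)).
      by apply/measurable_EFinP/measurable_funTS; exact: fm.
    exact: measurableT_comp fl.
  - by apply: measurable_funeM; exact: measurable_EFin_norm.
  - by move=> w _; rewrite -EFinM /= lee_fin lC.
by apply: lte_mul_pinfty => //; rewrite ?lee_fin.
Qed.

Lemma Rintegral_dual_le f (l : X -> R) C : dmeas f -> nrm D f < +oo -> dual l ->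
  (0 <= C)%R -> (forall x, `|l x| <= C * `|x|)%R ->
  (`|\int[mu]_(w in D) l (f w)| <= C * fine (nrm D f))%R.
Proof.
move=> fm foo lX C0 lC; have fi := integrable_dual fm foo lX.
rewrite -lee_fin EFin_normr_Rintegral// EFinM fineK; last first.
  by rewrite ge0_fin_numE// nrm_ge0.
apply: le_trans (le_abse_integral _ mD (measurable_int _ fi)) _.
rewrite /nrm -ge0_integralZl//; last exact: measurable_EFin_norm.
apply: ge0_le_integral => //.
- by apply: measurableT_comp => //; exact: measurable_int fi.
- by apply: measurable_funeM; exact: measurable_EFin_norm.
- by move=> w _; rewrite -EFinM /= lee_fin lC.
Qed.

End VectorNorm.
End IntegralNorm.

Section EreaCvgZero.
Local Open Scope ereal_scope.
Context (R : realType) (I : Type) (Fi : set_system I) {FF : Filter Fi}.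

Lemma cvge0P (u : I -> \bar R) : (forall i, 0 <= u i) ->
  u i @[i --> Fi] --> 0 <-> forall e : R, (0 < e)%R -> \forall i \near Fi, u i < e%:E.
Proof.
move=> u0; split=> [/fine_cvgP[ufin ucvg] e e0|h].
  move/cvgrPdist_lt : ucvg => /(_ e e0) ucvg.
  near=> i; have ui : u i \is a fin_num by near: i.
  rewrite -(fineK ui) lte_fin.
  have : (`|0 - (fine \o u) i| < e)%R by near: i.
  by rewrite sub0r normrN ger0_norm//= fine_ge0.
apply/fine_cvgP; split.
  near=> i; rewrite ge0_fin_numE//.
  by apply: lt_trans (ltry 1%R); near: i; exact: h.
apply/cvgrPdist_lt => e e0; near=> i.
have ui : u i < e%:E by near: i; exact: h.
rewrite sub0r normrN ger0_norm/= ?fine_ge0//.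
by rewrite -lte_fin fineK// ge0_fin_numE// (lt_trans ui)// ltry.
Unshelve. all: by end_near. Qed.

End EreaCvgZero.

(** * The Bochner integral seen through functionals *)

Section Bochner.
Context (R : realType) (X : completeNormedModType R).
Hypothesis X_separable : separable X.
Context d (T : measurableType d).
Variable mu : {measure set T -> \bar R}.
Variable D : set T.
Hypothesis mD : measurable D.
Implicit Types (f g : T -> X) (I J : X).

Lemma Rintegral_sum (I : Type) (r : seq I) (F : I -> T -> R) :
  (forall i, mu.-integrable D (EFin \o F i)) ->
  \int[mu]_(w in D) (\sum_(i <- r) F i w) = \sum_(i <- r) \int[mu]_(w in D) F i w.
Proof.
move=> Fi; elim: r => [|i r IH].
  under eq_Rintegral do rewrite big_nil.
  by rewrite big_nil Rintegral_cst// mul0r.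
under eq_Rintegral do rewrite big_cons.
rewrite big_cons -IH RintegralD//.
rewrite (_ : _ \o _ = fun w => (\sum_(j <- r) (EFin \o F j) w)%E).
  by apply: integrable_sum => // j _.
by apply/funext => w /=; rewrite -sumEFin.
Qed.

(* The weak characterization of the Bochner integral [I] of [f] on [D]. *)
Definition wint (f : T -> X) (I : X) :=
  forall l, dual l -> l I = \int[mu]_(w in D) l (f w).

Lemma wint_unique f I J : wint f I -> wint f J -> I = J.
Proof. by move=> fI fJ; apply: dual_separated => l lX; rewrite fI// fJ. Qed.

Lemma wint_lin a f g I J : dmeas f -> dmeas g ->
  (nrm mu D f < +oo)%E -> (nrm mu D g < +oo)%E -> wint f I -> wint g J ->
  wint (fun w => a *: f w + g w) (a *: I + J).
Proof.
move=> fm gm foo goo fI gJ l lX; rewrite dualD// dualZ// fI// gJ//.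
have fi := integrable_dual X_separable mD fm foo lX.
have gi := integrable_dual X_separable mD gm goo lX.
rewrite -RintegralZl// -RintegralD//; last first.
  by rewrite (_ : _ \o _ = (fun w => a%:E * (EFin \o (l \o f)) w)%E)//;
    exact: integrableZl.
by apply: eq_Rintegral => w _; rewrite dualD// dualZ.
Qed.

Lemma wint_bound f I : dmeas f -> wint f I -> (`|I|%:E <= nrm mu D f)%E.
Proof.
move=> fm fI; have [foo|] := ltP (nrm mu D f) +oo%E; last first.
  by move=> h; rewrite (le_trans _ h)// leey.
have [l [lX lb lI]] := norming_functional I.
have := Rintegral_dual_le X_separable mD fm foo lX ler01.
rewrite -fI// lI normr_id mul1r -lee_fin fineK ?ge0_fin_numE ?nrm_ge0//; apply.
by move=> x; rewrite mul1r.
Qed.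

Lemma wint_dist_bound f g I J : dmeas f -> dmeas g ->
  (nrm mu D f < +oo)%E -> (nrm mu D g < +oo)%E -> wint f I -> wint g J ->
  (`|I - J|%:E <= nrm mu D (fun w => (f w - g w)%R))%E.
Proof.
move=> fm gm foo goo fI gJ; apply: wint_bound; first exact: dmeasB.
have := wint_lin (-1) gm fm goo foo gJ fI.
rewrite scaleN1r addrC; congr wint; apply/funext => w.
by rewrite scaleN1r addrC.
Qed.

Lemma eq_wint_ae f g I : dmeas f -> dmeas g ->
  {ae mu, forall w, D w -> f w = g w} -> wint f I -> wint g I.
Proof.
move=> fm gm fg fI l lX; rewrite fI//; congr fine.
apply: ae_eq_integral => //.
- by apply/measurable_EFinP/measurable_funTS; exact: fm.
- by apply/measurable_EFinP/measurable_funTS; exact: gm.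
- by apply: filterS fg => w fg Dw; rewrite fg.
Qed.

Section Simple.
Variable s : {fimfun T >-> X}.
Hypothesis s_meas : forall x, measurable (s @^-1` [set x]).
Hypothesis s_fin : forall x, x != 0 -> (mu (D `&` s @^-1` [set x]) < +oo)%E.

Lemma simple_sumE (V : lmodType R) (l : X -> V) w :
  l (s w) = \sum_(x <- fset_set (range s)) \1_(s @^-1` [set x]) w *: l x.
Proof.
have sw : s w \in fset_set (range s) by rewrite in_fset_set// mem_set//; exists w.
rewrite (big_rem _ sw)/= indicE mem_set// scale1r big1_seq ?addr0// => x /=.
rewrite mem_rem_uniq ?fset_uniq// inE => /andP[xs _].
by rewrite indicE memNset ?scale0r// => /= xE; rewrite xE eqxx in xs.
Qed.

Lemma simple_integral_dual l : dual l ->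
  l (simple_integral mu D s) = \int[mu]_(w in D) l (s w).
Proof.
move=> lX; rewrite /simple_integral fsbig_finite//= dual_sum//.
under [RHS]eq_Rintegral do rewrite (simple_sumE l).
have Ai x : mu.-integrable D (EFin \o (fun w => \1_(s @^-1` [set x]) w *: (l x : R^o))).
  have [->|x0] := eqVneq x 0.
    rewrite dual0// (_ : _ \o _ = cst 0%E); first exact: integrable0.
    by apply/funext => w /=; rewrite scaler0.
  rewrite (_ : _ \o _ = (fun w => (l x)%:E * (EFin \o \1_(s @^-1` [set x])) w)%E).
    apply: integrableZl => //; apply/integrableP; split.
      by apply/measurable_EFinP; exact: measurable_indic.
    under eq_integral do rewrite /= ger0_norm//.
    by rewrite integral_indic// setIC; exact: s_fin.
  by apply/funext => w /=; rewrite -EFinM mulrC.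
rewrite (Rintegral_sum _ Ai); apply: eq_bigr => x _.
rewrite dualZ// mulrC.
have [->|x0] := eqVneq x 0.
  rewrite dual0// mul0r; under eq_Rintegral do rewrite scaler0.
  by rewrite Rintegral_cst// mul0r.
under eq_Rintegral do rewrite /GRing.scale/= mulrC.
rewrite RintegralZl//; last first.
  apply/integrableP; split; first by apply/measurable_EFinP; exact: measurable_indic.
  under eq_integral do rewrite /= ger0_norm//.
  by rewrite integral_indic// setIC; exact: s_fin.
by rewrite /Rintegral integral_indic// setIC.
Qed.

Lemma simple_nrm_lty : (nrm mu D s < +oo)%E.
Proof.
rewrite /nrm.
under eq_integral do rewrite (simple_sumE (fun x => `|x| : R^o)) -sumEFin.
rewrite ge0_integral_sum//=; last 2 first.
- move=> x; apply/measurable_EFinP/measurable_funM; last exact: measurable_cst.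
  exact: measurable_indic.
- by move=> x w _; rewrite lee_fin mulr_ge0.
apply: lte_sum_pinfty => x _.
under eq_integral do rewrite /GRing.scale/= EFinM muleC.
rewrite ge0_integralZl//; last first.
  by apply/measurable_EFinP; exact: measurable_indic.
have [->|x0] := eqVneq x 0; first by rewrite normr0 mul0e.
rewrite integral_indic// setIC; apply: lte_mul_pinfty; rewrite ?lee_fin//.
exact: s_fin.
Qed.

Lemma simple_dmeas : dmeas s.
Proof. exact: dmeas_fin. Qed.

Lemma simple_wint : wint s (simple_integral mu D s).
Proof. exact: simple_integral_dual. Qed.

End Simple.

(** A continuous [l] maps the integrals of the simple approximants to a sequence tending to [l I],
    while the integrals of [l (f - s_ n)] are at most a constant times the L1 distance. One
    approximant at finite distance already makes [f] integrable. *)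
Lemma bochner_integral_wint f I : dmeas f -> is_bochner_integral mu D f I ->
  (nrm mu D f < +oo)%E /\ wint f I.
Proof.
move=> fm [s_ [sm sf _ fs sI]].
have sdm n := simple_dmeas (sm n).
have sfin n := simple_nrm_lty (sm n) (sf n).
have foo : (nrm mu D f < +oo)%E.
  have [n _ nP] : exists2 n, True & (nrm mu D (fun w => f w - s_ n w)%R < 1)%E.
    move/cvge0P : fs => /(_ (fun n => nrm_ge0 _ _ _) 1 ltr01)[n _ nP].
    by exists n => //; exact: nP (leqnn n).
  have -> : f = (fun w => (f w - s_ n w) + s_ n w) by apply/funext => w; rewrite subrK.
  apply: le_lt_trans (nrmD _ X_separable mD (dmeasB fm (sdm n)) (sdm n)) _.
  by rewrite lte_add_pinfty// (lt_trans nP)// ltry.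
split=> // l lX.
have [C C0 lC] := dual_bound lX.
apply: (@cvg_unique _ (@norm_hausdorff R R^o) (l (simple_integral mu D (s_ n)) @[n --> \oo])).
  by apply: continuous_cvg => //; exact: lX.2.
apply/cvgrPdist_le => e e0.
have e1 : 0 < e / (C + 1) by rewrite divr_gt0// ltr_wpDl.
near=> n.
rewrite (simple_integral_dual (sm n) (sf n))//.
rewrite -RintegralB//; try exact: integrable_dual.
under eq_Rintegral do rewrite -dualB//.
have fsn : (nrm mu D (fun w => f w - s_ n w)%R < (e / (C + 1))%:E)%E.
  by near: n; move/cvge0P : fs; apply => // n; exact: nrm_ge0.
have fsoo : (nrm mu D (fun w => f w - s_ n w)%R < +oo)%E.
  by rewrite (lt_trans fsn)// ltry.
apply: le_trans (Rintegral_dual_le X_separable mD (dmeasB fm (sdm n)) fsoo lX C0 lC) _.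
rewrite -lee_fin EFinM fineK ?ge0_fin_numE ?nrm_ge0//.
rewrite (@le_trans _ _ (C%:E * (e / (C + 1))%:E)%E)//.
  by apply: lee_wpmul2l; rewrite ?lee_fin//; exact: ltW.
rewrite -EFinM lee_fin mulrA ler_pdivrMr ?ltr_wpDl//.
by rewrite mulrDr mulr1 [C * e]mulrC lerDl; exact: ltW.
Unshelve. all: by end_near. Qed.

(** The approximants with [|f - s_ n| <= |f|] converge in L1 by domination, so their integrals form
    a Cauchy sequence, and completeness of [X] produces the value. *)
Lemma wint_bochner_integral f : dmeas f -> (nrm mu D f < +oo)%E ->
  exists I, is_bochner_integral mu D f I.
Proof.
move=> fm foo; have [s_ [sm sf sle]] := dmeas_simple X_separable fm.
have sdm n := simple_dmeas (sm n).
have fint : mu.-integrable D (fun w => (`|f w|)%:E).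
  apply/integrableP; split; first exact: measurable_EFin_norm.
  by under eq_integral do rewrite /= normr_id.
(* On this level set [|f - x| <= |f|], hence [|f| >= |x| / 2], and Markov's inequality bounds its
   measure. *)
have sfin n x : x != 0 -> (mu (D `&` s_ n @^-1` [set x]) < +oo)%E.
  move=> x0; have x1 : 0 < `|x| / 2 by rewrite divr_gt0// normr_gt0.
  have mf : measurable_fun D (fun w => (`|f w|)%:E) by apply: measurable_EFin_norm.
  have := le_integral_abse mu mD mf x1.
  under eq_integral do rewrite /= normr_id.
  move=> h; have {}h := le_lt_trans h foo.
  set A := (X in mu X) in h.
  have mA : measurable A.
    have := measurableT_comp (@abse_measurable R setT) mf.
    move=> /(emeasurable_fun_c_infty mD)/(_ (`|x| / 2)%:E); exact.
  have {}h : (mu A < +oo)%E.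
    rewrite ltNge leye_eq; apply/negP => /eqP Aoo.
    by move: h; rewrite Aoo gt0_muley// lte_fin.
  apply: le_lt_trans h; apply: le_mu => //; first exact: measurableI.
  move=> w [Dw /= swx]; split=> //=; rewrite lee_fin normr_id.
  have := sle n w; rewrite swx => h1.
  have := ler_distD (f w) x 0; rewrite !subr0 distrC => h2.
  by rewrite ler_pdivrMr//; lra.
have cvg0 : nrm mu D (fun w => f w - s_ n w) @[n --> \oo] --> 0%E.
  have [|||||_ _] := @dominated_convergence _ _ R mu D mD
      (fun n w => (`|f w - s_ n w|)%:E) (cst 0%E) (fun w => (`|f w|)%:E).
  - by move=> n; apply: measurable_EFin_norm => //; exact: dmeasB.
  - exact: measurable_cst.
  - apply: aeW => w Dw; apply/cvge0P => [n|e e0]; first by rewrite lee_fin.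
    by move/cvgrPdist_lt : (sf w) => /(_ e e0).
  - exact: fint.
  - by apply: aeW => w n Dw; rewrite /= lee_fin normr_id.
  by rewrite integral0.
have nfs n : (nrm mu D (fun w => f w - s_ n w)%R < +oo)%E.
  apply: le_lt_trans foo; apply: le_nrm_ae => //; first exact: dmeasB.
    exact: measurable_norm_dmeas.
  exact: aeW.
have sfoo n := simple_nrm_lty (sm n) (sfin n).
have sI n := simple_wint (sm n) (sfin n).
have : cvgn (fun n => simple_integral mu D (s_ n)).
  apply: cauchy_cvg; apply/cauchy_ballP => e e0; rewrite near_map2.
  have e2 : 0 < e / 2 by rewrite divr_gt0.
  move/cvge0P : cvg0 => /(_ (fun n => nrm_ge0 _ _ _) _ e2)[N _ NP].
  exists ([set n | (N <= n)%N], [set n | (N <= n)%N]) => /=; first by split; exists N.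
  move=> [n m] [/= Nn Nm]; rewrite -ball_normE/= -lte_fin.
  apply: le_lt_trans (wint_dist_bound (sdm n) (sdm m) (sfoo n) (sfoo m) (sI n) (sI m)) _.
  apply: le_lt_trans (nrm_dist_trans _ X_separable mD (sdm n) fm (sdm m)) _.
  rewrite nrm_distC (splitr e) EFinD lteD//; exact: NP.
move=> /cvg_ex[I sII]; exists I, s_; split => //.
by apply: aeW => w _; exact: sf.
Qed.

Lemma is_bochner_integralP f I : dmeas f -> (nrm mu D f < +oo)%E ->
  is_bochner_integral mu D f I <-> wint f I.
Proof.
move=> fm foo; split=> [/(bochner_integral_wint fm)[]//|fI].
have [J fJ] := wint_bochner_integral fm foo.
by have [_ /(wint_unique fI) ->] := bochner_integral_wint fm fJ.
Qed.

Lemma wint_exists f : dmeas f -> (nrm mu D f < +oo)%E -> exists I, wint f I.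
Proof.
move=> fm foo; have [I fI] := wint_bochner_integral fm foo.
by exists I; apply/is_bochner_integralP.
Qed.

Lemma bochner_integral_eq0 f : dmeas f -> ~ (nrm mu D f < +oo)%E ->
  bochner_integral mu D f = 0.
Proof.
move=> fm foo; rewrite /bochner_integral; case: xgetP => // I _.
by move=> /(bochner_integral_wint fm)[].
Qed.

Lemma wint_bochner f : dmeas f -> (nrm mu D f < +oo)%E ->
  wint f (bochner_integral mu D f).
Proof.
move=> fm foo; apply: (bochner_integral_wint fm _).2.
by apply: xgetPex; exact: wint_bochner_integral.
Qed.

End Bochner.

(** * Almost everywhere and almost uniform convergence *)

Section HalfPowers.
Variable R : realType.

Lemma half_pow_gt0 n : 0 < (2^-1 : R) ^+ n.
Proof. by rewrite exprn_gt0// invr_gt0. Qed.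

Lemma half_pow_lt (e : R) : 0 < e -> \forall n \near \oo, (2^-1 : R) ^+ n < e.
Proof.
move=> e0; have /cvgrPdist_lt/(_ e e0) : (2^-1 : R) ^+ n @[n --> \oo] --> (0 : R^o).
  by apply: cvg_expr; rewrite ger0_norm ?invr_ge0// invf_lt1// ltr1n.
by apply: filterS => n; rewrite sub0r normrN ger0_norm// ltW// half_pow_gt0.
Qed.

Lemma sum_half_pow_le m n (C : R) : 0 <= C ->
  \sum_(m <= i < n) C * 2^-1 ^+ i <= 2 * C * 2^-1 ^+ m.
Proof.
move=> C0; have [nm|mn] := leqP n m.
  by rewrite big_geq// mulr_ge0// ?mulr_ge0// ltW// half_pow_gt0.
suff -> : \sum_(m <= i < n) C * 2^-1 ^+ i = 2 * C * 2^-1 ^+ m - 2 * C * 2^-1 ^+ n.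
  by rewrite gerBl mulr_ge0// ?mulr_ge0// ltW// half_pow_gt0.
rewrite -(subnKC (ltnW mn)); elim: (n - m)%N => [|k IH].
  by rewrite addn0 big_geq// subrr.
rewrite addnS big_nat_recr/= ?leq_addr// IH exprS.
by field.
Qed.

Lemma nneseries_half_pow_lty (u : nat -> \bar R) (C : R) : 0 <= C ->
  (forall n, 0 <= u n)%E -> (forall n, u n <= (C * 2^-1 ^+ n)%:E)%E ->
  (\sum_(n <oo) u n < +oo)%E.
Proof.
move=> C0 u0 uC; apply: (@le_lt_trans _ _ (2 * C)%:E); last exact: ltry.
apply: lime_le; first by apply: is_cvg_nneseries => n _ _; exact: u0.
apply: nearW => n; apply: (@le_trans _ _ (\sum_(0 <= i < n) (C * 2^-1 ^+ i)%:E)%E).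
  by apply: lee_sum => i _; exact: uC.
by rewrite sumEFin lee_fin -[leRHS]mulr1 -(expr0 (2^-1 : R)) sum_half_pow_le.
Qed.

End HalfPowers.

(** * Almost everywhere limits of sequences that converge fast in L1 *)

Section SummableConvergence.
Context (R : realType) d (T : measurableType d).
Variable mu : {measure set T -> \bar R}.

Lemma ae_cvg_series (u_ : nat -> T -> R) (C : R) : 0 <= C ->
  (forall n, measurable_fun setT (u_ n)) -> (forall n w, 0 <= u_ n w) ->
  (forall n, \int[mu]_w (u_ n w)%:E <= (C * 2^-1 ^+ n)%:E)%E ->
  {ae mu, forall w, cvgn (series (fun n => u_ n w))}.
Proof.
move=> C0 um u0 uC.
have um' n : measurable_fun setT (fun w => (u_ n w)%:E) by exact/measurable_EFinP.
have soo : (\int[mu]_w (\sum_(n <oo) (u_ n w)%:E) < +oo)%E.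
  rewrite integral_nneseries//; last by move=> n w _; rewrite lee_fin.
  apply: nneseries_half_pow_lty C0 _ uC => n.
  by apply: integral_ge0 => w _; rewrite lee_fin.
have s0 w : (0 <= \sum_(n <oo) (u_ n w)%:E)%E.
  by apply: nneseries_ge0 => n _ _; rewrite lee_fin.
have : mu.-integrable setT (fun w => \sum_(n <oo) (u_ n w)%:E)%E.
  apply/integrableP; split.
    apply: ge0_emeasurable_sum => // n w _ _; by rewrite lee_fin.
  by under eq_integral do rewrite gee0_abs//.
move=> /(integrable_ae measurableT); apply: filterS => w /(_ Logic.I).
rewrite ge0_fin_numE// => sw.
apply: nondecreasing_is_cvgn.
  apply/nondecreasing_seqP => n; rewrite /series/= big_nat_recr//=.
  by rewrite lerDl.
exists (fine (\sum_(n <oo) (u_ n w)%:E)%E) => _ [n _ <-].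
rewrite -lee_fin fineK ?ge0_fin_numE// /series/= -sumEFin.
by apply: (@nneseries_lim_ge _ (fun n => (u_ n w)%:E)) => k _ _; rewrite lee_fin.
Qed.

Section Vector.
Variable X : completeNormedModType R.
Hypothesis X_separable : separable X.
Implicit Types f g : T -> X.

Lemma ae_cvg_fast (f_ : nat -> T -> X) f (C : R) : 0 <= C ->
  (forall n, dmeas (f_ n)) -> dmeas f ->
  (forall n, nrm mu setT (fun w => f_ n w - f w)%R <= (C * 2^-1 ^+ n)%:E)%E ->
  {ae mu, forall w, f_ n w @[n --> \oo] --> f w}.
Proof.
move=> C0 fm gm fC.
have := ae_cvg_series C0 (fun n => measurable_dist_dmeas X_separable (fm n) gm)
  (fun n w => normr_ge0 _) fC.
apply: filterS => w /cvg_series_cvg_0 /cvgrPdist_lt h.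
apply/cvgrPdist_lt => e /h; apply: filterS => n.
by rewrite sub0r normrN normr_id distrC.
Qed.

Lemma nrm_fatou (f_ : nat -> T -> X) g (c : \bar R) :
  (forall n, dmeas (f_ n)) -> dmeas g ->
  {ae mu, forall w, f_ n w @[n --> \oo] --> g w} ->
  (forall n, nrm mu setT (f_ n) <= c)%E -> (nrm mu setT g <= c)%E.
Proof.
move=> fm gm fg fc.
have mf m : measurable_fun setT (fun w => (`|f_ m w|)%:E).
  exact: measurable_EFin_norm.
have -> : nrm mu setT g = (\int[mu]_w limn_einf (fun m => (`|f_ m w|)%:E))%E.
  apply: ae_eq_integral => //.
  - exact: measurable_EFin_norm.
  - under eq_fun do rewrite -[limn_einf _]oppeK -limn_esupN.
    apply: measurableT_comp => //; apply: measurable_fun_limn_esup => m.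
    by apply: measurableT_comp => //; exact: mf.
  - apply: filterS fg => w fw _; apply/esym.
    suff /cvg_limn_einf_sup[] : (`|f_ m w|)%:E @[m --> \oo] --> (`|g w|)%:E by [].
    by apply: cvg_EFin; [exact: nearW|exact: cvg_norm].
apply: le_trans (fatou mu measurableT mf _) _ => [m w _|]; first by rewrite lee_fin.
rewrite limn_einf_lim; apply: lime_le; first exact: is_cvg_einfs.
by apply: nearW => m; apply: ereal_inf_le; exists (nrm mu setT (f_ m)) => //; exists m => /=.
Qed.

(** [Q] is the set of points where the sequence is Cauchy, and the limit is set to 0 elsewhere. No
    measure is involved, so on a product space the same [g] serves all slices at once. *)
Lemma dmeas_seqlim (f_ : nat -> T -> X) : (forall n, dmeas (f_ n)) ->
  exists2 g, dmeas g & forall w, cvgn (fun n => f_ n w) -> f_ n w @[n --> \oo] --> g w.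
Proof.
move=> fm.
pose Q := \bigcap_k \bigcup_N \bigcap_m
  [set w | `|f_ (N + m)%N w - f_ N w| < (2^-1 : R) ^+ k].
have mQ : measurable Q.
  apply: bigcap_measurable => // k _; apply: bigcupT_measurable => N.
  apply: bigcap_measurable => // m _.
  have := measurable_fun_ltr (measurable_dist_dmeas X_separable (fm (N + m)%N) (fm N))
    (measurable_cst ((2^-1 : R) ^+ k)).
  by move=> /(_ measurableT [set true]); rewrite setTI; exact.
have Qcvg w : Q w -> cvgn (fun n => f_ n w).
  move=> Qw; apply: cauchy_cvg; apply/cauchy_ballP => e e0; rewrite near_map2.
  have e2 : 0 < e / 2 by rewrite divr_gt0.
  have [k _ /(_ k (leqnn _)) ke] := half_pow_lt e2.
  have [N _ NP] := Qw k Logic.I.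
  exists ([set n | (N <= n)%N], [set n | (N <= n)%N]) => /=; first by split; exists N.
  move=> [n m] [/= Nn Nm]; rewrite -ball_normE/=.
  have hn := NP (n - N)%N Logic.I; have hm := NP (m - N)%N Logic.I.
  rewrite /= subnKC// in hn; rewrite /= subnKC// in hm.
  rewrite (le_lt_trans (ler_distD (f_ N w) _ _))//.
  by rewrite (distrC (f_ N w)); lra.
have cvgQ w : cvgn (fun n => f_ n w) -> Q w.
  move=> /cvg_ex[l /cvgrPdist_lt h] k _.
  have e0 : 0 < (2^-1 : R) ^+ k / 2 by rewrite divr_gt0// half_pow_gt0.
  have [N _ NP] := h _ e0; exists N => // m _ /=.
  have := NP N (leqnn _); have := NP (N + m)%N (leq_addr _ _) => /= h1 h2.
  rewrite (le_lt_trans (ler_distD l _ _))//.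
  by rewrite (distrC (f_ (N + m)%N w)); lra.
pose g w := if w \in Q then limn (fun n => f_ n w) else 0.
exists g.
  apply: (@dmeas_lim _ _ _ _ (fun n w => if w \in Q then f_ n w else 0)).
    by move=> n; apply: dmeas_if => //; exact: dmeas_cst.
  move=> w; rewrite /g; case: ifPn => [/set_mem Qw|_]; last exact: cvg_cst.
  exact: Qcvg.
move=> w cw; rewrite /g mem_set//; exact: cvgQ.
Qed.

Lemma fast_cauchy_limit (f_ : nat -> T -> X) (C : R) : 0 <= C ->
  (forall n, dmeas (f_ n)) ->
  (forall n, nrm mu setT (fun w => f_ n.+1 w - f_ n w)%R <= (C * 2^-1 ^+ n)%:E)%E ->
  exists g, [/\ dmeas g, {ae mu, forall w, f_ n w @[n --> \oo] --> g w} &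
    forall n, (nrm mu setT (fun w => f_ n w - g w)%R <= (2 * C * 2^-1 ^+ n)%:E)%E].
Proof.
move=> C0 fm fC; have [g gm gP] := dmeas_seqlim fm.
have gl : {ae mu, forall w, f_ n w @[n --> \oo] --> g w}.
  have := ae_cvg_series C0
    (fun n => measurable_dist_dmeas X_separable (fm n.+1) (fm n))
    (fun n w => normr_ge0 _) fC.
  apply: filterS => w h; apply: gP.
  have /cvg_ex[s sP] : cvgn (series (fun n => f_ n.+1 w - f_ n w)) by exact: normed_cvg.
  apply/cvg_ex; exists (s + f_ 0%N w).
  rewrite (_ : (fun n => f_ n w) = (fun n => series (fun n => f_ n.+1 w - f_ n w) n + f_ 0%N w)).
    by apply: cvgD => //; exact: cvg_cst.
  by apply/funext => n; rewrite /series/= telescope_sumr// subrK.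
exists g; split => // n.
have dist m : (nrm mu setT (fun w => f_ n w - f_ (n + m)%N w)%R <= (2 * C * 2^-1 ^+ n)%:E)%E.
  apply: (@le_trans _ _ (\sum_(n <= i < n + m) C * 2^-1 ^+ i)%:E); last first.
    by rewrite lee_fin sum_half_pow_le.
  elim: m => [|m IH].
    rewrite addn0 big_geq// /nrm; under eq_integral do rewrite subrr normr0.
    by rewrite integral0.
  rewrite addnS big_nat_recr/= ?leq_addr// EFinD.
  apply: le_trans (nrm_dist_trans _ X_separable measurableT (fm _) (fm (n + m)%N) (fm _)) _.
  by rewrite leeD// nrm_distC.
apply: (nrm_fatou (f_ := fun m w => f_ n w - f_ (n + m)%N w)) dist.
- by move=> m; exact: dmeasB.
- exact: dmeasB.
- apply: filterS gl => w fw; apply: cvgB; first exact: cvg_cst.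
  by under eq_fun do rewrite addnC; move: fw; rewrite -(cvg_shiftn n).
Qed.

End Vector.
End SummableConvergence.

(** * Essential unions *)

Section EssentialUnion.
Context (R : realType) d (T : measurableType d).
Variable mu : {finite_measure set T -> \bar R}.

Lemma fin_mu (A : set T) : measurable A -> (mu A < +oo)%E.
Proof. by move=> mA; rewrite -ge0_fin_numE// fin_num_measure. Qed.

(** An uncountable union may fail to be measurable. Here [B] is an increasing union of finite unions
    whose measures approach the supremum [m] over all finite unions; if some [S i] exceeded [B] by
    positive measure, adding it would exceed [m]. The last clause turns a bound on all finite unions
    into a bound on [B], which is how a maximal inequality passes from finitely many indices to a
    half-line. *)
Lemma essential_union (I : Type) (D : set I) (S : I -> set T) :
  (forall i, D i -> measurable (S i)) ->
  exists B, [/\ measurable B, B `<=` \bigcup_(i in D) S i,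
    forall i, D i -> mu (S i `\` B) = 0%E &
    forall c, (forall s : seq I, (forall i, List.In i s -> D i) ->
      (mu (\big[setU/set0]_(i <- s) S i) <= c)%E) -> (mu B <= c)%E].
Proof.
move=> mS; pose U (s : seq I) := \big[setU/set0]_(i <- s) S i.
pose P (s : seq I) := forall i, List.In i s -> D i.
have mU s : P s -> measurable (U s).
  elim: s => [|i s IH] Ps; rewrite /U ?big_nil// big_cons.
  apply: measurableU; first by apply: mS; apply: Ps; left.
  by apply: IH => j js; apply: Ps; right.
have UD s : P s -> U s `<=` \bigcup_(i in D) S i.
  elim: s => [|i s IH] Ps; rewrite /U ?big_nil// big_cons.
  rewrite subUset; split; last by apply: IH => j js; apply: Ps; right.
  by move=> w Sw; exists i => //; apply: Ps; left.
have Ucat s1 s2 : U (s1 ++ s2) = U s1 `|` U s2 by rewrite /U big_cat.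
have Pcat s1 s2 : P s1 -> P s2 -> P (s1 ++ s2).
  by move=> P1 P2 i h; case: (List.in_app_or s1 s2 i h) => [/P1|/P2].
pose m := ereal_sup [set mu (U s) | s in P].
have Um s : P s -> (mu (U s) <= m)%E by move=> Ps; apply: ereal_sup_ubound; exists s.
have P0 : P [::] by [].
have m_fin : m \is a fin_num.
  rewrite ge0_fin_numE; last by apply: le_trans (Um _ P0).
  apply: le_lt_trans (fin_mu measurableT); apply: ge_ereal_sup => _ [s Ps <-].
  by apply: le_mu => //; exact: mU.
have /choice[s_ sP] n : exists s, P s /\ (m - (2^-1 ^+ n)%:E < mu (U s))%E.
  have [x [s Ps sx] h] :=
    @ub_ereal_sup_adherent R [set mu (U s) | s in P] (2^-1 ^+ n) (half_pow_gt0 R n) m_fin.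
  by exists s; rewrite sx.
pose t_ := fix t_ n := if n is k.+1 then s_ n ++ t_ k else s_ 0%N.
have Pt n : P (t_ n).
  elim: n => [|n IH]; first by case: (sP 0%N).
  by apply: Pcat => //; case: (sP n.+1).
have tnd : {homo (fun n => U (t_ n)) : n k / (n <= k)%N >-> (n <= k)%O}.
  move=> n k /subnK <-; elim: (k - n)%N => [//|i IH].
  by rewrite addSn; apply: (le_trans IH); apply/subsetPset; rewrite /= Ucat; right.
have st n : U (s_ n) `<=` U (t_ n).
  by case: n => [//|n]; rewrite /= Ucat; left.
have mt n : measurable (U (t_ n)) by apply: mU.
pose B := \bigcup_n U (t_ n).
have mB : measurable B by exact: bigcup_measurable.
have Bm : (m <= mu B)%E.
  apply/lee_addgt0Pr => e e0.
  have [n _ /(_ n (leqnn _)) ne] := half_pow_lt e0.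
  have [Ps h] := sP n.
  rewrite -leeBlDr//; apply: le_trans (ltW (lt_le_trans h _)).
    by rewrite leeB// lee_fin ltW.
  by apply: le_mu => //; [exact: mU|move=> w /st; exists n].
have cvgB : (mu \o (fun n => U (t_ n))) n @[n --> \oo] --> mu B.
  exact: nondecreasing_cvg_mu.
exists B; split=> //.
- by move=> w [n _ /UD]; apply.
- move=> i Di; pose V n := U (i :: t_ n).
  have VE n : V n = S i `|` U (t_ n) by rewrite /V /U big_cons.
  have Pi n : P (i :: t_ n) by move=> j [<-//|]; exact: Pt.
  have cvgV : (mu \o V) n @[n --> \oo] --> mu (\bigcup_n V n).
    apply: nondecreasing_cvg_mu => [n||n k nk]; first exact: mU.
      by apply: bigcup_measurable => n _; exact: mU.
    apply/subsetPset; rewrite !VE; apply: setUS.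
    by have /subsetPset := tnd _ _ nk.
  have Vm : (mu (\bigcup_n V n) <= m)%E.
    apply: cvge_to_le cvgV _; apply: nearW => n; exact: Um.
  have EV : \bigcup_n V n = B `|` (S i `\` B).
    apply/seteqP; split=> [w [n _]|w].
      rewrite VE => -[Sw|Uw]; last by left; exists n.
      by have [Bw|Bw] := pselect (B w); [left|right].
    move=> [[n _ Uw]|[Sw _]]; first by exists n => //; rewrite VE; right.
    by exists 0%N => //; rewrite VE; left.
  have mD : measurable (S i `\` B) by apply: measurableD => //; exact: mS.
  move: Vm; rewrite EV measureU//; last first.
    by rewrite setIDA setIC -setIDA setDv setI0.
  move=> h; have {}h := le_trans h Bm.
  apply/eqP; rewrite eq_le measure_ge0 andbT.
  by move: h; rewrite -[leRHS]adde0 leeD2lE//; exact: fin_num_measure.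
- move=> c cP; apply: cvge_to_le cvgB _; apply: nearW => n; exact: cP (Pt n).
Qed.

End EssentialUnion.

Section AlmostUniform.
Context (R : realType) d (T : measurableType d).
Variable mu : {finite_measure set T -> \bar R}.
Variable X : completeNormedModType R.
Hypothesis X_separable : separable X.
Variables (I : Type) (E : nat -> set I).

(* Almost uniform convergence along the tails [E N], modulo a null set that may
   depend on the index. *)
Definition au_cvg (u : I -> T -> X) (l : T -> X) :=
  forall lam eps : R, 0 < lam -> 0 < eps -> exists N B,
    [/\ measurable B, (mu B <= eps%:E)%E &
        forall i, E N i -> {ae mu, forall w, ~ B w -> `|u i w - l w| <= lam}].

(** Choose exceptional sets of measure at most [2^-1 ^+ k] for accuracy [2^-1 ^+ k]; by
    Borel-Cantelli almost every point lies in finitely many of them. For each [i] the estimates also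
    fail on a null set [Z i], where the version is redefined to equal the limit; the last hypothesis
    on [V] permits exactly such changes. *)
Lemma au_cvg_ae_versions (D : set I) (Fi : set_system I) {FF : Filter Fi}
    (V : I -> set (T -> X)) u l :
  (forall N, \forall i \near Fi, E N i) -> au_cvg u l ->
  (forall i, D i -> forall Z, measurable Z -> mu Z = 0%E ->
     V i (fun w => if w \in Z then l w else u i w)) ->
  cvg_ae_versions mu D Fi V l.
Proof.
move=> FE ul VZ.
have /choice[NB NBP] (k : nat) : exists NB : nat * set T,
    [/\ measurable NB.2, (mu NB.2 <= (2^-1 ^+ k)%:E)%E &
     forall i, E NB.1 i ->
       {ae mu, forall w, ~ NB.2 w -> `|u i w - l w| <= 2^-1 ^+ k}].
  have [N [B h]] := ul _ _ (half_pow_gt0 R k) (half_pow_gt0 R k).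
  by exists (N, B).
have /choice[Z ZP] i : exists Z, [/\ measurable Z, mu Z = 0%E &
    forall w, ~ Z w -> forall k, E (NB k).1 i -> ~ (NB k).2 w ->
      `|u i w - l w| <= 2^-1 ^+ k].
  have : {ae mu, forall w k, E (NB k).1 i -> ~ (NB k).2 w -> `|u i w - l w| <= 2^-1 ^+ k}.
    apply: ae_foralln => k; have [_ _ h] := NBP k.
    have [Ei|nEi] := pselect (E (NB k).1 i); last by apply: aeW => w.
    by apply: filterS (h _ Ei) => w hw _.
  move=> [Z [mZ Z0 ZP]]; exists Z; split=> // w nZw.
  by apply: contrapT => hw; apply: nZw; exact: ZP.
exists (fun i w => if w \in Z i then l w else u i w); split.
  by move=> i Di; have [mZ Z0 _] := ZP i; exact: VZ.
pose L := lim_sup_set (fun k => (NB k).2).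
have mNB k : measurable (NB k).2 by case: (NBP k).
have L0 : mu L = 0%E.
  apply: lim_sup_set_cvg0 => //.
  apply: (@nneseries_half_pow_lty _ _ 1) => // k; rewrite mul1r.
  by case: (NBP k).
have mL : measurable L.
  by apply: bigcap_measurable => // n _; exact: bigcup_measurable.
exists L; split=> // w nw; apply: contrapT => nLw; apply: nw.
have [n nP] : exists n, forall j, (n <= j)%N -> ~ (NB j).2 w.
  apply: contrapT => /forallNP h; apply: nLw => n _.
  by have /existsNP[j /not_implyP[nj /contrapT Bj]] := h n; exists j.
apply/cvgrPdist_lt => e e0; have [k0 _ k0P] := half_pow_lt e0.
pose k := maxn n k0.
have ke : (2^-1 : R) ^+ k < e by apply: k0P; rewrite /= leq_maxr.
apply: filterS (FE (NB k).1) => i Ei.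
case: ifPn => [_|/negP nZ]; first by rewrite subrr normr0.
rewrite distrC; apply: le_lt_trans ke; have [_ _ ZPi] := ZP i.
apply: ZPi => //; first by move=> /mem_set.
by apply: nP; rewrite leq_maxl.
Qed.

(** Egorov's argument, with the essential union [B_ N] of the sets where [|u i - l| > lam] over a
    tail. As [B_ N] lies inside the true union, a point of infinitely many [B_ N] is a point of
    divergence. What a single set has outside [B_ N] is null and becomes the null set that depends
    on the index. *)
Lemma au_cvg_of_ae_cvg (Fi : set_system I) {FF : ProperFilter Fi} u l :
  (forall A, Fi A -> exists N, E N `<=` A) ->
  (forall N i, E N.+1 i -> E N i) ->
  (forall i, E 0%N i -> dmeas (u i)) -> dmeas l ->
  {ae mu, forall w, u i w @[i --> Fi] --> l w} -> au_cvg u l.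
Proof.
move=> FE Edec um lm ul lam eps lam0 eps0.
have EdecN N i : E N i -> E 0%N i by elim: N => // N IH /Edec.
have EdecM N M i : (N <= M)%N -> E M i -> E N i.
  by move=> /subnK <-; elim: (M - N)%N => // k IH; rewrite addSn => /Edec.
pose S i := [set w | lam < `|u i w - l w|].
have mS i : E 0%N i -> measurable (S i).
  move=> Ei; have := measurable_fun_ltr (measurable_cst lam)
    (measurable_dist_dmeas X_separable (um i Ei) lm).
  by move=> /(_ measurableT [set true]); rewrite setTI; exact.
have /choice[B_ BP] N := @essential_union R d T mu I (E N) S (fun i Ei => mS i (EdecN N i Ei)).
(* The [B_ N] need not be nested, and continuity from above requires a decreasing sequence. *)
pose C N := \bigcup_(M >= N) B_ M.
have mB N : measurable (B_ N) by case: (BP N).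
have mC N : measurable (C N) by exact: bigcup_measurable.
have [Z [mZ Z0 ZP]] := ul.
have CZ : \bigcap_N C N `<=` Z.
  move=> w Cw; apply: ZP => /= /cvgrPdist_le/(_ lam lam0)/FE[N NP].
  have [M NM BM] := Cw N Logic.I.
  have [_ /(_ w BM)[i Ei Si] _ _] := BP M.
  have := NP i (EdecM _ _ _ NM Ei); rewrite distrC leNgt => /negP; apply.
  exact: Si.
have mbC : measurable (\bigcap_N C N) by exact: bigcap_measurable.
have C0 : mu (\bigcap_N C N) = 0%E.
  apply/eqP; rewrite eq_le measure_ge0 andbT -Z0.
  exact: le_mu.
have : (mu \o C) N @[N --> \oo] --> mu (\bigcap_N C N).
  apply: nonincreasing_cvg_mu => //; first exact: fin_mu.
  move=> N M NM; apply/subsetPset => w [k /= Mk Bk].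
  by exists k => //=; exact: leq_trans Mk.
rewrite C0 => /cvge0P hc; have [//|N _ /(_ N (leqnn _))] := hc _ _ eps0.
move=> /= CN; exists N, (C N); split=> //; first exact: ltW.
move=> i Ei; have [_ _ /(_ i Ei) h _] := BP N.
exists (S i `\` B_ N); split=> //.
  by apply: measurableD => //; apply: mS; exact: EdecN Ei.
move=> w /= /not_implyP[nC nS]; split; first by rewrite /S /= ltNge; exact/negP.
by move=> Bw; apply: nC; exists N => /=.
Qed.

Lemma au_cvg_trans u v l : (forall lam eps : R, 0 < lam -> 0 < eps -> exists N B,
    [/\ measurable B, (mu B <= eps%:E)%E &
        forall i, E N i -> {ae mu, forall w, ~ B w -> `|u i w - v i w| <= lam}]) ->
  (forall N i, E N.+1 i -> E N i) -> au_cvg v l -> au_cvg u l.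
Proof.
move=> uv Edec vl lam eps lam0 eps0.
have EdecM N M i : (N <= M)%N -> E M i -> E N i.
  by move=> /subnK <-; elim: (M - N)%N => // k IH; rewrite addSn => /Edec.
have lam2 : 0 < lam / 2 by rewrite divr_gt0.
have eps2 : 0 < eps / 2 by rewrite divr_gt0.
have [N1 [B1 [mB1 B1e h1]]] := uv _ _ lam2 eps2.
have [N2 [B2 [mB2 B2e h2]]] := vl _ _ lam2 eps2.
exists (maxn N1 N2), (B1 `|` B2); split; first exact: measurableU.
  apply: le_trans (measureU2 mu mB1 mB2) _.
  by rewrite (splitr eps) EFinD leeD.
move=> i Ei; have := h1 i (EdecM _ _ _ (leq_maxl _ _) Ei).
apply: filterS2 (h2 i (EdecM _ _ _ (leq_maxr _ _) Ei)) => w hw2 hw1 nB.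
rewrite (le_trans (ler_distD (v i w) _ _))// (splitr lam) lerD//.
  by apply: hw1 => Bw; apply: nB; left.
by apply: hw2 => Bw; apply: nB; right.
Qed.

End AlmostUniform.

(** * Conditional expectations and martingales *)

Section AeComparison.
Context (R : realType) d (T : measurableType d).
Variable mu : {measure set T -> \bar R}.
Implicit Types u v : T -> R.
Local Notation int u := (mu.-integrable setT (EFin \o u)).

Lemma integrable_measurable u : int u -> measurable_fun setT u.
Proof. by move=> /measurable_int/measurable_EFinP. Qed.

Lemma ae_le_of_Rintegral u v : int u -> int v ->
  (forall A, measurable A -> \int[mu]_(w in A) u w <= \int[mu]_(w in A) v w) ->
  {ae mu, forall w, u w <= v w}.
Proof.
move=> ui vi uv; have um := integrable_measurable ui; have vm := integrable_measurable vi.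
pose A := [set w | v w < u w].
have mA : measurable A.
  have := measurable_fun_ltr vm um.
  by move=> /(_ measurableT [set true]); rewrite setTI; exact.
have uA := integrableS measurableT mA (@subsetT _ _) ui.
have vA := integrableS measurableT mA (@subsetT _ _) vi.
have uvA : mu.-integrable A (EFin \o (u \- v)).
  by rewrite (_ : _ \o _ = (EFin \o u) \- (EFin \o v))%E//; exact: integrableB.
have h : \int[mu]_(w in A) (u w - v w) <= 0 by rewrite RintegralB// subr_le0 uv.
have : (\int[mu]_(w in A) `|(u w - v w)%:E| = 0)%E.
  apply/eqP; rewrite eq_le; apply/andP; split; last by apply: integral_ge0.
  have -> : (\int[mu]_(w in A) `|(u w - v w)%:E| = \int[mu]_(w in A) (u w - v w)%:E)%E.
    apply: eq_integral => w /set_mem Aw; rewrite gee0_abs// lee_fin subr_ge0.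
    exact: ltW.
  have : (\int[mu]_(w in A) (u w - v w)%:E)%E \is a fin_num.
    exact: integrable_fin_num uvA.
  by move=> /fineK <-; rewrite lee_fin.
move=> /(ae_eq_integral_abs mu mA (measurable_int _ uvA)).
apply: filterS => w /= uv0; rewrite leNgt; apply/negP => Aw.
by have /eqP := uv0 Aw; rewrite eqe subr_eq0 gt_eqF.
Qed.

Lemma int_comb (a : R) u v : int u -> int v -> int (fun w => a * u w + v w).
Proof.
move=> ui vi; rewrite (_ : _ \o _ = (fun w => a%:E * (EFin \o u) w) \+ (EFin \o v))%E//.
by apply: integrableD => //; exact: integrableZl.
Qed.

Lemma Rintegral_comb (a : R) u v A : measurable A -> int u -> int v ->
  \int[mu]_(w in A) (a * u w + v w) = a * \int[mu]_(w in A) u w + \int[mu]_(w in A) v w.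
Proof.
move=> mA ui vi; have uA := integrableS measurableT mA (@subsetT _ _) ui.
have vA := integrableS measurableT mA (@subsetT _ _) vi.
rewrite RintegralD//; first by rewrite RintegralZl.
by rewrite (_ : _ \o _ = (fun w => a%:E * (EFin \o u) w)%E)//; exact: integrableZl.
Qed.

Lemma le_Rintegral_ae_in u v A : measurable A -> int u -> int v ->
  {ae mu, forall w, A w -> u w <= v w} ->
  \int[mu]_(w in A) u w <= \int[mu]_(w in A) v w.
Proof.
move=> mA ui vi uv; rewrite -subr_ge0.
have uA := integrableS measurableT mA (@subsetT _ _) ui.
have vA := integrableS measurableT mA (@subsetT _ _) vi.
rewrite -RintegralB//.
have uvm : measurable_fun A (fun w => (v w - u w)%:E).
  by apply/measurable_EFinP/measurable_funTS/measurable_funB; exact: integrable_measurable.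
have -> : \int[mu]_(w in A) (v w - u w) = fine (\int[mu]_(w in A) (`|v w - u w|)%:E)%E.
  congr fine; apply: ae_eq_integral => //.
    by apply/measurable_EFinP/measurableT_comp => //; exact/measurable_EFinP.
  by apply: filterS uv => w uv Aw; rewrite ger0_norm// subr_ge0 uv.
by rewrite fine_ge0// integral_ge0// => w _; rewrite lee_fin.
Qed.

Lemma le_Rintegral_ae u v A : measurable A -> int u -> int v ->
  {ae mu, forall w, u w <= v w} -> \int[mu]_(w in A) u w <= \int[mu]_(w in A) v w.
Proof.
by move=> mA ui vi uv; apply: le_Rintegral_ae_in => //; apply: filterS uv.
Qed.

Lemma Rintegral_setC u A : measurable A -> int u ->
  \int[mu]_w u w = \int[mu]_(w in A) u w + \int[mu]_(w in ~` A) u w.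
Proof.
move=> mA ui; rewrite -[in LHS](setUv A) Rintegral_setU//.
- exact: measurableC.
- by rewrite setUv.
- by apply/disj_setPS; rewrite setICr.
Qed.

End AeComparison.

(** * Densities of additive set functions dominated by the measure *)

Section BoundedAdditive.
Context (R : realType) d (T : measurableType d).
Variable mu : {finite_measure set T -> \bar R}.

Section Charge.
Variables (nu : set T -> R) (C : R).
Hypothesis nu_add : forall A B, measurable A -> measurable B -> A `&` B = set0 ->
  nu (A `|` B) = nu A + nu B.
Hypothesis nu_le : forall A, measurable A -> `|nu A| <= C * fine (mu A).

Let nu0 : nu set0 = 0.
Proof.
by have := nu_add measurable0 measurable0 (set0I _); rewrite setU0; lra.
Qed.

Let nuE (A : set T) : \bar R := (nu A)%:E.

Let nuE0 : nuE set0 = 0%E. Proof. by rewrite /nuE nu0. Qed.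

Let nuE_fin A : measurable A -> nuE A \is a fin_num. Proof. by []. Qed.

Let nu_sum (F : nat -> set T) n : (forall i, measurable (F i)) -> trivIset setT F ->
  nu (\bigcup_(i < n) F i) = \sum_(0 <= i < n) nu (F i).
Proof.
move=> mF tF; elim: n => [|n IH]; first by rewrite big_geq// bigcup_mkord big_ord0.
rewrite big_nat_recr//= -IH -nu_add//.
- congr nu; apply/seteqP; split=> [w [i /= ni Fi]|w [[i /= ni Fi]|Fn]].
  + move: ni; rewrite ltnS leq_eqVlt => /predU1P[<-|ni]; first by right.
    by left; exists i.
  + by exists i => //=; rewrite ltnW.
  + by exists n => /=.
- by apply: bigcup_measurable.
- apply/seteqP; split=> // w [[i /= ni Fi] Fn].
  have := tF i n Logic.I Logic.I; move=> /(_ (ex_intro _ w (conj Fi Fn))) iE.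
  by rewrite iE ltnn in ni.
Qed.

Let nuE_sigma_additive : semi_sigma_additive nuE.
Proof.
move=> F mF tF mUF.
have -> : (fun n => \sum_(0 <= i < n) nuE (F i))%E =
    (fun n => (nu (\bigcup_(i < n) F i))%:E).
  by apply/funext => n; rewrite nu_sum// /nuE sumEFin.
apply: cvg_EFin; first exact: nearW.
pose D n := \bigcup_k F k `\` \bigcup_(i < n) F i.
have mU n : measurable (\bigcup_(i < n) F i) by apply: bigcup_measurable.
have mD n : measurable (D n) by exact: measurableD.
have Dnu n : nu (\bigcup_k F k) = nu (\bigcup_(i < n) F i) + nu (D n).
  rewrite -nu_add//; last by apply/seteqP; split=> // w [h1 [_ h2]].
  congr nu; rewrite /D; apply/seteqP; split=> [w Fw|w [[i _ Fi]|[]//]].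
    by have [?|?] := pselect ((\bigcup_(i < n) F i) w); [left|right].
  by exists i.
have : (mu \o D) n @[n --> \oo] --> mu (\bigcap_n D n).
  apply: nonincreasing_cvg_mu => //.
  - by apply: fin_mu.
  - by apply: bigcap_measurable.
  - move=> n m nm; apply/subsetPset => w [Fw nF]; split=> //.
    by move=> [i /= ni Fi]; apply: nF; exists i => //=; exact: leq_trans nm.
have -> : \bigcap_n D n = set0.
  apply/seteqP; split=> // w Dw; have [[k _ Fk] _] := Dw 0%N Logic.I.
  by have [_] := Dw k.+1 Logic.I; apply; exists k => /=.
rewrite measure0 => /cvge0P h.
apply/cvgrPdist_lt => e e0.
have e1 : 0 < e / (`|C| + 1) by rewrite divr_gt0// ltr_wpDl.
have [//|N _ NP] := h _ _ e1; exists N => // n /NP /= De.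
rewrite (Dnu n) [_ + nu (D n)]addrC addrK (le_lt_trans (nu_le (mD n)))//.
have Dfin : mu (D n) \is a fin_num by rewrite fin_num_measure.
have D0 : 0 <= fine (mu (D n)) by rewrite fine_ge0.
have {}De : fine (mu (D n)) < e / (`|C| + 1) by rewrite -lte_fin fineK.
apply: (@le_lt_trans _ _ (`|C| * fine (mu (D n)))).
  by rewrite ler_wpM2r// ler_norm.
move: De; rewrite ltr_pdivlMr ?ltr_wpDl//; have := normr_ge0 C.
nra.
Qed.

HB.instance Definition _ := isCharge.Build d T R nuE nuE0 nuE_fin nuE_sigma_additive.

(** Domination by a multiple of [mu] upgrades finite to countable additivity, because the tails of a
    disjoint union have small measure; the Radon-Nikodym theorem then applies. Both conditional
    probabilities and functionals on L1 are represented in this way. *)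
Lemma bounded_additive_density : exists m : T -> R,
  mu.-integrable setT (EFin \o m) /\
  forall A, measurable A -> nu A = \int[mu]_(w in A) m w.
Proof.
have numu : nuE `<< mu.
  apply/null_content_dominatesP => A mA muA0.
  have := nu_le mA; rewrite muA0 mulr0 => h.
  by apply/eqP; rewrite /nuE eqe -normr_le0.
exists (fine \o Radon_Nikodym nuE mu).
have E : EFin \o (fine \o Radon_Nikodym nuE mu) = Radon_Nikodym nuE mu.
  by apply/funext => w /=; rewrite fineK// Radon_Nikodym_fin_num.
split; first by rewrite E; exact: Radon_Nikodym_integrable.
move=> A mA; apply/EFin_inj; rewrite -[LHS]/(nuE A) (Radon_Nikodym_integral numu mA).
rewrite /Rintegral; have := congr1 (fun f => integral mu A f) E; rewrite /comp => ->.
rewrite fineK//; apply: integrable_fin_num => //.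
exact: integrableS (Radon_Nikodym_integrable numu).
Qed.

End Charge.
End BoundedAdditive.

Section IntegralLimit.
Context (R : realType) (X : completeNormedModType R).
Hypothesis X_separable : separable X.
Context d (T : measurableType d).
Variable mu : {measure set T -> \bar R}.
Implicit Types f g : T -> X.

Lemma nrm_subset (A B : set T) f : measurable A -> measurable B -> A `<=` B ->
  dmeas f -> (nrm mu A f <= nrm mu B f)%E.
Proof.
move=> mA mB AB fm; apply: ge0_subset_integral => //.
exact: measurable_EFin_norm.
Qed.

Lemma nrm_dist_lty f g : dmeas f -> dmeas g ->
  (nrm mu setT f < +oo)%E -> (nrm mu setT g < +oo)%E ->
  (nrm mu setT (fun w => f w - g w)%R < +oo)%E.
Proof.
move=> fm gm foo goo; apply: le_lt_trans (nrmB _ X_separable measurableT fm gm) _.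
by rewrite lte_add_pinfty.
Qed.

Lemma nrm_lty_of_dist f g : dmeas f -> dmeas g -> (nrm mu setT f < +oo)%E ->
  (nrm mu setT (fun w => f w - g w)%R < +oo)%E -> (nrm mu setT g < +oo)%E.
Proof.
move=> fm gm foo fgoo.
have -> : g = (fun w => f w - (f w - g w)) by apply/funext => w; rewrite subKr.
by apply: nrm_dist_lty => //; exact: dmeasB.
Qed.

Lemma cvg_Rintegral_dual (f_ : nat -> T -> X) f (l : X -> R) B :
  measurable B -> dual l -> (forall n, dmeas (f_ n)) -> dmeas f ->
  (forall n, nrm mu setT (f_ n) < +oo)%E -> (nrm mu setT f < +oo)%E ->
  nrm mu setT (fun w => f_ n w - f w)%R @[n --> \oo] --> 0%E ->
  (\int[mu]_(w in B) l (f_ n w)) @[n --> \oo] --> \int[mu]_(w in B) l (f w).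
Proof.
move=> mB lX fnm fm fnoo foo fnf; have [C C0 lC] := dual_bound lX.
apply/cvgrPdist_le => e e0.
have e1 : 0 < e / (C + 1) by rewrite divr_gt0// ltr_wpDl.
near=> n.
have fin_B (h : T -> X) : dmeas h -> (nrm mu setT h < +oo)%E -> (nrm mu B h < +oo)%E.
  by move=> hm hoo; apply: le_lt_trans hoo; apply: nrm_subset.
rewrite distrC -RintegralB//; try (by apply: integrable_dual => //; apply: fin_B).
under eq_Rintegral do rewrite -dualB//.
have ds := dmeasB (fnm n) fm.
have fsn : (nrm mu setT (fun w => f_ n w - f w)%R < (e / (C + 1))%:E)%E.
  by near: n; move/cvge0P : fnf; apply => // n; exact: nrm_ge0.
have fsB : (nrm mu B (fun w => f_ n w - f w)%R < (e / (C + 1))%:E)%E.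
  by apply: le_lt_trans fsn; apply: nrm_subset.
have fsoo : (nrm mu B (fun w => f_ n w - f w)%R < +oo)%E.
  by rewrite (lt_trans fsB)// ltry.
apply: le_trans (Rintegral_dual_le X_separable mB ds fsoo lX C0 lC) _.
move: fsB; rewrite -[X in (X < _)%E]fineK ?ge0_fin_numE ?nrm_ge0// lte_fin.
set y := fine _; rewrite ltr_pdivlMr ?ltr_wpDl// => h.
have y0 : 0 <= y by rewrite fine_ge0// nrm_ge0.
nra.
Unshelve. all: by end_near. Qed.

End IntegralLimit.

(** * Restriction of the measure to a sub-sigma-algebra *)

Section SubSigmaAlgebra.
Context (R : realType) d (T : measurableType d).
Variable mu : {finite_measure set T -> \bar R}.
Variable G : set (set T).
Hypothesis G_sigma : sigma_algebra setT G.
Hypothesis G_sub : G `<=` measurable.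
Local Notation GT := (g_sigma_algebraType G).

Lemma measurable_subE (A : set T) : measurable (A : set GT) <-> G A.
Proof. by rewrite /measurable/= (sigma_algebra_id G_sigma). Qed.

(** As a measurable map onto the coarser space, the identity makes the restricted measure a
    pushforward, so that integrals transfer by change of variables. *)
Definition sub_id : T -> GT := id.

Lemma measurable_sub_id : measurable_fun setT sub_id.
Proof. by move=> _ A /measurable_subE/G_sub mA; rewrite setTI. Qed.

Definition sub_mu (A : set GT) : \bar R := mu A.

Let sub_mu0 : sub_mu set0 = 0%E. Proof. exact: measure0. Qed.

Let sub_mu_ge0 A : (0 <= sub_mu A)%E. Proof. exact: measure_ge0. Qed.

Let sub_mu_sigma_additive : semi_sigma_additive sub_mu.
Proof.
move=> F mF tF mUF; apply: measure_semi_sigma_additive => // [i|];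
  by apply: G_sub; apply/measurable_subE.
Qed.

HB.instance Definition _ :=
  isMeasure.Build _ GT R sub_mu sub_mu0 sub_mu_ge0 sub_mu_sigma_additive.

Lemma sub_mu_fin : fin_num_fun sub_mu.
Proof.
move=> A /measurable_subE/G_sub mA.
exact: (fin_num_measure mu).
Qed.

HB.instance Definition _ := Measure_isFinite.Build _ _ _ sub_mu sub_mu_fin.

Lemma sub_measurable_fun d' (U : measurableType d') (u : T -> U) :
  measurable_fun setT (u : GT -> U) -> measurable_fun setT u.
Proof.
move=> um _ B mB; have := um measurableT B mB.
by rewrite !setTI => /measurable_subE/G_sub.
Qed.

Lemma sub_integral (u : T -> \bar R) A : G A -> measurable_fun setT (u : GT -> \bar R) ->
  mu.-integrable setT u -> (\int[sub_mu]_(w in A) u w = \int[mu]_(w in A) u w)%E.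
Proof.
move=> GA um ui; apply: etrans (integral_pushforward measurable_sub_id um _ _).
- by [].
- exact: (integrableS measurableT (G_sub GA) (@subsetT _ _) ui).
- exact/measurable_subE.
Qed.

Lemma sub_ge0_integral (u : T -> \bar R) : measurable_fun setT (u : GT -> \bar R) ->
  (forall w, 0 <= u w)%E -> (\int[sub_mu]_w u w = \int[mu]_w u w)%E.
Proof.
move=> um u0.
by have := ge0_integral_pushforward measurable_sub_id mu measurableT um (fun w _ => u0 w).
Qed.

Lemma sub_integrable (u : T -> R) : measurable_fun setT (u : GT -> R) ->
  mu.-integrable setT (EFin \o u) -> sub_mu.-integrable setT (EFin \o u).
Proof.
move=> um ui; apply/integrableP; split; first exact/measurable_EFinP.
rewrite sub_ge0_integral//; first by case/integrableP : ui.
by apply: measurableT_comp => //; exact/measurable_EFinP.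
Qed.

Lemma sub_ae (P : T -> Prop) : {ae sub_mu, forall w, P w} -> {ae mu, forall w, P w}.
Proof.
move=> [N [mN N0 NP]]; exists N; split=> //.
by apply: G_sub; apply/measurable_subE.
Qed.

Lemma sub_Rintegral (u : T -> R) A : G A -> measurable_fun setT (u : GT -> R) ->
  mu.-integrable setT (EFin \o u) ->
  \int[sub_mu]_(w in A) u w = \int[mu]_(w in A) u w.
Proof.
move=> GA um ui; congr fine; apply: sub_integral => //.
exact/measurable_EFinP.
Qed.

Lemma sub_int_of_ge0 (u : T -> R) : measurable_fun setT (u : GT -> R) ->
  sub_mu.-integrable setT (EFin \o u) -> mu.-integrable setT (EFin \o u).
Proof.
move=> um /integrableP[_ uoo]; apply/integrableP; split.
  by apply/measurable_EFinP; exact: sub_measurable_fun.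
rewrite -sub_ge0_integral//.
by apply: measurableT_comp => //; exact/measurable_EFinP.
Qed.

(** The conditional probability of [A]: the density of [B |-> mu (A /\ B)] with respect to the
    restriction of [mu] to [G]. *)
Lemma cexp_indic A : measurable A -> exists e : T -> R,
  [/\ measurable_fun setT (e : GT -> R), mu.-integrable setT (EFin \o e) &
      forall B, G B -> \int[mu]_(w in B) e w = fine (mu (A `&` B))].
Proof.
move=> mA; have GmE := measurable_subE.
have finI B : G B -> mu (A `&` B) \is a fin_num.
  by move=> /G_sub mB; rewrite fin_num_measure//; exact: measurableI.
have [|B mB|e [ei eE]] := @bounded_additive_density R _ GT sub_mu
    (fun B => fine (mu (A `&` B))) 1.
- move=> B1 B2 /GmE G1 /GmE G2 B12; rewrite setIUr -fineD ?finI//.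
  rewrite measureU//; try (by apply: measurableI => //; exact: G_sub).
  by rewrite setIACA setIid B12 setI0.
- move/GmE : mB => GB; rewrite mul1r ger0_norm ?fine_ge0//.
  apply: fine_le; [exact: finI|by apply: (fin_num_measure mu); exact: G_sub|].
  by apply: le_mu => //; [apply: measurableI => //; exact: G_sub|exact: G_sub].
have em := integrable_measurable ei.
have ei' := sub_int_of_ge0 em ei.
exists e; split=> // B GB; rewrite -sub_Rintegral// -eE//.
exact/GmE.
Qed.

Lemma sub_ae_le (u v : T -> R) :
  measurable_fun setT (u : GT -> R) -> measurable_fun setT (v : GT -> R) ->
  mu.-integrable setT (EFin \o u) -> mu.-integrable setT (EFin \o v) ->
  (forall B, G B -> \int[mu]_(w in B) u w <= \int[mu]_(w in B) v w) ->
  {ae mu, forall w, u w <= v w}.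
Proof.
move=> um vm ui vi uv; apply: sub_ae.
apply: ae_le_of_Rintegral; [exact: sub_integrable|exact: sub_integrable|].
move=> A /measurable_subE GA; rewrite !sub_Rintegral//; exact: uv.
Qed.

Section Vector.
Variable X : completeNormedModType R.
Hypothesis X_separable : separable X.

Definition sub_dmeas (f : T -> X) := @dmeas R X _ GT f.

Lemma sub_dmeas_dmeas f : sub_dmeas f -> dmeas f.
Proof. by move=> fm l lX; apply: sub_measurable_fun; exact: fm. Qed.

Lemma sub_nrm f : sub_dmeas f -> nrm sub_mu setT f = nrm mu setT f.
Proof.
move=> fm; apply: sub_ge0_integral; last by move=> w; rewrite lee_fin.
exact: (@measurable_EFin_norm R _ GT X X_separable setT f fm).
Qed.

Lemma sub_fast_cauchy_limit (f_ : nat -> T -> X) (C : R) : 0 <= C ->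
  (forall n, sub_dmeas (f_ n)) ->
  (forall n, nrm mu setT (fun w => f_ n.+1 w - f_ n w)%R <= (C * 2^-1 ^+ n)%:E)%E ->
  exists2 g, sub_dmeas g &
    forall n, (nrm mu setT (fun w => f_ n w - g w)%R <= (2 * C * 2^-1 ^+ n)%:E)%E.
Proof.
move=> C0 fm fC.
have [|g [gm _ gP]] := @fast_cauchy_limit R _ GT sub_mu X X_separable f_ C C0 fm.
  by move=> n; rewrite sub_nrm//; apply: dmeasB; exact: fm.
exists g => // n; rewrite -sub_nrm//; apply: dmeasB => //; exact: fm.
Qed.

End Vector.
End SubSigmaAlgebra.

Lemma separable_real (R : realType) : separable (R^o : normedModType R).
Proof.
exists (range (@ratr R)).
  by apply: sub_countable (card_image_le _ _) _; exact: countableP.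
exact: dense_rat.
Qed.

Lemma dual_id (R : realType) : dual (id : R^o -> R).
Proof. by apply: (@dual_of_bound R R^o _ 1) => [a x y|x]; rewrite ?mul1r. Qed.

Lemma dmeas_real (R : realType) d (T : measurableType d) (u : T -> R) :
  measurable_fun setT u <-> dmeas (u : T -> R^o).
Proof.
split=> [um l lX|/(_ _ (dual_id R))//].
rewrite (_ : _ \o _ = fun w => u w * l 1).
  by apply: measurable_funM => //; exact: measurable_cst.
by apply/funext => w /=; rewrite -[u w in LHS]mulr1 [LHS](dualZ _ _ lX).
Qed.

(** * Existence and domination of conditional expectations *)

Section ConditionalExpectation.
Context (R : realType) d (T : measurableType d).
Variable mu : {finite_measure set T -> \bar R}.
Variable G : set (set T).
Hypothesis G_sigma : sigma_algebra setT G.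
Hypothesis G_sub : G `<=` measurable.
Local Notation GT := (g_sigma_algebraType G).
Local Notation int u := (mu.-integrable setT (EFin \o u)).

(** The working form of [is_cond_exp]: the representative is itself [G]-measurable, and the
    integrals are compared through functionals. *)
Definition cexp (X : completeNormedModType R) (f g : T -> X) :=
  [/\ sub_dmeas G g, (nrm mu setT g < +oo)%E &
      forall B, G B -> forall l, dual l ->
        \int[mu]_(w in B) l (f w) = \int[mu]_(w in B) l (g w)].

(** The scalar case is stated separately because its order provides the majorants of vector-valued
    conditional expectations. *)
Definition rexp (u v : T -> R) :=
  [/\ measurable_fun setT (v : GT -> R), int v &
      forall B, G B -> \int[mu]_(w in B) u w = \int[mu]_(w in B) v w].

Lemma rexp_le u v u' v' : int u -> int u' -> rexp u v -> rexp u' v' ->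
  {ae mu, forall w, u w <= u' w} -> {ae mu, forall w, v w <= v' w}.
Proof.
move=> ui ui' [vm vi uv] [vm' vi' uv'] uu'.
apply: (sub_ae_le G_sigma G_sub) => // B GB; rewrite -uv// -uv'//.
have mB := G_sub GB.
have uB := integrableS measurableT mB (@subsetT _ _) ui.
have uB' := integrableS measurableT mB (@subsetT _ _) ui'.
by apply: le_Rintegral_ae.
Qed.

Lemma rexp_integral u v : int u -> rexp u v ->
  (\int[mu]_w (v w)%:E = \int[mu]_w (u w)%:E)%E.
Proof.
move=> ui [vm vi uv].
have GT0 : G setT by have [G0 GD _] := G_sigma; have := GD _ G0; rewrite setD0.
have := congr1 EFin (uv _ GT0); rewrite /Rintegral.
by rewrite !fineK//; exact: integrable_fin_num.
Qed.

Section Vector.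
Variable X : completeNormedModType R.
Hypothesis X_separable : separable X.
Implicit Types f g : T -> X.

Lemma cexp_dmeas f g : cexp f g -> dmeas g.
Proof. by case=> gm _ _; exact: (sub_dmeas_dmeas G_sigma G_sub). Qed.

Lemma cexp_lin a f g f' g' : dmeas f -> dmeas f' ->
  (nrm mu setT f < +oo)%E -> (nrm mu setT f' < +oo)%E -> cexp f g -> cexp f' g' ->
  cexp (fun w => a *: f w + f' w) (fun w => a *: g w + g' w).
Proof.
move=> fm fm' foo foo' fg fg'; have gm := cexp_dmeas fg; have gm' := cexp_dmeas fg'.
have [sgm goo h] := fg; have [sgm' goo' h'] := fg'.
split.
- exact: (@dmeas_lin R X _ GT).
- apply: le_lt_trans (nrmD _ X_separable measurableT (dmeasZ a gm) gm') _.
  by rewrite nrmZ// lte_add_pinfty// lte_mul_pinfty.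
- move=> B GB l lX.
  have int_l (k : T -> X) : dmeas k -> (nrm mu setT k < +oo)%E -> int (l \o k).
    by move=> km koo; exact: integrable_dual.
  have E k k' w : l (a *: k w + k' w : X) = a * (l \o k) w + (l \o k') w.
    by rewrite /= dualD// dualZ.
  under eq_Rintegral do rewrite E; under [RHS]eq_Rintegral do rewrite E.
  rewrite !Rintegral_comb//; try exact: int_l; try exact: G_sub.
  by rewrite /= h// h'.
Qed.

(* The norming functionals reduce the bound on the vector [g] to the real case. *)
Lemma cexp_norm_le f g u v : dmeas f -> (nrm mu setT f < +oo)%E -> int u ->
  {ae mu, forall w, `|f w| <= u w} -> cexp f g -> rexp u v ->
  {ae mu, forall w, `|g w| <= v w}.
Proof.
move=> fm foo ui fu fg [vm vi uv]; have gm := cexp_dmeas fg.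
have [sgm goo h] := fg; have [l_ [lX lb ln]] := norming_sequence X_separable.
have int_l j (k : T -> X) : dmeas k -> (nrm mu setT k < +oo)%E -> int (l_ j \o k).
  by move=> km koo; exact: integrable_dual.
have H j : {ae mu, forall w, l_ j (g w) <= v w}.
  apply: (@sub_ae_le R _ T mu G G_sigma G_sub (l_ j \o g) v) => //.
  - exact: sgm.
  - exact: int_l.
  - move=> B GB; rewrite -uv// -h//; apply: le_Rintegral_ae => //.
    + exact: G_sub.
    + exact: int_l.
    + apply: filterS fu => w fuw; rewrite (le_trans _ fuw)//.
      by rewrite (le_trans (ler_norm _)).
have := ae_foralln H; apply: filterS => w Hw; exact: ln.
Qed.

Lemma cexp_simple (s : {fimfun T >-> X}) : (forall x, measurable (s @^-1` [set x])) ->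
  exists g, cexp s g.
Proof.
move=> sm.
have /choice[e eP] x := @cexp_indic R _ T mu G G_sigma G_sub (s @^-1` [set x]) (sm x).
pose r : seq X := fset_set (range s).
have ed x : sub_dmeas G (fun w => e x w *: x).
  by apply: (@dmeasZf R X _ GT); [case: (eP x)|exact: dmeas_cst].
have em x : measurable_fun setT (e x).
  by apply: (integrable_measurable (mu := mu)); case: (eP x).
have eoo x : (nrm mu setT (fun w => e x w *: x)%R < +oo)%E.
  rewrite /nrm; under eq_integral do rewrite normrZ EFinM muleC.
  rewrite ge0_integralZl//; last first.
    by apply/measurable_EFinP; exact: measurableT_comp.
  apply: lte_mul_pinfty; rewrite ?lee_fin//.
  by case: (eP x) => _ /integrableP[].
exists (fun w => \sum_(x <- r) e x w *: x); split.
- by apply: (@dmeas_sum R X _ GT) => x _; exact: ed.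
- apply: le_lt_trans (nrm_sum _ X_separable measurableT _ _) _.
    by move=> x; exact: (sub_dmeas_dmeas G_sigma G_sub (ed x)).
  by apply: lte_sum_pinfty => x _.
- move=> B GB l lX; have mB := G_sub GB.
  rewrite -simple_integral_dual//; last by move=> x _; apply: fin_mu; exact: measurableI.
  rewrite /simple_integral fsbig_finite//= dual_sum//.
  under [RHS]eq_Rintegral do rewrite dual_sum//.
  under [RHS]eq_Rintegral do under eq_bigr do rewrite dualZ// mulrC.
  have ei x : mu.-integrable B (EFin \o (fun w => l x * e x w)).
    rewrite (_ : _ \o _ = (fun w => (l x)%:E * (EFin \o e x) w)%E)//.
    by apply: integrableZl => //; apply: integrableS (_ : int (e x)) => //; case: (eP x).
  rewrite Rintegral_sum//; apply: eq_bigr => x _.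
  have [_ exi exE] := eP x.
  rewrite dualZ// RintegralZl//; last exact: integrableS exi.
  by rewrite exE// mulrC setIC.
Qed.

End Vector.

(** General existence is derived from this contraction property, so the argument stays among simple
    functions: [|s|] is one, its conditional expectation [v] is already available, and [v] dominates
    [|g|] and has the integral of [|s|]. *)
Let cexp_simple_nrm (X : completeNormedModType R) (X_separable : separable X)
    (s : {fimfun T >-> X}) g :
  (forall x, measurable (s @^-1` [set x])) -> cexp s g ->
  (nrm mu setT g <= nrm mu setT s)%E.
Proof.
move=> sm sg; have sdm : dmeas s by exact: simple_dmeas.
have soo : (nrm mu setT s < +oo)%E.
  by apply: simple_nrm_lty => // x _; apply: fin_mu; exact: measurableI.
have nfin : finite_set (range (fun w => `|s w| : R^o)).
  have -> : range (fun w => `|s w| : R^o) = (fun x => `|x|) @` range s.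
    apply/seteqP; split=> [_ [w _ <-]|_ [_ [w _ <-] <-]]; last by exists w.
    by exists (s w) => //; exists w.
  exact: finite_image.
have nm : measurable_fun setT (fun w => `|s w|) by exact: measurable_norm_dmeas.
pose ns := fimfun_Sub (mem_set nfin) : {fimfun T >-> R^o}.
have [|v [vm voo vE]] := @cexp_simple R^o (separable_real R) ns.
  by move=> x; have := nm measurableT [set (x : R)] (measurable_set1 x); rewrite setTI.
have ni : int (fun w => `|s w|).
  apply/integrableP; split; first exact/measurable_EFinP.
  by under eq_integral do rewrite /= normr_id.
have vi : int v.
  apply/integrableP; split=> //; apply/measurable_EFinP.
  by apply/dmeas_real; exact: (sub_dmeas_dmeas G_sigma G_sub vm).
have rv : rexp (fun w => `|s w|) v.
  by split=> // [|B GB]; [exact/dmeas_real|exact: (vE B GB _ (dual_id R))].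
have gv : {ae mu, forall w, `|g w| <= v w}.
  by apply: (cexp_norm_le X_separable sdm soo ni _ sg rv); exact: aeW.
have gm := cexp_dmeas sg.
apply: le_trans (le_nrm_ae X_separable measurableT gm (integrable_measurable vi) _) _.
  by apply: filterS gv => w ? _.
by rewrite (rexp_integral ni rv).
Qed.

(** Conditional expectations of simple functions [t n] at distance at most [2^-1 ^+ n] from [f] are
    Cauchy in L1 by contraction. Their limit is taken on the coarser space, hence is [G]-measurable,
    and the integral identities survive L1 limits. *)
Lemma cexp_exists (X : completeNormedModType R) (f : T -> X) : separable X ->
  dmeas f -> (nrm mu setT f < +oo)%E -> exists g, cexp f g.
Proof.
move=> X_separable fm foo.
have [I [s_ [sm sfin _ fs _]]] := wint_bochner_integral X_separable measurableT fm foo.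
have /choice[t tP] n : exists t : {fimfun T >-> X}, (forall x, measurable (t @^-1` [set x])) /\
    (nrm mu setT (fun w => f w - t w)%R <= (2^-1 ^+ n)%:E)%E.
  move/cvge0P : fs => fs; have [k|N _ /(_ N (leqnn _)) h] := fs _ _ (half_pow_gt0 R n).
    exact: nrm_ge0.
  by exists (s_ N); split; [exact: sm|exact: ltW].
have tm n : dmeas (t n) by apply: simple_dmeas; case: (tP n).
have too n : (nrm mu setT (t n) < +oo)%E.
  by apply: simple_nrm_lty => [||x _];
    [exact: measurableT|case: (tP n)|apply: fin_mu; rewrite setTI; case: (tP n)].
have ttn n : (nrm mu setT (fun w => t n.+1 w - t n w)%R <= (2 * 2^-1 ^+ n)%:E)%E.
  apply: le_trans (nrm_dist_trans _ X_separable measurableT (tm n.+1) fm (tm n)) _.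
  rewrite nrm_distC mulr_natl mulr2n EFinD leeD//; last by case: (tP n).
  have [_ /le_trans] := tP n.+1; apply; rewrite lee_fin exprS.
  by have := half_pow_gt0 R n; lra.
have /choice[g gP] n := cexp_simple X_separable (tP n).1.
have ggn n : (nrm mu setT (fun w => g n.+1 w - g n w)%R <= (2 * 2^-1 ^+ n)%:E)%E.
  apply: le_trans (ttn n).
  have tE : (t n.+1 - t n : {fimfun T >-> X}) = (fun w => t n.+1 w - t n w) :> (T -> X).
    by rewrite fimfunB.
  have tdm : dmeas (fun w => t n.+1 w - t n w) by exact: dmeasB.
  rewrite -tE; apply: cexp_simple_nrm => // [x|].
    rewrite tE; have := measurable_norm_dmeas X_separable (dmeasB tdm (dmeas_cst x)).
    move=> /(_ measurableT [set (0 : R)] (measurable_set1 _)); rewrite setTI.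
    congr measurable; apply/seteqP; split=> [w /eqP/=|w /= ->].
      by rewrite normr_eq0 subr_eq0 => /eqP.
    by rewrite subrr normr0.
  rewrite tE.
  have := cexp_lin X_separable (-1) (tm n) (tm n.+1) (too n) (too n.+1) (gP n) (gP n.+1).
  by congr cexp; apply/funext => w; rewrite scaleN1r addrC.
have sgm n : sub_dmeas G (g n) by case: (gP n).
have goo n : (nrm mu setT (g n) < +oo)%E by case: (gP n).
have [//|h hm hP] := @sub_fast_cauchy_limit R _ T mu G G_sigma G_sub X X_separable g 2 _ sgm ggn.
have gm n := cexp_dmeas (gP n).
have hdm := sub_dmeas_dmeas G_sigma G_sub hm.
have cvg0 (u : nat -> \bar R) C : (forall n, 0 <= u n)%E ->
    (forall n, u n <= (C * 2^-1 ^+ n)%:E)%E -> u n @[n --> \oo] --> 0%E.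
  move=> u0 uC; apply/cvge0P => // e e0.
  have e1 : 0 < e / (`|C| + 1) by rewrite divr_gt0// ltr_wpDl.
  have := half_pow_lt e1; apply: filterS => n ne; apply: le_lt_trans (uC n) _.
  rewrite lte_fin; move: ne; rewrite ltr_pdivlMr ?ltr_wpDl//.
  by have := half_pow_gt0 R n; have := ler_norm C; nra.
have hoo : (nrm mu setT h < +oo)%E.
  apply: (nrm_lty_of_dist X_separable (gm 0%N) hdm (goo 0%N)).
  by apply: le_lt_trans (hP 0%N) _; rewrite ltry.
exists h; split=> // B GB l lX; have mB := G_sub GB.
have tf : (\int[mu]_(w in B) l (t n w)) @[n --> \oo] --> \int[mu]_(w in B) l (f w).
  apply: cvg_Rintegral_dual => //; apply: (cvg0 _ 1) => n; first exact: nrm_ge0.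
  by rewrite mul1r nrm_distC; case: (tP n).
have gh : (\int[mu]_(w in B) l (g n w)) @[n --> \oo] --> \int[mu]_(w in B) l (h w).
  by apply: cvg_Rintegral_dual => //; apply: (cvg0 _ (2 * 2)) => n; [exact: nrm_ge0|exact: hP].
have tg n : \int[mu]_(w in B) l (t n w) = \int[mu]_(w in B) l (g n w).
  by have [_ _ ->] := gP n.
move: tf; under eq_fun do rewrite tg; move=> tf.
exact: (cvg_unique (@norm_hausdorff R R^o) tf gh).
Qed.

Lemma rexp_exists u : int u -> exists v, rexp u v.
Proof.
move=> ui; have um := integrable_measurable ui.
have [|v [vm voo vE]] := @cexp_exists R^o u (separable_real R) ((dmeas_real u).1 um).
  by case/integrableP : ui.
exists v; split=> [||B GB]; [exact/dmeas_real| |exact: vE GB _ (dual_id R)].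
apply/integrableP; split=> //; apply/measurable_EFinP.
by apply/dmeas_real; exact: (sub_dmeas_dmeas G_sigma G_sub vm).
Qed.

End ConditionalExpectation.

Section VectorDominatedConvergence.
Context (R : realType) (X : completeNormedModType R).
Hypothesis X_separable : separable X.
Context d (T : measurableType d).
Variable mu : {measure set T -> \bar R}.

Lemma nrm_dominated_cvg0 (f_ : nat -> T -> X) f (u : T -> R) :
  (forall n, dmeas (f_ n)) -> dmeas f -> mu.-integrable setT (EFin \o u) ->
  {ae mu, forall w, f_ n w @[n --> \oo] --> f w} ->
  {ae mu, forall w, forall n, `|f_ n w - f w| <= u w} ->
  nrm mu setT (fun w => f_ n w - f w)%R @[n --> \oo] --> 0%E.
Proof.
move=> fm gm ui fl fu.
have [|||||_ _] := @dominated_convergence _ _ R mu setT measurableT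
    (fun n w => (`|f_ n w - f w|)%:E) (cst 0%E) (EFin \o u).
- by move=> n; apply: measurable_EFin_norm => //; exact: dmeasB.
- exact: measurable_cst.
- apply: filterS fl => w fw _; apply/cvge0P => [n|e e0]; first by rewrite lee_fin.
  by move/cvgrPdist_lt : fw => /(_ e e0); apply: filterS => n; rewrite distrC.
- exact: ui.
- by apply: filterS fu => w fw n _; rewrite /= lee_fin normr_id.
by rewrite integral0.
Qed.

End VectorDominatedConvergence.

Section Representatives.
Context (R : realType) (X : completeNormedModType R).
Hypothesis X_separable : separable X.
Context d (T : measurableType d).
Variable mu : {finite_measure set T -> \bar R}.
Implicit Types f g u : T -> X.

Lemma Lnorm1_nrm f : Lnorm_vector mu 1%E f = nrm mu setT f.
Proof.
rewrite /Lnorm_vector Lnorm1; apply: eq_integral => w _.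
by rewrite gee0_abs// lee_fin.
Qed.

Lemma L1P f : L1 mu f <-> dmeas f /\ (nrm mu setT f < +oo)%E.
Proof.
rewrite /L1 /= Lnorm1_nrm; split=> [[fm foo]|[fm foo]]; split=> //.
  exact: strongly_measurable_dmeas.
exact: dmeas_strongly_measurable.
Qed.

Section Given.
Variable G : set (set T).
Hypothesis G_sigma : sigma_algebra setT G.
Hypothesis G_sub : G `<=` measurable.

Lemma sub_strongly_measurableP g : strongly_measurable G g <-> sub_dmeas G g.
Proof.
have GE := measurable_subE G_sigma; split=> [[s_ [sm sf]]|gm].
  apply: (@dmeas_lim R X _ (g_sigma_algebraType G) (fun n => s_ n)) => // n.
  by apply: (@dmeas_fin R X _ (g_sigma_algebraType G)) => // x; apply/GE.
have [s_ [sm sf]] := @dmeas_strongly_measurable R X X_separable _ (g_sigma_algebraType G) g gm.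
by exists s_; split=> // n x; apply/GE.
Qed.

Lemma cexp_is_cond_exp f g u : L1 mu f -> cexp mu G f g -> dmeas u ->
  {ae mu, forall w, u w = g w} -> is_cond_exp mu G f u.
Proof.
move=> /L1P[fm foo] fg um ug; have gm := cexp_dmeas G_sigma G_sub fg.
have [sgm goo h] := fg.
have uoo : (nrm mu setT u < +oo)%E.
  rewrite (_ : nrm _ _ _ = nrm mu setT g)//; apply: eq_nrm_ae => //.
  by apply: filterS ug => w ? _.
split; first exact/L1P.
- by exists g; [exact/sub_strongly_measurableP|apply: filterS ug => w ->].
- move=> B GB; have mB := G_sub GB.
  have fB : (nrm mu B f < +oo)%E by apply: le_lt_trans foo; apply: nrm_subset.
  have uB : (nrm mu B u < +oo)%E by apply: le_lt_trans uoo; apply: nrm_subset.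
  have [I fI] := wint_exists X_separable mB fm fB.
  exists I; first exact/is_bochner_integralP.
  apply/is_bochner_integralP => //.
  apply: (eq_wint_ae mB gm um); first by apply: filterS ug => w -> _.
  by move=> l lX; rewrite fI// h.
Qed.

Lemma is_cond_exp_cexp f u : L1 mu f -> is_cond_exp mu G f u ->
  exists2 g, cexp mu G f g & {ae mu, forall w, u w = g w}.
Proof.
move=> /L1P[fm foo] [/L1P[um uoo] [g /sub_strongly_measurableP gm gu] h].
have gdm := sub_dmeas_dmeas G_sigma G_sub gm.
have ug : {ae mu, forall w, u w = g w} by apply: filterS gu => w ->.
exists g => //; split=> //.
  rewrite (_ : nrm _ _ _ = nrm mu setT u)//; apply: eq_nrm_ae => //.
  by apply: filterS ug => w ? _.
move=> B GB l lX; have mB := G_sub GB; have [I fI uI] := h B GB.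
have [_ /(_ l lX) <-] := bochner_integral_wint X_separable mB fm fI.
have [_ uI'] := bochner_integral_wint X_separable mB um uI.
rewrite (uI' l lX); apply/eqP; rewrite eq_le; apply/andP; split;
  (apply: le_Rintegral_ae => //; [| |by apply: filterS ug => w ->]);
  apply: integrable_dual => //.
all: rewrite (_ : nrm _ _ _ = nrm mu setT u)//; apply: eq_nrm_ae => //;
  by apply: filterS ug => w ? _.
Qed.

End Given.
End Representatives.

(** * Doob's maximal inequality *)

Section Doob.
Context (R : realType) d (T : measurableType d).
Variable mu : {finite_measure set T -> \bar R}.
Variable F : R -> set (set T).
Hypothesis F_filtration : filtration F.

Lemma filtration_sigma s : 0 <= s -> sigma_algebra setT (F s).
Proof. by case: F_filtration => h _ _; exact: h. Qed.

Lemma filtration_sub s : 0 <= s -> F s `<=` measurable.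
Proof. by case: F_filtration => _ h _; exact: h. Qed.

Lemma filtration_mono s t : 0 <= s -> s <= t -> F s `<=` F t.
Proof.
case: F_filtration => _ _ h s0; rewrite le_eqVlt => /predU1P[->//|st].
exact: h.
Qed.

Lemma sigma_setU (G : set (set T)) A B : sigma_algebra setT G -> G A -> G B -> G (A `|` B).
Proof.
move=> Gs /(measurable_subE Gs) mA /(measurable_subE Gs) mB.
by apply/(measurable_subE Gs); exact: measurableU.
Qed.

Lemma sigma_setD (G : set (set T)) A B : sigma_algebra setT G -> G A -> G B -> G (A `\` B).
Proof.
move=> Gs /(measurable_subE Gs) mA /(measurable_subE Gs) mB.
by apply/(measurable_subE Gs); exact: measurableD.
Qed.

Lemma sigma_lt (G : set (set T)) (v : T -> R) lam : sigma_algebra setT G ->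
  measurable_fun setT (v : g_sigma_algebraType G -> R) -> G [set w | lam < v w].
Proof.
move=> Gs vm; apply/(measurable_subE Gs).
have := measurable_fun_ltr (measurable_cst lam) vm.
by move=> /(_ measurableT [set true]); rewrite setTI; exact.
Qed.

(** First-passage decomposition by induction on the increasing list of times, where [A] collects the
    points that have crossed [lam] earlier. The new crossings at time [s] form [S] minus [A], a set
    of [F s]; on it [u] and [v s] have the same integral and [v s > lam]. Excluding [A] is what
    counts each point only once. *)
Lemma doob_finite (u : T -> R) (v : R -> T -> R) lam (r : seq R) A a :
  mu.-integrable setT (EFin \o u) -> (forall w, 0 <= u w) -> 0 <= a ->
  (forall s, 0 <= s -> rexp mu (F s) u (v s)) -> path <=%R a r -> F a A ->
  let U := \big[setU/set0]_(s <- r) [set w | lam < v s w] in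
  measurable U /\ lam * fine (mu (U `\` A)) <= \int[mu]_(w in U `\` A) u w.
Proof.
move=> ui u0 a0 uv; elim: r a A a0 => [|s r IH] a A a0 /=.
  move=> _ _; rewrite big_nil set0D measure0 mulr0; split=> //.
  by rewrite Rintegral_set0.
move=> /andP[as_ sr] FA; have s0 : 0 <= s by exact: le_trans as_.
pose S := [set w | lam < v s w].
have [vm vi vE] := uv s s0.
have FsA : F s A by exact: filtration_mono FA.
have FS : F s S by apply: sigma_lt => //; exact: filtration_sigma.
have FAS : F s (A `|` S) by apply: sigma_setU => //; exact: filtration_sigma.
have [mU h] := IH s (A `|` S) s0 sr FAS.
rewrite big_cons -/S; set U := \big[setU/set0]_(_ <- r) _ in mU h *.
have mS : measurable S by exact: filtration_sub FS.
have mA : measurable A by exact: filtration_sub FsA.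
split; first exact: measurableU.
have -> : (S `|` U) `\` A = (S `\` A) `|` (U `\` (A `|` S)).
  apply/seteqP; split=> [w [[Sw|Uw] nA]|w [[Sw nA]|[Uw nAS]]].
  - by left.
  - have [Sw|nS] := pselect (S w); first by left.
    by right; split=> // -[].
  - by split=> //; left.
  - by split; [right|move=> Aw; apply: nAS; left].
have mSA : measurable (S `\` A) by exact: measurableD.
have mUAS : measurable (U `\` (A `|` S)) by apply: measurableD => //; exact: measurableU.
have dj : [disjoint (S `\` A) & (U `\` (A `|` S))].
  by apply/disj_setPS => w [[Sw _] [_ nAS]]; apply: nAS; right.
rewrite Rintegral_setU//; last first.
  apply: integrableS ui => //; exact: measurableU.
rewrite measureU//; last by apply/disj_set2P.
rewrite fineD ?fin_num_measure// mulrDr lerD//.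
rewrite vE; last by apply: sigma_setD => //; exact: filtration_sigma.
rewrite mulrC -[leLHS]mulrC -Rintegral_cst//.
apply: le_Rintegral => //.
- by apply: finite_measure_integrable_cst.
- exact: integrableS vi.
- by move=> w [Sw _]; exact: ltW.
Qed.

(** A finite set of times can be sorted, so [doob_finite] bounds all finite unions and
    [essential_union] gives one exceptional set for all [s]. Any two versions agree almost
    everywhere, so [B] serves every version [v], with a null set that depends on it. *)
Lemma doob_maximal (u : T -> R) lam : 0 < lam ->
  mu.-integrable setT (EFin \o u) -> (forall w, 0 <= u w) -> exists B,
  [/\ measurable B, (lam%:E * mu B <= \int[mu]_w (u w)%:E)%E &
  forall s v, 0 <= s -> rexp mu (F s) u v -> {ae mu, forall w, ~ B w -> v w <= lam}].
Proof.
move=> lam0 ui u0.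
have /choice[v vP] s : exists v, 0 <= s -> rexp mu (F s) u v.
  have [s0|s0] := leP 0 s; last by exists u.
  by have [v ?] := rexp_exists (filtration_sigma s0) (filtration_sub s0) ui; exists v.
pose S s := [set w | lam < v s w].
have FS s : 0 <= s -> F s (S s).
  by move=> s0; apply: sigma_lt; [exact: filtration_sigma|case: (vP s s0)].
have [|B [mB _ BS Bc]] := @essential_union R d T mu R [set s | 0 <= s] S.
  by move=> s /= s0; exact: (filtration_sub s0 (FS s s0)).
exists B; split=> //.
  have ufin : (\int[mu]_w (u w)%:E)%E \is a fin_num by exact: integrable_fin_num ui.
  rewrite -lee_pdivlMl//; apply: Bc => s sD.
  pose r := sort <=%R s.
  have -> : \big[setU/set0]_(i <- s) S i = \big[setU/set0]_(i <- r) S i.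
    by apply: perm_big; rewrite perm_sym perm_sort.
  have r0 : path <=%R 0 r.
    rewrite path_min_sorted ?sort_le_sorted//; apply/allP => x.
    rewrite mem_sort => xs; apply: sD; move: xs; elim: (s) => //= y t IH.
    by rewrite inE => /predU1P[->|/IH]; [left|right].
  have F00 : F 0 set0 by case: (filtration_sigma (lexx (0 : R))).
  have [mU] := doob_finite lam ui u0 (lexx _) vP r0 F00.
  rewrite setD0 => h; rewrite lee_pdivlMl//.
  rewrite -(fineK ufin) -[mu _]fineK ?fin_num_measure// -EFinM lee_fin.
  apply: le_trans h _; rewrite -lee_fin /Rintegral !fineK//.
    apply: ge0_subset_integral => //.
      by apply/measurable_EFinP; exact: integrable_measurable ui.
    by move=> w _; rewrite lee_fin.
  apply: integrable_fin_num => //; exact: integrableS ui.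
move=> s v' s0 uv'.
have vv' : {ae mu, forall w, v' w <= v s w}.
  apply: (rexp_le (filtration_sigma s0) (filtration_sub s0) ui ui uv' (vP s s0)).
  exact: aeW.
have : {ae mu, forall w, ~ B w -> v s w <= lam}.
  exists (S s `\` B); split; last 1 first.
  - move=> w /= /not_implyP[nB nS]; split=> //=; rewrite /S /= ltNge; exact/negP.
  - by apply: measurableD => //; exact: (filtration_sub s0 (FS s s0)).
  - exact: BS.
by apply: filterS2 vv' => w h1 h2 /h2; exact: le_trans.
Qed.

End Doob.

(** * Convergence of martingales *)

Section Martingale.
Context (R : realType) d (T : measurableType d).
Variable mu : {finite_measure set T -> \bar R}.
Variable F : R -> set (set T).
Hypothesis F_filtration : filtration F.
Variable X : completeNormedModType R.
Hypothesis X_separable : separable X.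
Local Notation Foo := (filtration_limit F).
Local Notation F_sigma := (filtration_sigma F_filtration).
Local Notation F_sub := (filtration_sub F_filtration).

Lemma filtration_limit_sigma : sigma_algebra setT Foo.
Proof. exact: smallest_sigma_algebra. Qed.

Lemma filtration_limit_sub : Foo `<=` measurable.
Proof.
apply: smallest_sub; first exact: sigma_algebra_measurable.
by move=> A [s s0 FA]; exact: (F_sub s0 FA).
Qed.

Lemma filtration_limit_ge s : 0 <= s -> F s `<=` Foo.
Proof. by move=> s0 A FA; apply: sub_sigma_algebra; exists s. Qed.

Lemma sub_dmeas_mono s t (k : T -> X) : 0 <= s -> s <= t ->
  sub_dmeas (F s) k -> sub_dmeas (F t) k.
Proof.
move=> s0 st km l lX _ B mB; have t0 := le_trans s0 st.
apply/(measurable_subE (F_sigma t0)); apply: (filtration_mono F_filtration s0 st).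
by apply/(measurable_subE (F_sigma s0)); exact: km.
Qed.

Definition approximable (h : T -> X) := forall e : R, 0 < e -> exists s k,
  [/\ 0 <= s, sub_dmeas (F s) k, (nrm mu setT k < +oo)%E &
      (nrm mu setT (fun w => h w - k w)%R <= e%:E)%E].

Lemma approximable_sum (h h' : T -> X) : dmeas h -> dmeas h' ->
  approximable h -> approximable h' -> approximable (fun w => h w + h' w).
Proof.
move=> hm hm' ha ha' e e0; have e2 : 0 < e / 2 by rewrite divr_gt0.
have [s [k [s0 km koo hk]]] := ha _ e2.
have [s' [k' [s0' km' koo' hk']]] := ha' _ e2.
have m0 : 0 <= Num.max s s' by rewrite le_max s0.
have kd := sub_dmeas_dmeas (F_sigma s0) (F_sub s0) km.
have kd' := sub_dmeas_dmeas (F_sigma s0') (F_sub s0') km'.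
exists (Num.max s s'), (fun w => k w + k' w); split=> //.
- apply: (@dmeasD R X _ (g_sigma_algebraType (F (Num.max s s')))).
    by apply: sub_dmeas_mono km => //; rewrite le_max lexx.
  by apply: sub_dmeas_mono km' => //; rewrite le_max lexx orbT.
- by apply: le_lt_trans (nrmD _ X_separable measurableT kd kd') _; rewrite lte_add_pinfty.
- have -> : (fun w => h w + h' w - (k w + k' w)) = (fun w => (h w - k w) + (h' w - k' w)).
    by apply/funext => w; rewrite opprD addrACA.
  apply: le_trans (nrmD _ X_separable measurableT (dmeasB hm kd) (dmeasB hm' kd')) _.
  by rewrite (splitr e) EFinD leeD.
Qed.

Lemma approximableN (h : T -> X) : approximable h -> approximable (fun w => - h w).
Proof.
move=> ha e e0; have [s [k [s0 km koo hk]]] := ha _ e0.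
exists s, (fun w => - k w); split=> //.
- rewrite (_ : (fun w => - k w) = (fun w => (-1) *: k w)).
    exact: (@dmeasZ R X _ (g_sigma_algebraType (F s))).
  by apply/funext => w; rewrite scaleN1r.
- by rewrite /nrm; under eq_integral do rewrite normrN.
- by rewrite /nrm; under eq_integral do rewrite -opprB opprK normrN addrC.
Qed.

Lemma approximable_lim (h : T -> X) : dmeas h ->
  (forall e : R, 0 < e -> exists h', [/\ dmeas h', approximable h' &
     (nrm mu setT (fun w => h w - h' w)%R <= e%:E)%E]) -> approximable h.
Proof.
move=> hm ha e e0; have e2 : 0 < e / 2 by rewrite divr_gt0.
have [h' [hm' ha' hh']] := ha _ e2; have [s [k [s0 km koo hk]]] := ha' _ e2.
exists s, k; split=> //.
have kd := sub_dmeas_dmeas (F_sigma s0) (F_sub s0) km.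
apply: le_trans (nrm_dist_trans _ X_separable measurableT hm hm' kd) _.
by rewrite (splitr e) EFinD leeD.
Qed.

Let ind (A : set T) (x : X) (w : T) : X := \1_A w *: x.

Let ind_dmeas A x : measurable A -> dmeas (ind A x).
Proof.
by move=> mA; apply: dmeasZf; [exact: measurable_indic|exact: dmeas_cst].
Qed.

Let nrm_ind A x : measurable A -> nrm mu setT (ind A x) = (`|x|%:E * mu A)%E.
Proof.
move=> mA; rewrite /nrm; under eq_integral do rewrite normrZ mulrC EFinM ger0_norm//.
rewrite ge0_integralZl//; last first.
- by apply/measurable_EFinP; exact: measurable_indic.
by rewrite integral_indic// setIT.
Qed.

(** Dynkin's argument: the [F s] are nested, so their union is stable under intersection, and the
    sets with approximable indicator are stable under complements and disjoint countable unions. *)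
Lemma approximable_indic A x : Foo A -> approximable (ind A x).
Proof.
have F0 : 0 <= (0 : R) by [].
have Fs := filtration_limit_sigma.
have approxF s B : 0 <= s -> F s B -> approximable (ind B x).
  move=> s0 FB e e0; have mB := F_sub s0 FB; exists s, (ind B x); split=> //.
  - apply: (@dmeasZf R X _ (g_sigma_algebraType (F s))); last exact: dmeas_cst.
    by apply: measurable_indic; apply/(measurable_subE (F_sigma s0)).
  - by rewrite nrm_ind// lte_mul_pinfty ?lee_fin//; exact: fin_mu.
  - rewrite /nrm; under eq_integral do rewrite subrr normr0.
    by rewrite integral0 lee_fin ltW.
move=> FA.
pose G0 := \bigcup_(s in [set s | 0 <= s]) F s.
have E : (measurable : set (set (g_sigma_algebraType Foo))) = <<s G0 >>.
  by apply/seteqP; split=> B /(measurable_subE Fs).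
apply: (@dynkin_induction _ (g_sigma_algebraType Foo) G0
  (fun B => approximable (ind B x)) E _ _ _ _ _ A FA).
- move=> B1 B2 [s1 s10 F1] [s2 s20 F2].
  have m0 : 0 <= Num.max s1 s2 by rewrite le_max s10.
  exists (Num.max s1 s2) => //.
  have /(measurable_subE (F_sigma m0)) h1 : F (Num.max s1 s2) B1.
    by apply: (filtration_mono F_filtration s10 _ F1); rewrite le_max lexx.
  have /(measurable_subE (F_sigma m0)) h2 : F (Num.max s1 s2) B2.
    by apply: (filtration_mono F_filtration s20 _ F2); rewrite le_max lexx orbT.
  by apply/(measurable_subE (F_sigma m0)); exact: measurableI.
- apply: (approxF 0 setT) => //; apply/(measurable_subE (F_sigma F0)).
  exact: measurableT.
- by move=> B [s s0 FB]; exact: (approxF s).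
- move=> B /(measurable_subE Fs)/filtration_limit_sub mB aB.
  have -> : ind (~` B) x = (fun w => ind setT x w + - ind B x w).
    apply/funext => w; rewrite /ind -scalerBl; congr (_ *: _).
    by rewrite !indicE in_setC in_setT; case: (w \in B); rewrite /= ?subrr ?subr0.
  apply: approximable_sum; [exact: ind_dmeas| | |exact: approximableN].
    have -> : (fun w => - ind B x w) = (fun w => (-1) *: ind B x w).
      by apply/funext => w; rewrite scaleN1r.
    by apply: dmeasZ; exact: ind_dmeas.
  apply: (approxF 0 setT) => //; apply/(measurable_subE (F_sigma F0)).
  exact: measurableT.
- move=> B mB tB aB.
  have mB' n : measurable (B n : set T).
    by apply: filtration_limit_sub; apply/(measurable_subE Fs).
  have mU : measurable (\bigcup_n B n : set T) by exact: bigcup_measurable.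
  pose C n := \bigcup_k B k `\` \bigcup_(i < n) B i.
  have mUn n : measurable (\bigcup_(i < n) B i : set T) by apply: bigcup_measurable.
  have mC n : measurable (C n : set T) by apply: measurableD.
  have C0 : (mu \o C) n @[n --> \oo] --> mu (\bigcap_n C n).
    apply: nonincreasing_cvg_mu => //; first exact: fin_mu.
      exact: bigcap_measurable.
    move=> n m nm; apply/subsetPset => w [Fw nF]; split=> //.
    by move=> [i /= ni Fi]; apply: nF; exists i => //=; exact: leq_trans nm.
  have CE : \bigcap_n C n = set0.
    apply/seteqP; split=> // w Dw; have [[k _ Fk] _] := Dw 0%N Logic.I.
    by have [_] := Dw k.+1 Logic.I; apply; exists k => /=.
  apply: approximable_lim => [|e e0]; first exact: ind_dmeas.
  have x1 : 0 < `|x| + 1 by rewrite ltr_wpDl.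
  have e1 : 0 < e / (`|x| + 1) by rewrite divr_gt0.
  rewrite CE measure0 in C0; move/cvge0P : C0 => C0.
  have [//|n _ /(_ n (leqnn _)) /= Cn] := C0 _ _ e1.
  exists (ind (\bigcup_(i < n) B i) x); split; first exact: ind_dmeas.
    have {}IH m : approximable (ind (\bigcup_(i < m) B i) x).
      elim: m => [|m IH].
        apply: (approxF 0) => //; rewrite bigcup_mkord big_ord0.
        by case: (F_sigma F0).
      have -> : ind (\bigcup_(i < m.+1) B i) x =
          (fun w => ind (\bigcup_(i < m) B i) x w + ind (B m) x w).
        apply/funext => w; rewrite /ind -scalerDl; congr (_ *: _).
        rewrite !indicE; have [Bm|nBm] := pselect (B m w).
          rewrite [in RHS]memNset; last first.
            move=> [i /= im Bi]; have := tB i m Logic.I Logic.I.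
            by move=> /(_ (ex_intro _ w (conj Bi Bm))) iE; rewrite iE ltnn in im.
          by rewrite !mem_set//= ?add0r//; exists m => /=.
        rewrite [w \in B m]memNset// addr0; congr (_%:R); congr nat_of_bool.
        apply/idP/idP => /set_mem[i /= im Bi]; apply/mem_set; exists i => //=.
          by rewrite ltn_neqAle -ltnS im andbT; apply/eqP => iE; rewrite iE in Bi.
        exact: ltnW.
      by apply: approximable_sum => //; exact: ind_dmeas.
    exact: IH.
  have -> : (fun w => ind (\bigcup_k B k) x w - ind (\bigcup_(i < n) B i) x w) = ind (C n) x.
    apply/funext => w; rewrite /ind -scalerBl; congr (_ *: _).
    rewrite !indicE /C in_setD.
    have [h|h] := pselect ((\bigcup_(i < n) B i) w).
      rewrite (mem_set h) andbF mem_set ?subrr//.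
      by case: h => i _ Bi; exists i.
    by rewrite (memNset h) andbT subr0.
  rewrite nrm_ind//; apply: (@le_trans _ _ (`|x|%:E * (e / (`|x| + 1))%:E)%E).
    by apply: lee_wpmul2l; [rewrite lee_fin|exact: ltW].
  rewrite -EFinM lee_fin mulrA ler_pdivrMr// mulrC ler_wpM2l ?lerDl//; exact: ltW.
Qed.

Lemma approximable_limit h : sub_dmeas Foo h -> (nrm mu setT h < +oo)%E -> approximable h.
Proof.
move=> hm hoo; have Fs := filtration_limit_sigma; have Fsub := filtration_limit_sub.
have hd := sub_dmeas_dmeas Fs Fsub hm.
have [s_ [sm sh sle]] := @dmeas_simple R X X_separable _ (g_sigma_algebraType Foo) h hm.
have sm' n x : measurable (s_ n @^-1` [set x] : set T).
  by apply: Fsub; apply/(measurable_subE Fs); exact: sm.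
have sd n : dmeas (s_ n : T -> X) by apply: dmeas_fin.
apply: approximable_lim => // e e0.
have hi : mu.-integrable setT (EFin \o (fun w => `|h w|)).
  apply/integrableP; split; first exact: measurable_EFin_norm.
  by under eq_integral do rewrite /= normr_id.
have : nrm mu setT (fun w => s_ n w - h w)%R @[n --> \oo] --> 0%E.
  apply: (nrm_dominated_cvg0 X_separable sd hd hi).
    by apply: aeW => w; exact: sh.
  by apply: aeW => w n; rewrite distrC; exact: sle.
move=> /cvge0P c0; have [n|N _ /(_ N (leqnn _)) h0] := c0 _ _ e0; first exact: nrm_ge0.
exists (s_ N); split=> //; last by rewrite nrm_distC ltW.
pose r : seq X := fset_set (range (s_ N)).
have -> : (s_ N : T -> X) = (fun w => \sum_(x <- r) ind (s_ N @^-1` [set x]) x w).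
  by apply/funext => w; exact: (simple_sumE (s_ N) id w).
elim: r => [|x r IH].
  have -> : (fun w => \sum_(x <- [::]) ind (s_ N @^-1` [set x]) x w) = ind set0 0.
    by apply/funext => w; rewrite big_nil /ind scaler0.
  by apply: approximable_indic; case: Fs.
under eq_fun do rewrite big_cons.
apply: approximable_sum => //.
- exact: ind_dmeas.
- by apply: dmeas_sum => y _; exact: ind_dmeas.
- by apply: approximable_indic; apply/(measurable_subE Fs); exact: sm.
Qed.

Lemma cexp_self (G : set (set T)) (k : T -> X) : sub_dmeas G k ->
  (nrm mu setT k < +oo)%E -> cexp mu G k k.
Proof. by split. Qed.

Lemma cexp_tower s (f foo g : T -> X) : 0 <= s -> cexp mu Foo f foo -> cexp mu (F s) f g ->
  cexp mu (F s) foo g.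
Proof.
move=> s0 [_ _ h] [gm goo h']; split=> // B FB l lX.
by rewrite -h// ?h'//; exact: (filtration_limit_ge s0 FB).
Qed.

Lemma markov_set (u : T -> X) lam : dmeas u -> 0 < lam ->
  (lam%:E * mu [set w | (lam <= `|u w|)%R] <= nrm mu setT u)%E.
Proof.
move=> um lam0.
have := le_integral_abse mu measurableT (measurable_EFin_norm X_separable um (D := setT)) lam0.
rewrite setTI; under eq_integral do rewrite /= normr_id.
by under eq_set do rewrite /= lee_fin normr_id.
Qed.

(* For [s] so large that [f] is L1-close to an [F s]-measurable [k], the maximal
   inequality controls [M s - k = E(f - k | F s)] uniformly in [s]. *)
Theorem martingale_au_cvg (f foo : T -> X) (M : R -> T -> X) :
  dmeas f -> (nrm mu setT f < +oo)%E -> cexp mu Foo f foo ->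
  (forall s, 0 <= s -> cexp mu (F s) f (M s)) ->
  au_cvg mu (fun N => [set s : R | N%:R <= s]) M foo.
Proof.
move=> fm foo_ ffoo fM lam eps lam0 eps0.
have Fs := filtration_limit_sigma; have Fsub := filtration_limit_sub.
have fooM := cexp_dmeas Fs Fsub ffoo; have [sfoom fooo _] := ffoo.
have lam2 : 0 < lam / 2 by rewrite divr_gt0.
(* Doob's and Markov's inequalities are both used at level [lam / 2], and each exceptional set may
   take [eps / 2]. *)
have del0 : 0 < lam * eps / 4 by rewrite divr_gt0// mulr_gt0.
have [s0 [k [s00 km koo hk]]] := approximable_limit sfoom fooo del0.
have kd := sub_dmeas_dmeas (F_sigma s00) (F_sub s00) km.
have dd := dmeasB fooM kd.
have doo := nrm_dist_lty X_separable fooM kd fooo koo.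
pose u w := `|foo w - k w|.
have ui : mu.-integrable setT (EFin \o u).
  apply/integrableP; split; first exact: (measurable_EFin_norm X_separable dd).
  by under eq_integral do rewrite /= normr_id.
have [B1 [mB1 B1e B1P]] := doob_maximal F_filtration lam2 ui (fun w => normr_ge0 _).
pose B2 := [set w | lam / 2 <= u w].
have mB2 : measurable B2.
  have := measurable_fun_ler (measurable_cst (lam / 2)) (measurable_norm_dmeas X_separable dd).
  by move=> /(_ measurableT [set true]); rewrite setTI; exact.
have bnd (B : set T) : measurable B ->
    ((lam / 2)%:E * mu B <= nrm mu setT (fun w => foo w - k w)%R)%E ->
    (mu B <= (eps / 2)%:E)%E.
  move=> mB h; have {}h := le_trans h hk.
  have Bf : mu B \is a fin_num by rewrite fin_num_measure.
  move: h; rewrite -(fineK Bf) -EFinM !lee_fin => h.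
  rewrite -(ler_pM2l lam2); apply: le_trans h _.
  by rewrite le_eqVlt; apply/orP; left; apply/eqP; field.
exists (Num.bound s0), (B1 `|` B2); split.
- exact: measurableU.
- apply: le_trans (measureU2 mu mB1 mB2) _.
  rewrite (splitr eps) EFinD leeD//; first exact: bnd.
  by apply: bnd => //; exact: markov_set.
- move=> s /= sN; have ss0 : s0 <= s.
    by apply: le_trans sN; apply: ltW; exact: archi_boundP.
  have s0' : 0 <= s by exact: le_trans ss0.
  have [v uv] := rexp_exists (F_sigma s0') (F_sub s0') ui.
  have ck : cexp mu (F s) k k.
    by apply: cexp_self => //; exact: sub_dmeas_mono km.
  have cM := cexp_tower s0' ffoo (fM s s0').
  have := cexp_lin (F_sigma s0') (F_sub s0') X_separable (-1) kd fooM koo fooo ck cM.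
  have -> : (fun w => -1 *: k w + foo w) = (fun w => foo w - k w).
    by apply/funext => w; rewrite scaleN1r addrC.
  move=> /(cexp_norm_le (F_sigma s0') (F_sub s0') X_separable dd doo ui) Mk.
  have {}Mk := Mk v (aeW _ (fun w => lexx _)) uv.
  have hB1 := B1P s v s0' uv.
  apply: filterS2 Mk hB1 => w; rewrite scaleN1r addrC => h1 h2 nB.
  have {}h2 := h2 (fun b => nB (or_introl b)).
  have h3 : u w < lam / 2 by rewrite ltNge; apply/negP => b; apply: nB; right.
  rewrite (le_trans (ler_distD (k w) _ _))//.
  by move: h3; rewrite /u (distrC (foo w)); lra.
Qed.

End Martingale.

(** * Maximal ergodic inequality *)

Section BanachPrinciple.
Context (R : realType) d (T : measurableType d).
Variable mu : {measure set T -> \bar R}.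

(** At a fixed level the exceptional sets can be made of measure [2^-1 ^+ n] for every [n], so their
    intersection is null; monotonicity reduces to countably many levels. It converts a maximal
    inequality into an almost everywhere Cauchy property. *)
Lemma ae_forall_small (P : R -> T -> Prop) :
  (forall lam lam' w, lam <= lam' -> P lam w -> P lam' w) ->
  (forall lam eps : R, 0 < lam -> 0 < eps -> exists B,
    [/\ measurable B, (mu B <= eps%:E)%E & {ae mu, forall w, ~ B w -> P lam w}]) ->
  {ae mu, forall w lam, 0 < lam -> P lam w}.
Proof.
move=> Pmono PB.
suff H : {ae mu, forall w (k : nat), P (2^-1 ^+ k) w}.
  apply: filterS H => w Hw lam /half_pow_lt[k _ /(_ k (leqnn _)) h].
  exact: Pmono (ltW h) (Hw k).
apply: ae_foralln => k.
have /choice[B BP] n : exists B, [/\ measurable B, (mu B <= (2^-1 ^+ n)%:E)%E &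
    {ae mu, forall w, ~ B w -> P (2^-1 ^+ k) w}].
  by apply: PB; exact: half_pow_gt0.
have mB n : measurable (B n) by case: (BP n).
have B0 : mu (\bigcap_n B n) = 0%E.
  apply/eqP; rewrite eq_le measure_ge0 andbT; apply/lee_addgt0Pr => e e0.
  rewrite add0e; have [n _ /(_ n (leqnn _)) ne] := half_pow_lt e0.
  apply: (@le_trans _ _ (mu (B n))); last first.
    by have [_ h _] := BP n; apply: le_trans h _; rewrite lee_fin ltW.
  apply: le_mu => //; last by move=> w; apply.
  exact: bigcap_measurable.
have H : {ae mu, forall w, ~ (\bigcap_n B n) w}.
  exists (\bigcap_n B n); split=> //; first exact: bigcap_measurable.
  by move=> w /contrapT.
have H' : {ae mu, forall w n, ~ B n w -> P (2^-1 ^+ k) w}.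
  by apply: ae_foralln => n; case: (BP n).
by apply: filterS2 H H' => w /existsNP[n /not_implyP[_ nB]] h; exact: h nB.
Qed.

End BanachPrinciple.

(** * Contractions on representatives and their partial sums *)

Section Contraction.
Context (R : realType) (X : completeNormedModType R).
Hypothesis X_separable : separable X.
Context d (T : measurableType d).
Variable mu : {finite_measure set T -> \bar R}.
Implicit Types f g : T -> X.

Lemma L1_dmeas f : L1 mu f -> dmeas f.
Proof. by move=> /(L1P X_separable _ _)[fm _]; exact: fm. Qed.

Lemma L1_nrm f : L1 mu f -> (nrm mu setT f < +oo)%E.
Proof. by move=> /(L1P X_separable _ _)[]. Qed.

Lemma L1_lin a f g : L1 mu f -> L1 mu g -> L1 mu (fun w => a *: f w + g w).
Proof.
move=> /(L1P X_separable _ _)[fm foo] /(L1P X_separable _ _)[gm goo].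
apply/(L1P X_separable _ _); split; first exact: dmeas_lin.
apply: le_lt_trans (nrmD _ X_separable measurableT (dmeasZ a fm) gm) _.
by rewrite nrmZ// lte_add_pinfty// lte_mul_pinfty.
Qed.

Lemma L1_cst x : L1 mu (fun=> x : X).
Proof.
apply/(L1P X_separable _ _); split; first exact: dmeas_cst.
by rewrite /nrm integral_cst// lte_mul_pinfty ?lee_fin//; exact: fin_mu.
Qed.

Lemma L1D f g : L1 mu f -> L1 mu g -> L1 mu (fun w => f w + g w).
Proof.
by move=> /(L1_lin 1)/[apply]; under eq_fun do rewrite scale1r.
Qed.

Lemma L1Z a f : L1 mu f -> L1 mu (fun w => a *: f w).
Proof.
by move=> /(L1_lin a)/(_ (L1_cst 0)); under eq_fun do rewrite addr0.
Qed.

Lemma L1B f g : L1 mu f -> L1 mu g -> L1 mu (fun w => f w - g w).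
Proof.
move=> fL gL; have := L1_lin (-1) gL fL.
by under eq_fun do rewrite scaleN1r addrC.
Qed.

Lemma L1_norm_integrable f : L1 mu f -> mu.-integrable setT (EFin \o (fun w => `|f w|)).
Proof.
move=> /(L1P X_separable _ _)[fm foo]; apply/integrableP; split.
  exact: (measurable_EFin_norm X_separable fm).
by under eq_integral do rewrite /= normr_id.
Qed.

Section Operator.
Variable U : (T -> X) -> (T -> X).
Hypothesis U_op : L1_Linf_contraction mu U.

Lemma contr_L1 f : L1 mu f -> L1 mu (U f).
Proof. by case: U_op => -[h _ _] _; exact: h. Qed.

Lemma contr_ae f g : L1 mu f -> L1 mu g -> {ae mu, forall w, f w = g w} ->
  {ae mu, forall w, U f w = U g w}.
Proof.
move=> fL gL fg; case: U_op => -[_ h _] _.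
have : U f = U g %[ae mu] by apply: h => //; apply: filterS fg => w ->.
by apply: filterS => w ->.
Qed.

Lemma contr_lin a f g : L1 mu f -> L1 mu g ->
  {ae mu, forall w, U (fun w => a *: f w + g w) w = a *: U f w + U g w}.
Proof.
by move=> fL gL; case: U_op => -[_ _ h] _; apply: filterS (h a f g fL gL) => w ->.
Qed.

Lemma contrD f g : L1 mu f -> L1 mu g ->
  {ae mu, forall w, U (fun w => f w + g w) w = U f w + U g w}.
Proof.
move=> fL gL; have := contr_lin 1 fL gL; apply: filterS => w.
by under eq_fun do rewrite scale1r; rewrite scale1r.
Qed.

Lemma contrB f g : L1 mu f -> L1 mu g ->
  {ae mu, forall w, U (fun w => f w - g w) w = U f w - U g w}.
Proof.
move=> fL gL; have := contr_lin (-1) gL fL; apply: filterS => w.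
by under eq_fun do rewrite scaleN1r addrC; rewrite scaleN1r addrC.
Qed.

Lemma contrZ a f : L1 mu f -> {ae mu, forall w, U (fun w => a *: f w) w = a *: U f w}.
Proof.
move=> fL; have L0 := L1_cst 0.
have U0 : {ae mu, forall w, U (fun=> 0) w = 0}.
  have := contr_lin (-1) L0 L0; apply: filterS => w.
  by under eq_fun do rewrite scaleN1r addNr; rewrite scaleN1r addNr.
apply: filterS2 U0 (contr_lin a fL L0) => w U0.
by under eq_fun do rewrite addr0; rewrite U0 addr0.
Qed.

Lemma contr_nrm f : L1 mu f -> (nrm mu setT (U f) <= nrm mu setT f)%E.
Proof. by case: U_op => _ h /h[]; rewrite !Lnorm1_nrm. Qed.

Lemma contr_nrm_dist f g : L1 mu f -> L1 mu g ->
  (nrm mu setT (fun w => U f w - U g w)%R <= nrm mu setT (fun w => f w - g w)%R)%E.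
Proof.
move=> fL gL; apply: le_trans (contr_nrm (L1B fL gL)).
rewrite (_ : nrm _ _ _ = nrm mu setT (U (fun w => f w - g w)))//.
apply: eq_nrm_ae => //.
- by apply: dmeasB; apply/L1_dmeas/contr_L1.
- by apply/L1_dmeas/contr_L1/L1B.
- by apply: filterS (contrB fL gL) => w -> _.
Qed.

Lemma contr_bound f (C : R) : L1 mu f -> 0 <= C ->
  {ae mu, forall w, `|f w| <= C} -> {ae mu, forall w, `|U f w| <= C}.
Proof.
move=> fL C0 fC; case: U_op => _ /(_ f fL)[_].
rewrite /Lnorm_vector unlock.
have ufm := measurable_EFin_norm X_separable (L1_dmeas (contr_L1 fL)) (D := setT).
(* The norm at infinity is defined by cases on whether the whole space has positive measure; on a
   null space every statement holds almost everywhere. *)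
case: ifPn => [mu0 h|]; last first.
  rewrite -leNgt => mu0 _; exists setT; split=> //.
  by apply/eqP; rewrite eq_le mu0 measure_ge0.
have hf : (ess_sup_inf.ess_sup mu (abse \o (fun w => (`|f w|)%:E)) <= C%:E)%E.
  by apply/ess_sup_inf.ess_supP; apply: filterS fC => w fw /=; rewrite lee_fin normr_id.
have := le_trans h hf => /ess_sup_inf.ess_supP; apply: filterS => w /=.
by rewrite lee_fin normr_id.
Qed.

(** The sum of [iter k U f] for [k < n] in Horner form. The recursion [f + U (S n)] is the one used
    by Garsia's argument and by the comparison with a positive operator. *)
Fixpoint partial_sum (f : T -> X) n : T -> X :=
  if n is k.+1 then (fun w => f w + U (partial_sum f k) w) else (fun=> 0).

Lemma partial_sum_L1 f n : L1 mu f -> L1 mu (partial_sum f n).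
Proof.
move=> fL; elim: n => [|n IH] /=; first exact: L1_cst.
by apply: L1D => //; exact: contr_L1.
Qed.

Lemma partial_sum_lin a f g n : L1 mu f -> L1 mu g ->
  {ae mu, forall w, partial_sum (fun w => a *: f w + g w) n w =
                    a *: partial_sum f n w + partial_sum g n w}.
Proof.
move=> fL gL; elim: n => [|n IH] /=; first by apply: aeW => w; rewrite scaler0 addr0.
have Sf := partial_sum_L1 n fL; have Sg := partial_sum_L1 n gL.
have := contr_ae (partial_sum_L1 n (L1_lin a fL gL)) (L1_lin a Sf Sg) IH.
apply: filterS2 (contr_lin a Sf Sg) => w -> ->.
by rewrite scalerDr addrACA.
Qed.

Lemma partial_sum_ae f g n : L1 mu f -> L1 mu g -> {ae mu, forall w, f w = g w} ->
  {ae mu, forall w, partial_sum f n w = partial_sum g n w}.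
Proof.
move=> fL gL fg; elim: n => [|n IH] /=; first exact: aeW.
have := contr_ae (partial_sum_L1 n fL) (partial_sum_L1 n gL) IH.
by apply: filterS2 fg => w -> ->.
Qed.

Lemma partial_sum_fixed h n : L1 mu h -> {ae mu, forall w, U h w = h w} ->
  {ae mu, forall w, partial_sum h n w = n%:R *: h w}.
Proof.
move=> hL Uh; elim: n => [|n IH] /=; first by apply: aeW => w; rewrite scale0r.
have := contr_ae (partial_sum_L1 n hL) (L1Z n%:R hL) IH.
have {}Uh : {ae mu, forall w, U (fun w => n%:R *: h w) w = n%:R *: h w}.
  by apply: filterS2 Uh (contrZ n%:R hL) => w Uhw ->; rewrite Uhw.
by apply: filterS2 Uh => w -> ->; rewrite -[X in X + _]scale1r -scalerDl -natr1 addrC.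
Qed.

Lemma iter_L1 f n : L1 mu f -> L1 mu (iter n U f).
Proof. by move=> fL; elim: n => //= n; exact: contr_L1. Qed.

Lemma iter_bound f C n : L1 mu f -> 0 <= C -> {ae mu, forall w, `|f w| <= C} ->
  {ae mu, forall w, `|iter n U f w| <= C}.
Proof.
move=> fL C0 fC; elim: n => //= n; apply: contr_bound => //; exact: iter_L1.
Qed.

Lemma partial_sum_telescope g n : L1 mu g ->
  {ae mu, forall w, partial_sum (fun w => g w - U g w) n w = g w - iter n U g w}.
Proof.
move=> gL; elim: n => [|n IH] /=; first by apply: aeW => w; rewrite subrr.
have dL := L1B gL (contr_L1 gL).
have := contr_ae (partial_sum_L1 n dL) (L1B gL (iter_L1 n gL)) IH.
apply: filterS2 (contrB gL (iter_L1 n gL)) => w -> ->.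
by rewrite addrA subrK.
Qed.

End Operator.
End Contraction.

(** * Hopf's inequality for a positive contraction *)

Section MaximalErgodic.
Context (R : realType) d (T : measurableType d).
Variable mu : {finite_measure set T -> \bar R}.
Local Notation X_sep := (separable_real R).
Variable Q : (T -> R^o) -> (T -> R^o).
Hypothesis Q_op : L1_Linf_contraction mu Q.
Hypothesis Q_pos : forall u : T -> R^o, L1 mu u -> {ae mu, forall w, 0 <= u w} ->
  {ae mu, forall w, 0 <= Q u w}.
Implicit Types u v : T -> R^o.
Local Notation S := (partial_sum Q).

Lemma L1_integrable u : L1 mu u -> mu.-integrable setT (EFin \o (u : T -> R)).
Proof.
move=> /(L1P X_sep _ _)[um uoo]; apply/integrableP; split=> //.
by apply/measurable_EFinP; exact/dmeas_real.
Qed.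

Lemma integrable_L1 (u : T -> R) : mu.-integrable setT (EFin \o u) -> L1 mu (u : T -> R^o).
Proof.
move=> ui; apply/(L1P X_sep _ _); split; last by case/integrableP : ui.
by apply/dmeas_real; exact: integrable_measurable ui.
Qed.

Lemma pos_mono u v : L1 mu u -> L1 mu v -> {ae mu, forall w, u w <= v w} ->
  {ae mu, forall w, Q u w <= Q v w}.
Proof.
move=> uL vL uv.
have h : {ae mu, forall w, 0 <= Q (fun w => v w - u w) w}.
  by apply: Q_pos; [exact: (L1B X_sep)|apply: filterS uv => w; rewrite subr_ge0].
apply: filterS2 h (contrB Q_op vL uL) => w hw e.
by rewrite -subr_ge0; exact: (eq_ind _ (fun z : R => 0 <= z) hw _ e).
Qed.

Lemma partial_sum_mono u v n : L1 mu u -> L1 mu v -> {ae mu, forall w, u w <= v w} ->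
  {ae mu, forall w, S u n w <= S v n w}.
Proof.
move=> uL vL uv; elim: n => [|n IH] /=; first exact: aeW.
have := pos_mono (partial_sum_L1 X_sep Q_op n uL) (partial_sum_L1 X_sep Q_op n vL) IH.
by apply: filterS2 uv => w; exact: lerD.
Qed.

Lemma pos_one_le1 : {ae mu, forall w, Q (fun=> 1) w <= 1}.
Proof.
have := contr_bound X_sep Q_op (L1_cst X_sep mu (1 : R^o)) ler01.
move=> /(_ (aeW _ (fun w => _))); rewrite normr1 => /(_ (fun _ => lexx _)).
by apply: filterS => w; apply: le_trans; exact: ler_norm.
Qed.

Fixpoint max_sum u n : T -> R^o :=
  if n is k.+1 then (fun w => Num.max (max_sum u k w) (S u n w)) else (fun=> 0).

Lemma max_sum_ge0 u n w : 0 <= max_sum u n w.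
Proof. by elim: n => //= n IH; rewrite le_max IH. Qed.

Lemma max_sum_mono u n m w : (n <= m)%N -> max_sum u n w <= max_sum u m w.
Proof.
move=> /subnK <-; elim: (m - n)%N => [//|k IH].
by rewrite addSn /= le_max IH.
Qed.

Lemma max_sum_ge u n m w : (n <= m)%N -> S u n w <= max_sum u m w.
Proof.
move=> nm; apply: le_trans (max_sum_mono u w nm).
by case: n {nm} => [//|n]; rewrite /= le_max lexx orbT.
Qed.

Lemma max_sum_L1 u n : L1 mu u -> L1 mu (max_sum u n).
Proof.
move=> uL; elim: n => [|n IH]; first exact: (L1_cst X_sep).
have SL := partial_sum_L1 X_sep Q_op n.+1 uL.
apply: integrable_L1.
have Mi := L1_integrable IH; have Si := L1_integrable SL.
have Mm := integrable_measurable Mi; have Sm := integrable_measurable Si.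
have Ai : mu.-integrable setT (EFin \o (fun w => `|max_sum u n w| + `|S u n.+1 w|)).
  rewrite (_ : _ \o _ = (EFin \o (fun w => `|max_sum u n w|)%R) \+ (EFin \o (fun w => `|S u n.+1 w|)%R))%E//.
  by apply: integrableD => //; exact: (L1_norm_integrable X_sep).
apply: le_integrable Ai => //.
  by apply/measurable_EFinP; exact: measurable_maxr.
move=> w _; rewrite lee_fin [leRHS]ger0_norm ?addr_ge0//= /Num.max.
by case: ifPn => _; rewrite ?lerDl ?lerDr.
Qed.

(* Garsia's proof of Hopf's maximal ergodic theorem. *)
Lemma hopf_maximal u n : L1 mu u ->
  0 <= \int[mu]_(w in [set w | 0 < max_sum u n w]) u w.
Proof.
move=> uL; set M := max_sum u n; have ML : L1 mu M by exact: max_sum_L1.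
have QML := contr_L1 Q_op ML.
have QM0 : {ae mu, forall w, 0 <= Q M w}.
  by apply: Q_pos => //; apply: aeW => w; exact: max_sum_ge0.
(* A positive maximum is attained at some partial sum [u + Q (S u k)] with [k < n], and [S u k <= M]
   with [Q] positive. *)
have H m : (m <= n)%N -> {ae mu, forall w, 0 < max_sum u m w -> max_sum u m w <= u w + Q M w}.
  elim: m => [_|m IH mn]; first by apply: aeW => w /=; rewrite ltxx.
  have h : {ae mu, forall w, Q (S u m) w <= Q M w}.
    apply: pos_mono => //; first exact: (partial_sum_L1 X_sep).
    by apply: aeW => w; apply: max_sum_ge; exact: ltnW.
  apply: filterS2 (IH (ltnW mn)) h => w IHw hw /=.
  by rewrite /Num.max; case: ifPn => _; [move=> _; rewrite lerD2l|exact: IHw].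
pose A := [set w | 0 < M w].
have Mi := L1_integrable ML; have QMi := L1_integrable QML; have ui := L1_integrable uL.
have mA : measurable A.
  have := measurable_fun_ltr (measurable_cst (0 : R)) (integrable_measurable Mi).
  by move=> /(_ measurableT [set true]); rewrite setTI; exact.
have di : mu.-integrable setT (EFin \o (fun w => M w - Q M w)).
  rewrite (_ : _ \o _ = (EFin \o M) \- (EFin \o Q M))%E//.
  exact: integrableB.
have MA := integrableS measurableT mA (@subsetT _ _) Mi.
have QMA := integrableS measurableT mA (@subsetT _ _) QMi.
have dA := integrableS measurableT mA (@subsetT _ _) di.
have uA := integrableS measurableT mA (@subsetT _ _) ui.
apply: (@le_trans _ _ (\int[mu]_(w in A) (M w - Q M w))); last first.
  apply: le_Rintegral_ae_in => //.
  by apply: filterS (H n (leqnn _)) => w Hw Aw; rewrite lerBlDr; exact: Hw.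
(* [M] vanishes off [A], [Q M] is nonnegative there, and [Q] does not increase the total integral;
   so over [A] the integral of [Q M] is at most that of [M]. *)
rewrite RintegralB// subr_ge0.
have mC : measurable (~` A) by exact: measurableC.
have h1 : 0 <= \int[mu]_(w in ~` A) Q M w.
  have -> : 0 = \int[mu]_(w in ~` A) (0 : R) by rewrite Rintegral_cst// mul0r.
  by apply: le_Rintegral_ae => //; exact: integrable0.
have h2 : \int[mu]_(w in ~` A) M w <= 0.
  have -> : 0 = \int[mu]_(w in ~` A) (0 : R) by rewrite Rintegral_cst// mul0r.
  apply: le_Rintegral_ae_in => //; first exact: integrable0.
  by apply: aeW => w /negP; rewrite -leNgt.
have normE (k : T -> R^o) : L1 mu k -> {ae mu, forall w, 0 <= k w} ->
    \int[mu]_w k w = fine (nrm mu setT k).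
  move=> kL k0; congr fine; have ki := measurable_int _ (L1_integrable kL).
  apply: ae_eq_integral => //.
    exact: (measurable_EFin_norm X_sep (L1_dmeas X_sep kL)).
  by apply: filterS k0 => w kw _; rewrite ger0_norm.
have h3 : \int[mu]_w Q M w <= \int[mu]_w M w.
  rewrite !normE//; last by apply: aeW => w; exact: max_sum_ge0.
  apply: fine_le; [| |exact: (contr_nrm Q_op)];
    by rewrite ge0_fin_numE ?nrm_ge0//; exact: (L1_nrm X_sep).
by rewrite (Rintegral_setC mA QMi) (Rintegral_setC mA Mi) in h3; lra.
Qed.

(** Hopf's inequality is applied to [u - lam]. Since [Q 1 <= 1], the partial sums of [u - lam] are
    at least [S u n - n * lam], so they are positive wherever an average of [u] exceeds [lam]. *)
Lemma maximal_ergodic u (lam : R) : L1 mu u -> (forall w, 0 <= u w) -> 0 < lam ->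
  exists B, [/\ measurable B, (lam%:E * mu B <= nrm mu setT u)%E &
    {ae mu, forall w, ~ B w -> forall n, S u n w <= n%:R * lam}].
Proof.
move=> uL u0 lam0; pose v : T -> R^o := fun w => u w - lam.
have vL : L1 mu v by apply: (L1B X_sep) => //; exact: (L1_cst X_sep).
have cL c : L1 mu (fun=> c : R^o) by exact: (L1_cst X_sep).
have SuL n := partial_sum_L1 X_sep Q_op n uL.
have SvL n := partial_sum_L1 X_sep Q_op n vL.
have Suv n : {ae mu, forall w, S u n w - n%:R * lam <= S v n w}.
  elim: n => [|n IH]; first by apply: aeW => w /=; rewrite mul0r subr0.
  have kL : L1 mu (fun w => S u n w - n%:R * lam : R^o) by apply: (L1B X_sep).
  have h1 := pos_mono kL (SvL n) IH.
  have h2 := contrB Q_op (SuL n) (cL (n%:R * lam)).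
  have h3 : {ae mu, forall w, Q (fun=> n%:R * lam) w <= n%:R * lam}.
    have := contrZ X_sep Q_op (n%:R * lam) (cL 1).
    rewrite (_ : (fun w => n%:R * lam *: (1 : R^o)) = fun=> n%:R * lam); last first.
      by apply/funext => w; rewrite /GRing.scale/= mulr1.
    apply: filterS2 pos_one_le1 => w Q1 ->.
    rewrite /GRing.scale/= -[leRHS]mulr1 ler_wpM2l// mulr_ge0//; exact: ltW.
  near=> w => /=; rewrite /v.
  have k1 : Q (fun w => S u n w - n%:R * lam) w <= Q (S v n) w by near: w.
  have k2 : Q (fun w => S u n w - n%:R * lam) w = Q (S u n) w - Q (fun=> n%:R * lam) w.
    by near: w.
  have k3 : Q (fun=> n%:R * lam) w <= n%:R * lam by near: w.
  by rewrite -natr1 mulrDl mul1r; lra.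
pose A n := [set w | 0 < max_sum v n w].
have mA n : measurable (A n).
  have Mi := L1_integrable (max_sum_L1 n vL).
  have := measurable_fun_ltr (measurable_cst (0 : R)) (integrable_measurable Mi).
  by move=> /(_ measurableT [set true]); rewrite setTI; exact.
have mB : measurable (\bigcup_n A n) by exact: bigcup_measurable.
have uoo := L1_nrm X_sep uL.
exists (\bigcup_n A n); split=> //.
  have And : {homo A : n m / (n <= m)%N >-> (n <= m)%O}.
    by move=> n m nm; apply/subsetPset => w /=; move/lt_le_trans; apply; exact: max_sum_mono.
  have cA : (mu \o A) n @[n --> \oo] --> mu (\bigcup_n A n) by exact: nondecreasing_cvg_mu.
  rewrite -lee_pdivlMl//; apply: cvge_to_le cA _; apply: nearW => n /=.
  rewrite lee_pdivlMl//.
  have := hopf_maximal n vL; rewrite -/(A n) /v.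
  have uA := integrableS measurableT (mA n) (@subsetT _ _) (L1_integrable uL).
  rewrite RintegralB//; last by apply: finite_measure_integrable_cst.
  rewrite Rintegral_cst// subr_ge0 => h.
  have Af : mu (A n) \is a fin_num by rewrite fin_num_measure.
  rewrite -(fineK Af) -EFinM.
  apply: (@le_trans _ _ (\int[mu]_(w in A n) u w)%:E); first by rewrite lee_fin.
  rewrite /Rintegral fineK; last exact: integrable_fin_num.
  rewrite /nrm (eq_integral (fun w => (`|u w|)%:E)); last first.
    by move=> w _; rewrite ger0_norm.
  apply: ge0_subset_integral => //.
  exact: (measurable_EFin_norm X_sep (L1_dmeas X_sep uL)).
have := ae_foralln Suv; apply: filterS => w Sw nB n.
rewrite -subr_le0; apply: le_trans (Sw n) _.
apply: le_trans (max_sum_ge v w (leqnn n)) _.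
by rewrite leNgt; apply/negP => h; apply: nB; exists n.
Unshelve. all: by end_near. Qed.

End MaximalErgodic.

(** * Weak limits and functionals on L1 *)

Lemma ae_forall_count (R : realType) d (T : measurableType d)
    (mu : {measure set T -> \bar R}) (C : countType) (P : C -> T -> Prop) :
  (forall c, {ae mu, forall w, P c w}) -> {ae mu, forall w c, P c w}.
Proof.
move=> H; pose P' n w := if (choice.unpickle n : option C) is Some c then P c w else True.
have : {ae mu, forall w n, P' n w}.
  apply: ae_foralln => n; rewrite /P'; case: choice.unpickle => [c|]; first exact: H.
  exact: aeW.
by apply: filterS => w h c; have := h (choice.pickle c); rewrite /P' choice.pickleK.
Qed.

Section FunctionalExtension.
Variables (R : realType) (X : normedModType R).

(* McShane's formula extends the Lipschitz function [x_ i |-> m_ i]; linearity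
   follows by density. *)
Lemma dual_extension (x_ : nat -> X) (m_ : nat -> R) :
  (forall x e, 0 < e -> exists i, `|x - x_ i| < e) ->
  (forall i, `|m_ i| <= `|x_ i|) ->
  (forall i j k (q : rat),
     `|m_ i + ratr q * m_ j - m_ k| <= `|x_ i + ratr q *: x_ j - x_ k|) ->
  exists l, [/\ dual l, forall x, `|l x| <= `|x| & forall i, l (x_ i) = m_ i].
Proof.
move=> xd mb mlin.
have mL i k : `|m_ i - m_ k| <= `|x_ i - x_ k|.
  by have := mlin i i k 0; rewrite rmorph0 mul0r addr0 scale0r addr0.
pose E x := range (fun i => m_ i - `|x - x_ i|).
have Eub x : ubound (E x) `|x|.
  move=> _ [i _ <-]; have := ler_norm (m_ i); have := mb i.
  by have := ler_distD x (x_ i) 0; rewrite !subr0 (distrC (x_ i)); lra.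
have E0 x : E x !=set0 by exists (m_ 0%N - `|x - x_ 0%N|), 0%N.
pose l x := sup (E x).
have lge x i : m_ i - `|x - x_ i| <= l x.
  by apply: ub_le_sup; [exists `|x|; exact: Eub|exists i].
have lxi i : l (x_ i) = m_ i.
  apply/eqP; rewrite eq_le; apply/andP; split; last first.
    by have := lge (x_ i) i; rewrite subrr normr0 subr0.
  apply: ge_sup => // _ [k _ <-]; have := mL k i; rewrite (distrC (x_ k)).
  by have := ler_norm (m_ k - m_ i); lra.
have lL x y : l x - l y <= `|x - y|.
  rewrite lerBlDr; apply: ge_sup => // _ [k _ <-].
  by have := lge y k; have := ler_distD x y (x_ k); rewrite (distrC y x); lra.
have lL' x y : `|l x - l y| <= `|x - y|.
  by rewrite ler_norml lL andbT; have := lL y x; rewrite (distrC y x); lra.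
have lb x : `|l x| <= `|x|.
  apply/ler_addgt0Pr => e e0; have [i xi] := xd x (e / 2) (divr_gt0 e0 (ltr0Sn _ _)).
  have := lL' x (x_ i); rewrite lxi => h.
  have := mb i; have := ler_normD (l x - m_ i) (m_ i); rewrite subrK.
  by have := ler_distD x (x_ i) 0; rewrite !subr0 (distrC (x_ i)); lra.
exists l; split=> //; apply: (@dual_of_bound _ _ _ 1) => [a x y|x]; last by rewrite mul1r.
apply/eqP; rewrite -subr_eq0 -normr_le0; apply/ler_addgt0Pr => e e0; rewrite add0r.
(* The five terms of the final decomposition are bounded by multiples of [del] that add up to
   exactly [del * K]. *)
pose K := 2 * (`|a| + `|x| + 3).
have K0 : 0 < K by rewrite /K; have := normr_ge0 a; have := normr_ge0 x; lra.
pose del := Num.min 1 (e / K).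
have del0 : 0 < del by rewrite lt_min ltr01 divr_gt0.
have del1 : del <= 1 by rewrite ge_min lexx.
have delK : del * K <= e by rewrite -ler_pdivlMr// ge_min lexx orbT.
have [i xi] := xd x _ del0; have [j yj] := xd y _ del0.
have [k zk] := xd (a *: x + y) _ del0.
have [a' [/= aq [q _ qE]]] := @dense_rat R (ball a del) (ex_intro _ a (ballxx a del0)) (ball_open a del).
rewrite -ball_normE /= -qE in aq.
have h1 := mlin j i k q.
have li := lL' x (x_ i); have lj := lL' y (x_ j); have lk := lL' (a *: x + y) (x_ k).
rewrite !lxi in li lj lk.
have xib : `|x_ i| <= `|x| + 1.
  by have := ler_distD x (x_ i) 0; rewrite !subr0 (distrC (x_ i)); lra.
have h2 : `|x_ j + ratr q *: x_ i - x_ k| <= del * (2 + (`|x| + 1) + `|a|).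
  have sD (u v t : X) : u + t - (v + t) = u - v by rewrite opprD addrACA subrr addr0.
  have e1 : `|x_ j + ratr q *: x_ i - (y + ratr q *: x_ i)| < del.
    by rewrite sD distrC.
  have e2 : `|y + ratr q *: x_ i - (y + a *: x_ i)| <= del * (`|x| + 1).
    rewrite ![y + _]addrC sD -scalerBl normrZ distrC.
    by apply: ler_pM => //; exact: ltW.
  have e3 : `|y + a *: x_ i - (y + a *: x)| <= `|a| * del.
    rewrite ![y + _]addrC sD -scalerBr normrZ distrC.
    by rewrite ler_wpM2l// ltW.
  have e4 : `|y + a *: x - x_ k| < del by rewrite [y + _]addrC.
  have := ler_distD (y + ratr q *: x_ i) (x_ j + ratr q *: x_ i) (x_ k).
  have := ler_distD (y + a *: x_ i) (y + ratr q *: x_ i) (x_ k).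
  have := ler_distD (y + a *: x) (y + a *: x_ i) (x_ k).
  by lra.
have ai : `|a * (l x - m_ i)| <= `|a| * del by rewrite normrM ler_wpM2l// (le_trans li)// ltW.
have aqi : `|(a - ratr q) * m_ i| <= del * (`|x| + 1).
  by rewrite normrM; apply: ler_pM => //; [exact: ltW|exact: le_trans (mb i) xib].
have -> : l (a *: x + y) - (a * l x + l y) = (l (a *: x + y) - m_ k)
    - (m_ j + ratr q * m_ i - m_ k) - (l y - m_ j) - a * (l x - m_ i) - (a - ratr q) * m_ i.
  by ring.
have B0 := ler_normB (l (a *: x + y) - m_ k - (m_ j + ratr q * m_ i - m_ k) - (l y - m_ j)
  - a * (l x - m_ i)) ((a - ratr q) * m_ i).
have B1 := ler_normB (l (a *: x + y) - m_ k - (m_ j + ratr q * m_ i - m_ k) - (l y - m_ j))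
  (a * (l x - m_ i)).
have B2 := ler_normB (l (a *: x + y) - m_ k - (m_ j + ratr q * m_ i - m_ k)) (l y - m_ j).
have B3 := ler_normB (l (a *: x + y) - m_ k) (m_ j + ratr q * m_ i - m_ k).
by move: delK; rewrite /K; lra.
Qed.

End FunctionalExtension.

Section WeakSequentialLimits.
Variables (R : realType) (X : normedModType R).

Lemma dual_norm_bound (l : X -> R) x : dual l -> `|l x| <= dual_norm l * `|x|.
Proof.
move=> lX; have [C C0 lC] := dual_bound lX.
have [->|x0] := eqVneq x 0; first by rewrite dual0// !normr0 mulr0.
have x1 : 0 < `|x| by rewrite normr_gt0.
rewrite -ler_pdivrMr//; apply: ub_le_sup.
  exists C => _ [y /= y1 <-]; apply: le_trans (lC y) _.
  by rewrite -[leRHS]mulr1 ler_wpM2l.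
exists (`|x|^-1 *: x) => /=.
  by rewrite normrZ normfV normr_id mulVf// gt_eqF.
by rewrite dualZ// normrM normfV normr_id mulrC.
Qed.

Lemma bounded_ultra_limit (V : set_system nat) (r : nat -> R) M : UltraFilter V ->
  (forall n, `|r n| <= M) -> exists c : R^o, (r n : R^o) @[n --> V] --> c.
Proof.
move=> VU rM; have VP := ultra_proper.
have [|c [_ cV]] := @segment_compact R (- M) M (r n @[n --> V]) _.
  have : \forall n \near V, `[- M, M]%classic (r n) by
    apply: nearW => n; rewrite /= in_itv/= -ler_norml.
  by [].
exists c => A Ac; have [//|VnA] := in_ultra_setVsetC (r @^-1` A) VU.
have [y [nAy Ay]] := cV (~` A) A VnA Ac.
by case: (nAy Ay).
Qed.

(** Along an ultrafilter all the bounded scalar sequences [l (x_ n)] converge simultaneously; the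
    limits define an element of the bidual, and reflexivity turns it into a point. The cluster
    property is recorded through eventual upper bounds, which are all that is used of the
    ultrafilter afterwards. *)
Lemma reflexive_cluster (x_ : nat -> X) (C : R) : reflexive_space X ->
  (forall n, `|x_ n| <= C) -> exists h, forall l (c : R), dual l ->
    (\forall n \near \oo, l (x_ n) <= c) -> l h <= c.
Proof.
move=> Xr xC.
have [V [VU VF]] := @ultraFilterLemma nat (nbhs \oo) _.
have lC l : dual l -> forall n, `|l (x_ n)| <= C * dual_norm l.
  move=> lX n; apply: le_trans (dual_norm_bound (x_ n) lX) _.
  rewrite mulrC ler_wpM2r//; apply: le_trans (_ : `|l 0| <= _); first by [].
  apply: ub_le_sup; last by exists 0 => //=; rewrite normr0.
  have [D D0 lD] := dual_bound lX; exists D => _ [y /= y1 <-].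
  by apply: le_trans (lD y) _; rewrite -[leRHS]mulr1 ler_wpM2l.
pose phi (l : X -> R) : R := lim (l (x_ n) @[n --> V]).
have phiP l : dual l -> l (x_ n) @[n --> V] --> (phi l : R^o).
  move=> lX; have [c lc] := bounded_ultra_limit VU (lC l lX).
  by rewrite /phi (cvg_lim _ lc).
have [|h hP] := Xr phi; last first.
  exists h => l c lX lc; rewrite -hP//.
  by apply: cvgr_to_le (phiP l lX) _; exact: VF.
split.
- move=> a l m lX mX; apply/cvg_lim => //.
  by apply: cvgD; [apply: cvgMr; exact: phiP|exact: phiP].
- exists C => l lX.
  have h : `|l (x_ n)| @[n --> V] --> `|phi l| by apply: cvg_norm; exact: phiP.
  by apply: (cvgr_to_le h); apply: nearW => n; exact: lC.
Qed.

(* Along any subsequence where [l] stays away from [l h], a cluster point [h']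
   still agrees with [h] on the separating functionals [l_ j]. *)
Lemma reflexive_weak_limit (l_ : nat -> X -> R) (x_ : nat -> X) (C : R) :
  reflexive_space X -> (forall j, dual (l_ j)) ->
  (forall x, (forall j, l_ j x <= 0) -> x = 0) ->
  (forall n, `|x_ n| <= C) -> (forall j, cvgn (fun n => l_ j (x_ n) : R^o)) ->
  exists2 h, `|h| <= C & forall l, dual l -> l (x_ n) @[n --> \oo] --> l h.
Proof.
move=> Xr lX lsep xC lc; have [h hP] := reflexive_cluster Xr xC.
have uniq h' (k : nat -> nat) : (forall n, (n <= k n)%N) ->
    (forall l (c : R), dual l -> (\forall n \near \oo, l (x_ (k n)) <= c) -> l h' <= c) ->
    forall j, l_ j h' = limn (fun n => l_ j (x_ n) : R^o).
  move=> kn h'P j; set c := limn _.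
  have cj : l_ j (x_ n) @[n --> \oo] --> (c : R^o) by exact: lc.
  have ck e : 0 < e -> \forall n \near \oo, `|c - l_ j (x_ (k n))| < e.
    move=> e0; move/cvgrPdist_lt : cj => /(_ e e0)[N _ NP].
    by exists N => // n Nn; apply: NP; exact: leq_trans (kn n).
  apply/eqP; rewrite eq_le; apply/andP; split; apply/ler_addgt0Pr => e e0.
    apply: (h'P (l_ j) (c + e)) => //.
    apply: filterS (ck e e0) => n; rewrite ltr_norml => /andP[? ?]; lra.
  (* This is [- l_ j] in the shape that [dual_comb] provides; applied to it, the upper bounds for
     [h'] become lower bounds. *)
  have jX : dual (fun x => (- 2) * l_ j x + l_ j x) by exact: dual_comb.
  have h1 : - 2 * l_ j h' + l_ j h' <= - c + e.
    apply: (h'P (fun x => - 2 * l_ j x + l_ j x) (- c + e)) => //.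
    apply: filterS (ck e e0) => n; rewrite ltr_norml => /andP[? ?]; lra.
  lra.
have hC : `|h| <= C.
  have [l [lX' lb lh]] := norming_functional h; rewrite -lh; apply: (hP l C) => //.
  apply: nearW => n; apply: le_trans (ler_norm _) _; exact: le_trans (lb _) (xC n).
exists h => //.
have key l e : dual l -> 0 < e -> \forall n \near \oo, l (x_ n) < l h + e.
  move=> lX' e0; apply: contrapT => nh.
  have /choice[k kP] n : exists m, (n <= m)%N /\ l h + e <= l (x_ m).
    apply: contrapT => /forallNP nm; apply: nh; exists n => // m /= nm'.
    by rewrite ltNge; apply/negP => h1; apply: (nm m).
  have [h' h'P] := reflexive_cluster Xr (fun n => xC (k n)).
  have hE : h = h'.
    apply/eqP; rewrite -subr_eq0; apply/eqP; apply: lsep => j.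
    rewrite dualB// (uniq h' k)//; last by move=> n; case: (kP n).
    by rewrite (uniq h id)// subrr.
  have jX : dual (fun x => (- 2) * l x + l x) by exact: dual_comb.
  have : - 2 * l h' + l h' <= - (l h + e).
    apply: (h'P (fun x => - 2 * l x + l x) (- (l h + e))) => //; apply: nearW => n; have [_ h1] := kP n; lra.
  rewrite -hE; lra.
move=> l lX'; apply/cvgrPdist_lt => e e0.
have jX : dual (fun x => (- 2) * l x + l x) by exact: dual_comb.
have h1 := key _ _ lX' e0; have h2 := key _ _ jX e0.
near=> n; rewrite ltr_norml.
have k1 : l (x_ n) < l h + e by near: n.
have k2 : - 2 * l (x_ n) + l (x_ n) < - 2 * l h + l h + e by near: n.
by apply/andP; split; lra.
Unshelve. all: by end_near. Qed.

End WeakSequentialLimits.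

(** * Pointwise representation of functionals on L1 *)

Section WeakL1.
Context (R : realType) (X : completeNormedModType R).
Hypothesis X_separable : separable X.
Context d (T : measurableType d).
Variable mu : {finite_measure set T -> \bar R}.
Local Notation L1P := (L1P X_separable).
Local Notation nrm1 f := (fine (nrm mu setT f)).
Implicit Types f g : T -> X.

Definition L1_functional (phi : (T -> X) -> R) :=
  (forall a f g, L1 mu f -> L1 mu g ->
     phi (fun w => a *: f w + g w) = a * phi f + phi g) /\
  (forall f, L1 mu f -> `|phi f| <= nrm1 f).

Lemma nrm1K f : L1 mu f -> (nrm1 f)%:E = nrm mu setT f.
Proof. by move=> fL; rewrite fineK// ge0_fin_numE ?nrm_ge0//; exact: (L1_nrm X_separable). Qed.

Lemma functionalB phi f g : L1_functional phi -> L1 mu f -> L1 mu g ->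
  phi (fun w => f w - g w) = phi f - phi g.
Proof.
move=> [h _] fL gL; have := h (-1) g f gL fL.
under [in LHS]eq_fun do rewrite scaleN1r addrC.
by move=> ->; rewrite mulN1r addrC.
Qed.

Lemma functional_dist phi f g e : L1_functional phi -> L1 mu f -> L1 mu g ->
  (nrm mu setT (fun w => f w - g w)%R <= e%:E)%E -> `|phi f - phi g| <= e.
Proof.
move=> phiL fL gL fge; have dL := L1B X_separable fL gL.
rewrite -functionalB//; apply: le_trans (phiL.2 _ dL) _.
by rewrite -lee_fin nrm1K.
Qed.

Lemma L1_indic A (x : X) : measurable A -> L1 mu (fun w => \1_A w *: x).
Proof.
move=> mA; apply/L1P; split; first by apply: dmeasZf; [exact: measurable_indic|exact: dmeas_cst].
apply: (@le_lt_trans _ _ (nrm mu setT (fun=> x : X))); last exact: (L1_nrm X_separable (L1_cst X_separable mu x)).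
apply: (le_nrm_ae X_separable measurableT) => //.
  by apply: dmeasZf; [exact: measurable_indic|exact: dmeas_cst].
apply: aeW => w _; rewrite normrZ indicE; case: (w \in A) => /=.
  by rewrite normr1 mul1r.
by rewrite normr0 mul0r.
Qed.

Lemma nrm1_indic A (x : X) : measurable A ->
  nrm1 (fun w => \1_A w *: x) = `|x| * fine (mu A).
Proof.
move=> mA; apply/EFin_inj; rewrite nrm1K; last exact: L1_indic.
rewrite EFinM fineK ?fin_num_measure// /nrm.
under eq_integral do rewrite normrZ mulrC EFinM ger0_norm//.
rewrite ge0_integralZl//; last by apply/measurable_EFinP; exact: measurable_indic.
by rewrite integral_indic// setIT.
Qed.

Section Functional.
Variable phi : (T -> X) -> R.
Hypothesis phiL : L1_functional phi.

Lemma functional0 : phi (fun=> 0) = 0.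
Proof.
have L0 := L1_cst X_separable mu 0; have := functionalB phiL L0 L0.
by under [in LHS]eq_fun do rewrite subrr; move=> ->; rewrite subrr.
Qed.

(** For fixed [x] the set function [A |-> phi (1_A x)] is additive and bounded by [|x| mu A]. *)
Lemma functional_densities : exists m : X -> T -> R, forall x,
  mu.-integrable setT (EFin \o m x) /\
  forall A, measurable A -> phi (fun w => \1_A w *: x) = \int[mu]_(w in A) m x w.
Proof.
suff /choice[m mP] x : exists m : T -> R, mu.-integrable setT (EFin \o m) /\
    forall A, measurable A -> phi (fun w => \1_A w *: x) = \int[mu]_(w in A) m w.
  by exists m.
apply: (@bounded_additive_density R d T mu _ `|x|).
- move=> A B mA mB AB; rewrite -[phi (fun w => \1_A w *: x)]mul1r -phiL.1; try exact: L1_indic.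
  congr phi; apply/funext => w; rewrite scale1r -scalerDl; congr (_ *: _).
  rewrite !indicE; have [Aw|nA] := pselect (A w).
    rewrite [w \in B]memNset ?addr0; first by rewrite !mem_set//; left.
    by move=> Bw; have : (A `&` B) w by []; rewrite AB.
  rewrite [w \in A]memNset// add0r; congr ((nat_of_bool _)%:R).
  by apply/idP/idP => /set_mem h; apply/mem_set; [case: h|right].
- by move=> A mA; apply: le_trans (phiL.2 _ (L1_indic x mA)) _; rewrite nrm1_indic.
Qed.

(** Evaluating [phi] on [1_A (x + a y - z)] bounds the integral of the combined density over every
    [A], hence the density itself. The null set depends on [x], [y], [z] and [a]. *)
Lemma density_comb (m : X -> T -> R) x y z a : (forall x,
    mu.-integrable setT (EFin \o m x) /\
    forall A, measurable A -> phi (fun w => \1_A w *: x) = \int[mu]_(w in A) m x w) ->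
  {ae mu, forall w, `|m x w + a * m y w - m z w| <= `|x + a *: y - z|}.
Proof.
move=> mP; have [xi xE] := mP x; have [yi yE] := mP y; have [zi zE] := mP z.
have xyi := int_comb a yi xi; have wi := int_comb (-1) zi xyi.
have ci : mu.-integrable setT (EFin \o (fun=> `|x + a *: y - z| : R)).
  exact: finite_measure_integrable_cst.
have AE A : measurable A -> `|\int[mu]_(w in A) (-1 * m z w + (a * m y w + m x w))|
    <= \int[mu]_(w in A) `|x + a *: y - z|.
  move=> mA; rewrite Rintegral_comb// Rintegral_comb// -xE// -yE// -zE//.
  have LI u := L1_indic u mA.
  rewrite -phiL.1// -phiL.1//; last exact: (L1_lin X_separable).
  rewrite Rintegral_cst// -nrm1_indic//.
  have -> : (fun w => -1 *: (\1_A w *: z) + (a *: (\1_A w *: y) + \1_A w *: x)) =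
      (fun w => \1_A w *: (x + a *: y - z)).
    apply/funext => w; rewrite scalerBr scalerDr scaleN1r addrC [a *: _ + _]addrC.
    by rewrite !scalerA mulrC.
  exact: phiL.2.
have h1 : {ae mu, forall w, -1 * m z w + (a * m y w + m x w) <= `|x + a *: y - z|}.
  by apply: ae_le_of_Rintegral => // A mA; apply: le_trans (AE A mA); exact: ler_norm.
have h2 : {ae mu, forall w, -1 * `|x + a *: y - z| + (0 : R) <= -1 * m z w + (a * m y w + m x w)}.
  apply: (@ae_le_of_Rintegral _ _ _ mu (fun w => -1 * `|x + a *: y - z| + (0 : R))) => //.
    exact: finite_measure_integrable_cst.
  move=> A mA; have := AE A mA; rewrite ler_norml => /andP[h _]; apply: le_trans h.
  by rewrite !Rintegral_cst// addr0 mulN1r mulNr.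
apply: filterS2 h1 h2 => w k1 k2; rewrite ler_norml; apply/andP; split; lra.
Qed.

(** Off one null set the bounds of [density_comb] hold for all points of a dense sequence and all
    rational coefficients, and there [dual_extension] builds [L w] from the numbers [m (x_ i) w].
    The Lipschitz bound then carries the identity to any given [x], with a null set that depends on
    [x]. *)
Lemma functional_pointwise : exists (m : X -> T -> R) (L : T -> X -> R), [/\
  forall x, mu.-integrable setT (EFin \o m x) /\
    forall A, measurable A -> phi (fun w => \1_A w *: x) = \int[mu]_(w in A) m x w,
  forall w, dual (L w), forall w x, `|L w x| <= `|x| &
  forall x, {ae mu, forall w, m x w = L w x}].
Proof.
have [m mP] := functional_densities; have [x_ xd] := dense_sequence X_separable.
have H1 : {ae mu, forall w (c : nat * nat * nat * rat),
    `|m (x_ c.1.1.1) w + ratr c.2 * m (x_ c.1.1.2) w - m (x_ c.1.2) w| <=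
    `|x_ c.1.1.1 + ratr c.2 *: x_ c.1.1.2 - x_ c.1.2|}.
  by apply: ae_forall_count => c; exact: density_comb.
have H2 x : {ae mu, forall w i, `|m x w - m (x_ i) w| <= `|x - x_ i|}.
  apply: ae_foralln => i; have := density_comb x x (x_ i) 0 mP.
  by apply: filterS => w; rewrite mul0r addr0 scale0r addr0.
have H3 : {ae mu, forall w i, `|m (x_ i) w| <= `|x_ i|}.
  apply: ae_foralln => i; have := density_comb (x_ i) (x_ i) (x_ i) 1 mP.
  by apply: filterS => w; rewrite mul1r addrK scale1r addrK.
have /choice[L LP] w : exists l : X -> R, [/\ dual l, forall x, `|l x| <= `|x| &
   (forall i, `|m (x_ i) w| <= `|x_ i|) -> (forall c : nat * nat * nat * rat,
    `|m (x_ c.1.1.1) w + ratr c.2 * m (x_ c.1.1.2) w - m (x_ c.1.2) w| <=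
    `|x_ c.1.1.1 + ratr c.2 *: x_ c.1.1.2 - x_ c.1.2|) -> forall i, l (x_ i) = m (x_ i) w].
  have [[h3 h1]|nh] := pselect ((forall i, `|m (x_ i) w| <= `|x_ i|) /\
     (forall c : nat * nat * nat * rat,
    `|m (x_ c.1.1.1) w + ratr c.2 * m (x_ c.1.1.2) w - m (x_ c.1.2) w| <=
    `|x_ c.1.1.1 + ratr c.2 *: x_ c.1.1.2 - x_ c.1.2|)).
    have [l [lX lb lE]] := @dual_extension R X x_ (fun i => m (x_ i) w) xd h3
      (fun i j k q => h1 (i, j, k, q)).
    by exists l; split.
  (* On the exceptional null set any functional bounded by the norm can be taken. *)
  have [l [lX lb _]] := norming_functional (0 : X).
  by exists l; split=> // h3 h1; exfalso; apply: nh.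
exists m, L; split=> // [w|w|x]; [by case: (LP w)|by case: (LP w)|].
have H13 : {ae mu, forall w i, L w (x_ i) = m (x_ i) w}.
  by apply: filterS2 H1 H3 => w h1 h3 i; have [_ _ ->] := LP w.
apply: filterS2 H13 (H2 x) => w h1 h2.
apply/eqP; rewrite -subr_eq0 -normr_le0; apply/ler_addgt0Pr => e e0; rewrite add0r.
have [|i xi] := xd x (e / 2); first by rewrite divr_gt0.
have [lX lb _] := LP w; have := lb (x - x_ i); rewrite dualB// h1 => h3.
have := h2 i; have := ler_distD (m (x_ i) w) (m x w) (L w x).
by rewrite [X in _ <= _ + X -> _]distrC; lra.
Qed.

(* Representing [phi] by the random functional [L w] reduces the claim to
   dominated convergence along simple approximations of the [v k]. *)
Lemma functional_weak_cvg (v : nat -> T -> X) (C : R) :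
  (forall k, L1 mu (v k)) -> (forall k, {ae mu, forall w, `|v k w| <= C}) ->
  {ae mu, forall w, forall l, dual l -> l (v k w) @[k --> \oo] --> (0 : R)} ->
  phi (v k) @[k --> \oo] --> (0 : R^o).
Proof.
move=> vL vC vw; have [m [L [mP LX Lb mL]]] := functional_pointwise.
have /choice[s sP] k : exists s : {fimfun T >-> X}, [/\
    forall x, measurable (s @^-1` [set x]),
    forall w, `|v k w - s w| <= `|v k w| &
    (nrm mu setT (fun w => s w - v k w)%R <= (1 * 2^-1 ^+ k)%:E)%E].
  have vm := L1_dmeas X_separable (vL k).
  have [s_ [sm sv sle]] := dmeas_simple X_separable vm.
  have sd n : dmeas (s_ n) by apply: dmeas_fin.
  have h : {ae mu, forall w n, `|s_ n w - v k w| <= `|v k w|}.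
    by apply: aeW => w n; rewrite distrC; exact: sle.
  have := nrm_dominated_cvg0 X_separable sd vm (L1_norm_integrable X_separable (vL k))
    (aeW _ sv) h.
  move=> /cvge0P c0; have [n|N _ /(_ N (leqnn _)) c1] := c0 _ _ (half_pow_gt0 R k).
    exact: nrm_ge0.
  by exists (s_ N); split=> //; rewrite mul1r ltW.
have sm k x : measurable (s k @^-1` [set x]) by case: (sP k).
have sd k : dmeas (s k) by apply: dmeas_fin.
have sL k : L1 mu (s k).
  apply/L1P; split=> //; apply: simple_nrm_lty => // x _.
  by apply: fin_mu; rewrite setTI.
have svc : {ae mu, forall w, s k w - v k w @[k --> \oo] --> (0 : X)}.
  have m0 : dmeas ((fun=> 0) : T -> X) by exact: dmeas_cst.
  apply: (@ae_cvg_fast R _ T mu X X_separable (fun k w => s k w - v k w) (fun=> 0) 1) => //.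
    by move=> k; apply: dmeasB => //; exact: (L1_dmeas X_separable).
  by move=> k; under eq_fun do rewrite subr0; case: (sP k).
pose r k : seq X := fset_set (range (s k)).
(* For the simple function [s k] the densities give [phi (s k)] as the integral of [p k], and
   [p k w = L w (s k w)] almost everywhere because only finitely many values [x] occur. *)
pose p k w := \sum_(x <- r k) \1_(s k @^-1` [set x]) w * m x w.
have pL : {ae mu, forall w k, p k w = L w (s k w)}.
  apply: ae_foralln => k.
  have H : {ae mu, forall w, forall x, x \in r k -> m x w = L w x}.
    elim: (r k) => [|x t IH]; first by apply: aeW.
    by apply: filterS2 IH (mL x) => w h1 h2 y; rewrite inE => /predU1P[->//|/h1].
  apply: filterS H => w Hw; have := simple_sumE (s k) (L w : X -> R^o) w => ->.
  by apply: eq_big_seq => x xr; rewrite Hw.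
have termi k x : mu.-integrable setT (EFin \o (fun w => \1_(s k @^-1` [set x]) w * m x w)).
  have [xi _] := mP x.
  have xm := integrable_measurable xi.
  apply: le_integrable xi => //.
    by apply/measurable_EFinP/measurable_funM => //; exact: measurable_indic.
  move=> w _ /=; rewrite lee_fin normrM indicE; case: (_ \in _).
    by rewrite normr1 mul1r.
  by rewrite normr0 mul0r.
have phis k : phi (s k) = \int[mu]_w p k w.
  rewrite /p Rintegral_sum//.
  have -> : phi (s k) = phi (fun w => \sum_(x <- r k) \1_(s k @^-1` [set x]) w *: x).
    by congr phi; apply/funext => w; exact: (simple_sumE (s k) id w).
  elim: (r k) => [|x t IH].
    by rewrite big_nil; under [in LHS]eq_fun do rewrite big_nil; exact: functional0.
  rewrite big_cons; under [in LHS]eq_fun do rewrite big_cons.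
  have tL : L1 mu (fun w => \sum_(x <- t) \1_(s k @^-1` [set x]) w *: x).
    elim: (t) => [|y t' IH'].
      by under eq_fun do rewrite big_nil; exact: (L1_cst X_separable).
    under eq_fun do rewrite big_cons; apply: (L1D X_separable) => //; exact: L1_indic.
  have := phiL.1 1 _ _ (L1_indic x (sm k x)) tL.
  under [in X in X -> _]eq_fun do rewrite scale1r.
  move=> ->; rewrite mul1r IH; congr (_ + _).
  have [_ ->//] := mP x.
  apply: (etrans _ (esym (Rintegral_setC (sm k x) (termi k x)))) => /=.
  have -> : \int[mu]_(w in ~` (s k @^-1` [set x])) (\1_(s k @^-1` [set x]) w * m x w) = 0.
    under eq_Rintegral => w /set_mem nA do rewrite indicE memNset// mul0r.
    by rewrite Rintegral_cst ?mul0r//; exact: measurableC.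
  rewrite addr0; apply: eq_Rintegral => w wA.
  by rewrite indicE wA mul1r.
have pm k : dmeas (p k : T -> R^o).
  by apply/dmeas_real; apply: measurable_sum => x; exact: integrable_measurable (termi k x).
have Csv : {ae mu, forall w k, `|v k w| <= C} by exact: ae_foralln.
have c0 : nrm mu setT (fun w => (p k w : R^o) - 0)%R @[k --> \oo] --> 0%E.
  apply: (@nrm_dominated_cvg0 R R^o (separable_real R) d T mu (fun k => p k) (fun=> 0)
    (fun=> C + C)) => //.
  - exact: dmeas_cst.
  - exact: finite_measure_integrable_cst.
  - apply: filterS3 pL svc vw => w hp hs hv.
    have E k : p k w = L w (s k w - v k w) + L w (v k w) by rewrite hp -dualD// subrK.
    under eq_cvg do rewrite E.
    have c1 : L w (s k w - v k w) @[k --> \oo] --> (0 : R^o).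
      rewrite -(dual0 (LX w)).
      by apply: (@continuous_cvg _ X R^o) => //; exact: (LX w).2.
    have c2 : L w (s k w - v k w) + L w (v k w) @[k --> \oo] --> (0 + 0 : R^o).
      by apply: cvgD => //; exact: hv.
    by rewrite addr0 in c2; exact: c2.
  - apply: filterS2 pL Csv => w hp hv k.
    rewrite subr0 hp; apply: le_trans (Lb w _) _.
    have [_ h _] := sP k; have := h w; have := hv k.
    by have := ler_distD (v k w) (s k w) 0; rewrite !subr0 distrC; lra.
have pi k : mu.-integrable setT (EFin \o p k).
  rewrite (_ : _ \o _ = fun w => (\sum_(x <- r k) (EFin \o (fun w => \1_(s k @^-1` [set x]) w * m x w)%R) w)%E).
    by apply: integrable_sum => // x _; exact: termi.
  by apply/funext => w /=; rewrite -sumEFin.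
have phis0 : phi (s k) @[k --> \oo] --> (0 : R^o).
  apply/cvgrPdist_lt => e e0; move/cvge0P : c0 => c0.
  have [k|N _ NP] := c0 _ _ e0; first exact: nrm_ge0.
  exists N => // k Nk; rewrite sub0r normrN phis.
  apply: le_lt_trans (le_normr_Rintegral measurableT (pi k)) _.
  have := NP k Nk; rewrite -lte_fin; apply: le_lt_trans.
  rewrite /Rintegral fineK; last first.
    exact: integrable_fin_num (integrable_norm (pi k)).
  by rewrite /nrm; under [leRHS]eq_integral do rewrite subr0.
apply/cvgrPdist_lt => e e0; have e2 : 0 < e / 2 by rewrite divr_gt0.
move/cvgrPdist_lt : phis0 => /(_ _ e2) h1.
near=> k.
have k1 : `|0 - phi (s k)| < e / 2 by near: k.
have k2 : (2^-1 : R) ^+ k < e / 2 by near: k; exact: half_pow_lt.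
have := functional_dist phiL (sL k) (vL k) (_ : _ <= (2^-1 ^+ k)%:E)%E.
move=> /(_ _); have [_ _ h] := sP k; rewrite mul1r in h => /(_ h) k3.
have := ler_distD (phi (s k)) 0 (phi (v k)).
by lra.
Unshelve. all: by end_near. Qed.

End Functional.
End WeakL1.

(** * Mean and pointwise ergodic theorems *)

Section Separation.
Context (R : realType) (X : completeNormedModType R).
Hypothesis X_separable : separable X.
Context d (T : measurableType d).
Variable mu : {finite_measure set T -> \bar R}.
Local Notation nrm1 f := (fine (nrm mu setT f)).
Implicit Types f g u v z : T -> X.

Lemma functional_ae phi f g : L1_functional mu phi -> L1 mu f -> L1 mu g ->
  {ae mu, forall w, f w = g w} -> phi f = phi g.
Proof.
move=> phiL fL gL fg; apply/eqP; rewrite -subr_eq0 -normr_le0.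
apply: (functional_dist X_separable phiL fL gL).
rewrite (_ : nrm _ _ _ = nrm mu setT (fun=> 0 : X)); last first.
  apply: eq_nrm_ae => //; [|exact: dmeas_cst|by apply: filterS fg => w -> _; rewrite subrr].
  exact: dmeasB (L1_dmeas X_separable fL) (L1_dmeas X_separable gL).
by rewrite /nrm; under eq_integral do rewrite normr0; rewrite integral0.
Qed.

Lemma nrm1_triangle f g : L1 mu f -> L1 mu g ->
  nrm1 (fun w => f w + g w) <= nrm1 f + nrm1 g.
Proof.
move=> fL gL; rewrite -lee_fin EFinD !nrm1K//; last exact: (L1D X_separable).
exact: (nrmD _ X_separable measurableT (L1_dmeas X_separable fL) (L1_dmeas X_separable gL)).
Qed.

Lemma nrm1Z a f : L1 mu f -> nrm1 (fun w => a *: f w) = `|a| * nrm1 f.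
Proof.
move=> fL; apply/EFin_inj; rewrite EFinM !nrm1K//; last exact: (L1Z X_separable).
by rewrite (nrmZ _ X_separable measurableT a (L1_dmeas X_separable fL)).
Qed.

(* Hahn-Banach for the quotient seminorm [dist(v, Z)]. *)
Lemma functional_separation (Z : set (T -> X)) v0 :
  Z `<=` L1 mu -> Z (fun=> 0) ->
  (forall a z z', Z z -> Z z' -> Z (fun w => a *: z w + z' w)) -> L1 mu v0 ->
  (forall phi, L1_functional mu phi -> (forall z, Z z -> phi z = 0) -> phi v0 = 0) ->
  forall e : R, 0 < e -> exists2 z, Z z & (nrm mu setT (fun w => v0 w - z w)%R <= e%:E)%E.
Proof.
move=> ZL Z0 Zlin v0L Zphi.
pose D v := [set nrm1 (fun w => v w - z w) | z in Z].
pose p v := inf (D v).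
have D0 v : D v !=set0 by exists (nrm1 (fun w => v w - 0)), (fun=> 0).
have Dlb v : lbound (D v) 0 by move=> _ [z _ <-]; rewrite fine_ge0// nrm_ge0.
have Dinf v : has_inf (D v) by split; [exact: D0|exists 0; exact: Dlb].
have ple v z : Z z -> p v <= nrm1 (fun w => v w - z w).
  by move=> Zz; apply: ge_inf; [exists 0; exact: Dlb|exists z].
have padh v e : 0 < e -> exists2 z, Z z & nrm1 (fun w => v w - z w) < p v + e.
  by move=> e0; have [_ [z Zz <-] h] := inf_adherent e0 (Dinf v); exists z.
have p0 v : 0 <= p v by apply: lb_le_inf; [exact: D0|exact: Dlb].
have pnrm v : p v <= nrm1 v.
  by have := ple v _ Z0; under eq_fun do rewrite subr0.
have pZ z : Z z -> p z = 0.
  move=> Zz; apply/eqP; rewrite eq_le p0 andbT; have := ple z z Zz.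
  under eq_fun do rewrite subrr.
  by rewrite /nrm; under eq_integral do rewrite normr0; rewrite integral0.
have psc a v : 0 <= a -> L1 mu v -> p (fun w => a *: v w) <= a * p v.
  move=> a0 vL; apply/ler_addgt0Pr => e e0.
  have e1 : 0 < e / (a + 1) by rewrite divr_gt0// ltr_wpDl.
  have [z Zz zv] := padh v _ e1.
  have Zaz : Z (fun w => a *: z w).
    by have := Zlin a _ _ Zz Z0; under eq_fun do rewrite addr0.
  apply: le_trans (ple _ _ Zaz) _.
  under eq_fun do rewrite -scalerBr.
  rewrite nrm1Z ?ger0_norm//; last by apply: (L1B X_separable) => //; exact: ZL.
  apply: (@le_trans _ _ (a * (p v + e / (a + 1)))); first by rewrite ler_wpM2l// ltW.
  rewrite mulrDr lerD2l mulrA ler_pdivrMr ?ltr_wpDl//; nra.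
have [|||phi [philin phip phiv0]] := @hahn_banach R (T -> X) (L1 mu) p _ _ _ v0 v0L.
- by move=> a u v uL vL; exact: (L1_lin X_separable a uL vL).
- move=> u v uL vL; apply/ler_addgt0Pr => e e0.
  have e2 : 0 < e / 2 by rewrite divr_gt0.
  have [z Zz zu] := padh u _ e2; have [z' Zz' zv] := padh v _ e2.
  have Zzz : Z (fun w => z w + z' w).
    by have := Zlin 1 _ _ Zz Zz'; under eq_fun do rewrite scale1r.
  apply: le_trans (ple _ _ Zzz) _.
  have -> : (fun w => (u + v) w - (z w + z' w)) = (fun w => (u w - z w) + (v w - z' w)).
    by apply/funext => w; rewrite opprD addrACA.
  apply: le_trans (nrm1_triangle _ _) _; try by apply: (L1B X_separable) => //; exact: ZL.
  by lra.
- move=> a u; rewrite le_eqVlt => /predU1P[<-|a0] uL.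
    rewrite mul0r scale0r; exact: pZ.
  apply/eqP; rewrite eq_le; apply/andP; split; first by apply: psc => //; exact: ltW.
  rewrite -ler_pdivlMl//.
  have := psc a^-1 (a *: u) _ (L1Z X_separable a uL).
  rewrite invr_ge0 (ltW a0) => /(_ isT); congr (_ <= _); congr p.
  by apply/funext => w; rewrite /= scalerA mulVf ?scale1r// gt_eqF.
have phiN v : L1 mu v -> phi (fun w => - v w) = - phi v.
  move=> vL; have L0 := ZL _ Z0; have phi00 : phi (fun=> 0) = 0.
    have := philin (-1) _ _ L0 L0; rewrite mulN1r addNr => <-; congr phi.
    by apply/funext => w; rewrite !fctE scaleN1r addNr.
  have := philin (-1) _ _ vL L0; rewrite phi00 [RHS]addr0 mulN1r => <-; congr phi.
  by apply/funext => w; rewrite !fctE scaleN1r addr0.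
have NL v : L1 mu v -> L1 mu (fun w => - v w).
  move=> /(L1Z X_separable (-1)); congr L1.
  by apply/funext => w; rewrite scaleN1r.
have phiL : L1_functional mu phi.
  split=> [a u v uL vL|v vL]; first exact: philin.
  rewrite ler_norml; apply/andP; split; last exact: le_trans (phip _ vL) (pnrm _).
  rewrite lerNl -phiN//; apply: le_trans (phip _ (NL _ vL)) _.
  apply: le_trans (pnrm _) _; rewrite /nrm.
  by under eq_integral do rewrite normrN.
have phiZ z : Z z -> phi z = 0.
  move=> Zz; have zL := ZL _ Zz; apply/eqP; rewrite eq_le; apply/andP; split.
    by rewrite -(pZ _ Zz); exact: phip.
  rewrite -oppr_le0 -phiN//; apply: le_trans (phip _ (NL _ zL)) _.
  rewrite pZ//; have := Zlin (-1) _ _ Zz Z0; congr Z.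
  by apply/funext => w; rewrite scaleN1r addr0.
have := Zphi phi phiL phiZ; rewrite phiv0 => pv0 e e0.
have [z Zz h] := padh v0 _ e0; exists z => //.
rewrite -nrm1K//; last by apply: (L1B X_separable) => //; exact: ZL.
by rewrite lee_fin ltW// -[e]add0r -pv0.
Qed.

End Separation.

Section HilbertNorm.
Context (R : realType) (X : normedModType R).
Variable l_ : nat -> X -> R.
Hypothesis lX : forall j, dual (l_ j).
Hypothesis lb : forall j x, `|l_ j x| <= `|x|.

(* The square of a Hilbert norm that is weaker than the norm of [X]. *)
Definition hnorm2 (x : X) : \bar R := (\sum_(j <oo) (2^-1 ^+ j * l_ j x ^+ 2)%:E)%E.

Let term_ge0 j x : (0 <= (2^-1 ^+ j * l_ j x ^+ 2 : R)%:E)%E.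
Proof. by rewrite lee_fin mulr_ge0// ?sqr_ge0// ltW// half_pow_gt0. Qed.

Lemma hnorm2_ge0 x : (0 <= hnorm2 x)%E.
Proof. by apply: nneseries_ge0 => j _ _; exact: term_ge0. Qed.

Lemma hnorm2_le x : (hnorm2 x <= (2 * `|x| ^+ 2)%:E)%E.
Proof.
apply: lime_le; first by apply: is_cvg_nneseries => n _ _; exact: term_ge0.
apply: nearW => n; rewrite sumEFin lee_fin.
have := sum_half_pow_le 0 n (sqr_ge0 `|x|); rewrite expr0 mulr1; apply: le_trans.
apply: ler_sum => j _; rewrite mulrC; apply: ler_wpM2r; first exact: ltW (half_pow_gt0 R j).
by rewrite -[leLHS]real_normK ?num_real// lerXn2r ?nnegrE.
Qed.

Lemma hnorm2_term j x : ((2^-1 ^+ j * l_ j x ^+ 2)%:E <= hnorm2 x)%E.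
Proof.
apply: le_trans (nneseries_lim_ge j.+1 _); last by move=> *; exact: term_ge0.
rewrite big_nat_recr//= leeDr//; apply: sume_ge0 => i _; exact: term_ge0.
Qed.

Lemma hnorm2_parallelogram x y :
  (hnorm2 (x - y)%R + hnorm2 (x + y)%R = (hnorm2 x + hnorm2 y) + (hnorm2 x + hnorm2 y))%E.
Proof.
rewrite /hnorm2 -!nneseriesD//; try by move=> *; rewrite ?adde_ge0.
apply: eq_eseriesr => j _; rewrite -!EFinD; congr EFin.
rewrite (dualB _ _ (lX j)) (dualD _ _ (lX j)); move: (2^-1 ^+ j) (l_ j x) (l_ j y) => q a b; ring.
Qed.

Lemma hnorm2_half x : (hnorm2 (2^-1 *: x)%R = (4^-1)%:E * hnorm2 x)%E.
Proof.
rewrite /hnorm2 -nneseriesZl; last by move=> n _; exact: term_ge0.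
apply: eq_eseriesr => j _; rewrite -EFinM; congr EFin.
rewrite (dualZ _ _ (lX j)); move: (2^-1 ^+ j) (l_ j x) => q a; by field.
Qed.

End HilbertNorm.

Section MeanErgodic.
Context (R : realType) (X : completeNormedModType R).
Hypothesis X_separable : separable X.
Context d (T : measurableType d).
Variable mu : {finite_measure set T -> \bar R}.
Variable U : (T -> X) -> (T -> X).
Hypothesis U_op : L1_Linf_contraction mu U.
Local Notation S := (partial_sum U).
Implicit Types f g h : T -> X.

Lemma L1_bounded g (C : R) : dmeas g -> {ae mu, forall w, `|g w| <= C} -> L1 mu g.
Proof.
move=> gm gC; apply/(L1P X_separable _ _); split=> //.
apply: le_lt_trans (_ : (_ <= \int[mu]_w C%:E)%E) _.
  by apply: (le_nrm_ae X_separable measurableT gm) => //; apply: filterS gC.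
by rewrite integral_cst//= ltey_eq fin_numM ?fin_num_measure.
Qed.

Lemma bounded_nrm g (C : R) : dmeas g -> {ae mu, forall w, `|g w| <= C} ->
  (nrm mu setT g <= (C * fine (mu setT))%:E)%E.
Proof.
move=> gm gC; rewrite EFinM fineK ?fin_num_measure// -integral_cst//.
by apply: (le_nrm_ae X_separable measurableT gm) => //; apply: filterS gC.
Qed.

Lemma partial_sum_bound f C n : L1 mu f -> 0 <= C -> {ae mu, forall w, `|f w| <= C} ->
  {ae mu, forall w, `|S f n w| <= n%:R * C}.
Proof.
move=> fL C0 fC; elim: n => [|n IH] /=; first by apply: aeW => w; rewrite normr0 mul0r.
have SL := partial_sum_L1 X_separable U_op n fL.
have h := contr_bound X_separable U_op SL (mulr_ge0 (ler0n _ _) C0) IH.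
apply: filterS2 fC h => w h1 h2; apply: le_trans (ler_normD _ _) _.
by rewrite -natr1 mulrDl mul1r addrC lerD.
Qed.

Lemma partial_sumSr f n : L1 mu f ->
  {ae mu, forall w, S f n.+1 w = S f n w + iter n U f w}.
Proof.
move=> fL; elim: n => [|n IH].
  have := contrZ X_separable U_op 0 fL; apply: filterS => w.
  under eq_fun do rewrite scale0r; rewrite scale0r /= => ->.
  by rewrite addr0 add0r.
have SL k := partial_sum_L1 X_separable U_op k fL.
have iL := iter_L1 U_op n fL.
have h1 := contr_ae U_op (SL n.+1) (L1D X_separable (SL n) iL) IH.
have h2 := contrD U_op (SL n) iL.
by apply: filterS2 h1 h2 => w e1 e2; rewrite [LHS]/= [U _ _]e1 e2 addrA.
Qed.

(** Boundedness of [g] makes the averages of [z], which are [(g - U^n g) / n], tend to 0 uniformly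
    up to null sets. *)
Definition coboundary z := L1 mu z /\ exists g (D : R), [/\ L1 mu g,
  {ae mu, forall w, `|g w| <= D} & {ae mu, forall w, z w = g w - U g w}].

Lemma coboundary0 : coboundary (fun=> 0).
Proof.
have L0 := L1_cst X_separable mu (0 : X).
split=> //; exists (fun=> 0), 0; split=> //; first by apply: aeW => w; rewrite normr0.
have := contrB U_op L0 L0; apply: filterS => w /=.
by under eq_fun do rewrite subrr; move=> e; rewrite [U _ w]e subrr subr0.
Qed.

Lemma coboundary_lin a z z' : coboundary z -> coboundary z' ->
  coboundary (fun w => a *: z w + z' w).
Proof.
move=> [zL [g [D [gL gD zg]]]] [zL' [g' [D' [gL' gD' zg']]]].
split; first exact: (L1_lin X_separable).
exists (fun w => a *: g w + g' w), (`|a| * D + D'); split.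
- exact: (L1_lin X_separable).
- apply: filterS2 gD gD' => w h1 h2; apply: le_trans (ler_normD _ _) _.
  by rewrite normrZ lerD// ler_wpM2l.
- apply: filterS3 (contr_lin U_op a gL gL') zg zg' => w -> -> ->.
  by rewrite scalerBr opprD addrACA.
Qed.

Lemma coboundary_ae z z' : L1 mu z' -> {ae mu, forall w, z' w = z w} ->
  coboundary z -> coboundary z'.
Proof.
move=> zL zz [_ [g [D [gL gD zg]]]]; split=> //; exists g, D; split=> //.
by apply: filterS2 zz zg => w -> ->.
Qed.

(** The difference is the sum of the functions [f - U^k f] for [k < n], and each of these is the
    coboundary of the partial sum [S f k], which is bounded by [k * C]. So every average of [f]
    stays in the coset of [f] modulo coboundaries. *)
Lemma partial_sum_coboundary f C n : L1 mu f -> 0 <= C ->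
  {ae mu, forall w, `|f w| <= C} -> coboundary (fun w => n%:R *: f w - S f n w).
Proof.
move=> fL C0 fC; elim: n => [|n IH].
  by under eq_fun do rewrite scale0r subr0; exact: coboundary0.
have SL k := partial_sum_L1 X_separable U_op k fL.
have iL := iter_L1 U_op n fL.
have fi : coboundary (fun w => f w - iter n U f w).
  split; first exact: (L1B X_separable).
  exists (S f n), (n%:R * C); split=> //; first exact: partial_sum_bound.
  apply: filterS (partial_sumSr n fL) => w /= e.
  by rewrite -[f w](addrK (U (S f n) w)) e [X in X - _]addrAC addrK.
apply: (coboundary_ae _ _ (coboundary_lin 1 IH fi)).
  by apply: (L1B X_separable) => //; exact: (L1Z X_separable).
apply: filterS (partial_sumSr n fL) => w ->.
rewrite -natr1 scalerDl !scale1r opprD; exact: addrACA.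
Qed.

Section Energy.
Variable l_ : nat -> X -> R.
Hypothesis lX : forall j, dual (l_ j).
Hypothesis lb : forall j x, `|l_ j x| <= `|x|.
Local Notation hn := (hnorm2 l_).

Definition energy g := fine (\int[mu]_w hn (g w)).

Lemma measurable_hnorm2 g : dmeas g -> measurable_fun setT (fun w => hn (g w)).
Proof.
move=> gm; apply: ge0_emeasurable_sum => [k w _ _|k _].
  by rewrite lee_fin mulr_ge0// ?sqr_ge0// ltW// half_pow_gt0.
apply/measurable_EFinP/measurable_funM => //.
by apply: measurable_funX; exact: gm.
Qed.

Lemma energyK g C : dmeas g -> {ae mu, forall w, `|g w| <= C} ->
  (energy g)%:E = (\int[mu]_w hn (g w))%E /\ energy g <= 2 * C ^+ 2 * fine (mu setT).
Proof.
move=> gm gC; have hm := measurable_hnorm2 gm.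
have i0 : (0 <= \int[mu]_w hn (g w))%E by apply: integral_ge0 => w _; exact: hnorm2_ge0.
have h : (\int[mu]_w hn (g w) <= (2 * C ^+ 2 * fine (mu setT))%:E)%E.
  rewrite EFinM fineK ?fin_num_measure// -integral_cst//.
  apply: ae_ge0_le_integral => //; first by move=> w _; exact: hnorm2_ge0.
    by move=> w _; rewrite lee_fin mulr_ge0// sqr_ge0.
  apply: filterS gC => w gC _; apply: le_trans (hnorm2_le lb _) _.
  by rewrite lee_fin ler_wpM2l// lerXn2r// nnegrE// (le_trans _ gC).
have f : (\int[mu]_w hn (g w))%E \is a fin_num.
  by rewrite ge0_fin_numE//; apply: le_lt_trans h _; rewrite ltry.
by rewrite /energy fineK//; split=> //; rewrite -lee_fin fineK.
Qed.

Lemma energy_parallelogram g g' C : dmeas g -> dmeas g' ->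
  {ae mu, forall w, `|g w| <= C} -> {ae mu, forall w, `|g' w| <= C} ->
  energy (fun w => g w - g' w) + 4 * energy (fun w => 2^-1 *: (g w + g' w)) =
  2 * energy g + 2 * energy g'.
Proof.
move=> gm gm' gC gC'.
have [e1 _] := energyK gm gC; have [e2 _] := energyK gm' gC'.
have dm := dmeasB gm gm'; have sm := dmeasZ 2^-1 (dmeasD gm gm').
have dC : {ae mu, forall w, `|g w - g' w| <= C + C}.
  by apply: filterS2 gC gC' => w h1 h2; apply: le_trans (ler_normB _ _) _; exact: lerD.
have sC : {ae mu, forall w, `|2^-1 *: (g w + g' w)| <= C}.
  apply: filterS2 gC gC' => w h1 h2; rewrite normrZ ger0_norm ?invr_ge0//.
  by rewrite ler_pdivrMl//; apply: le_trans (ler_normD _ _) _; lra.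
have [e3 _] := energyK dm dC; have [e4 _] := energyK sm sC.
have [c4 c4E] : {c : R | c = 4} by exists 4.
have [c2 c2E] : {c : R | c = 2} by exists 2.
have c40 : (0 <= c4%:E)%E by rewrite c4E lee_fin.
have c20 : (0 <= c2%:E)%E by rewrite c2E lee_fin.
set m := energy (fun w => 2^-1 *: _) in e4 *.
apply/EFin_inj; rewrite -c4E -c2E !(EFinD, EFinM) e1 e2 e3 e4.
have h0 k w : (0 <= hn (k w : X))%E by exact: hnorm2_ge0.
have hm := measurable_hnorm2.
rewrite -!ge0_integralZl//; try exact: hm.
rewrite -!ge0_integralD//; try (by move=> *; rewrite mule_ge0);
  try (by apply: measurable_funeM; exact: hm); try exact: hm.
apply: eq_integral => w _.
rewrite hnorm2_half// muleA -EFinM c4E mulfV// mul1e hnorm2_parallelogram//.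
by rewrite c2E !mule_natl !mule2n addeACA.
Qed.

End Energy.
End MeanErgodic.

(** * Minimising sequences of almost invariant functions *)

Section MeanErgodicDecomposition.
Context (R : realType) (X : completeNormedModType R).
Hypothesis X_separable : separable X.
Hypothesis X_reflexive : reflexive_space X.
Context d (T : measurableType d).
Variable mu : {finite_measure set T -> \bar R}.
Variable U : (T -> X) -> (T -> X).
Hypothesis U_op : L1_Linf_contraction mu U.
Local Notation S := (partial_sum U).
Implicit Types f g h : T -> X.

Section Minimization.
Variables (f : T -> X) (C : R).
Hypothesis fL : L1 mu f.
Hypothesis C0 : 0 <= C.
Hypothesis fC : {ae mu, forall w, `|f w| <= C}.

(** The bound [C] keeps the values in one ball of [X], where reflexivity applies; the almost
    invariance makes the limit invariant; the last clause hides [f - g] from functionals that vanish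
    on coboundaries. *)
Definition almost_fixed k g := [/\ L1 mu g, {ae mu, forall w, `|g w| <= C},
  {ae mu, forall w, `|U g w - g w| <= 2^-1 ^+ k} & coboundary mu U (fun w => f w - g w)].

Lemma almost_fixed_le k m g : (k <= m)%N -> almost_fixed m g -> almost_fixed k g.
Proof.
move=> km [gL gC Ug fg]; split=> //; apply: filterS Ug => w /le_trans; apply.
by rewrite ler_wiXn2l// ?invr_ge0// invf_le1// ler1n.
Qed.

Lemma almost_fixed_mid k g g' : almost_fixed k g -> almost_fixed k g' ->
  almost_fixed k (fun w => 2^-1 *: (g w + g' w)).
Proof.
move=> [gL gC Ug fg] [gL' gC' Ug' fg'].
have h (x y : X) c : `|x| <= c -> `|y| <= c -> `|2^-1 *: (x + y)| <= c.
  move=> xc yc; rewrite normrZ ger0_norm ?invr_ge0// ler_pdivrMl//.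
  by apply: le_trans (ler_normD _ _) _; lra.
have sL := L1D X_separable gL gL'.
split; first exact: (L1Z X_separable).
- by apply: filterS2 gC gC' => w; exact: h.
- have e1 := contrZ X_separable U_op 2^-1 sL; have e2 := contrD U_op gL gL'.
  near=> w.
  have -> : U (fun w => 2^-1 *: (g w + g' w)) w = 2^-1 *: U (fun w => g w + g' w) w.
    by near: w.
  have -> : U (fun w => g w + g' w) w = U g w + U g' w by near: w.
  rewrite -scalerBr opprD addrACA; apply: h; near: w; [exact: Ug|exact: Ug'].
- have h0 := coboundary_lin X_separable U_op 2^-1 fg (coboundary0 X_separable U_op).
  have := coboundary_lin X_separable U_op 2^-1 fg' h0.
  congr coboundary; apply/funext => w.
  rewrite addr0 -scalerDr addrACA -opprD scalerBr; congr (_ - _).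
    by rewrite -mulr2n -(scaler_nat 2 (f w)) scalerA mulVf// scale1r.
  by rewrite addrC.
Unshelve. all: by end_near. Qed.

(** The average of [f] over [n] steps changes under [U] by [(U^n f - f) / n], which is at most
    [2 C / n]. *)
Lemma almost_fixed_nonempty k : exists g, almost_fixed k g.
Proof.
have [n nk] : exists n : nat, (C + C) * 2 ^+ k < n.+1%:R.
  have h := archi_boundP (mulr_ge0 (addr_ge0 C0 C0) (exprn_ge0 k (ler0n R 2))).
  by eexists; apply: lt_trans h _; rewrite ltr_nat.
have n0 : 0 < n.+1%:R :> R by [].
have SL := partial_sum_L1 X_separable U_op n.+1 fL.
exists (fun w => n.+1%:R^-1 *: S f n.+1 w); split.
- exact: (L1Z X_separable).
- apply: filterS (partial_sum_bound X_separable U_op n.+1 fL C0 fC) => w h.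
  by rewrite normrZ ger0_norm ?invr_ge0// ler_pdivrMl.
- have e1 := contrZ X_separable U_op n.+1%:R^-1 SL.
  have e2 := partial_sumSr X_separable U_op n.+1 fL.
  have e3 := iter_bound X_separable U_op n.+1 fL C0 fC.
  near=> w.
  have -> : U (fun w => n.+1%:R^-1 *: S f n.+1 w) w = n.+1%:R^-1 *: U (S f n.+1) w.
    by near: w.
  rewrite -scalerBr normrZ ger0_norm ?invr_ge0// ler_pdivrMl//.
  have e : f w + U (S f n.+1) w = S f n.+1 w + iter n.+1 U f w by near: w.
  have -> : U (S f n.+1) w - S f n.+1 w = iter n.+1 U f w - f w.
    by apply/eqP; rewrite subr_eq addrAC eq_sym subr_eq [X in X == _]addrC -e addrC.
  apply: le_trans (ler_normB _ _) _.
  have h1 : `|iter n.+1 U f w| <= C by near: w.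
  have h2 : `|f w| <= C by near: w.
  apply: le_trans (lerD h1 h2) _; rewrite exprVn ler_pdivlMr ?exprn_gt0//.
  exact: ltW.
- have h := coboundary_lin X_separable U_op n.+1%:R^-1
    (partial_sum_coboundary X_separable U_op n.+1 fL C0 fC) (coboundary0 X_separable U_op).
  move: h; congr coboundary; apply/funext => w.
  by rewrite addr0 scalerBr scalerA mulVf ?scale1r// gt_eqF.
Unshelve. all: by end_near. Qed.

(* Approximate minimisers of a strictly convex energy over the decreasing convex
   sets [almost_fixed k] converge, by the parallelogram identity. *)
Lemma almost_fixed_cvg (l_ : nat -> X -> R) :
  (forall j, dual (l_ j)) -> (forall j x, `|l_ j x| <= `|x|) ->
  exists g : nat -> T -> X, (forall i, almost_fixed i (g i)) /\
    {ae mu, forall w j, cvgn (fun i => l_ j (g i w) : R^o)}.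
Proof.
move=> lX lb; pose en := energy mu l_; pose M := fine (mu setT).
have M0 : 0 <= M by rewrite fine_ge0.
pose D k := [set en g | g in almost_fixed k]; pose dk k := inf (D k).
have en0 g : 0 <= en g by rewrite fine_ge0// integral_ge0// => w _; exact: hnorm2_ge0.
have D0 k : D k !=set0 by have [g gk] := almost_fixed_nonempty k; exists (en g), g.
have Dlb k : lbound (D k) 0 by move=> _ [g _ <-].
have Dinf k : has_inf (D k) by split; [exact: D0|exists 0; exact: Dlb].
have dle k g : almost_fixed k g -> dk k <= en g.
  by move=> kg; apply: ge_inf; [exists 0; exact: Dlb|exists g].
have enM k g : almost_fixed k g -> en g <= 2 * C ^+ 2 * M.
  by move=> [gL gC _ _]; have [_] := energyK lX lb (L1_dmeas X_separable gL) gC.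
have dmono k m : (k <= m)%N -> dk k <= dk m.
  move=> km; apply: lb_le_inf => [|_ [g gm <-]]; first exact: D0.
  by apply: dle; exact: almost_fixed_le gm.
have dM k : dk k <= 2 * C ^+ 2 * M.
  by have [g gk] := almost_fixed_nonempty k; exact: le_trans (dle _ _ gk) (enM _ _ gk).
(* The infima [dk] increase with [k] and stay bounded. Choosing [k i] with [dk (k i)] within
   [4^-1 ^+ i] of [dd] makes the minimisation problems comparable for different [i]. *)
pose dd := sup (range dk).
have ddP : has_sup (range dk) by split; [exists (dk 0), 0%N|exists (2 * C ^+ 2 * M) => _ [k _ <-]].
have dkd k : dk k <= dd by apply: sup_upper_bound => //; exists k.
have q0 i : 0 < (4^-1 : R) ^+ i by rewrite exprn_gt0.
have /choice[g /choice[k gk]] i : exists g k, [/\ (i <= k)%N, almost_fixed k g,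
    dd - dk k <= 4^-1 ^+ i & en g <= dk k + 4^-1 ^+ i].
  have [_ [n _ <-] dn] := sup_adherent (q0 i) ddP.
  have [_ [g gk <-] hg] := inf_adherent (q0 i) (Dinf (n + i)%N).
  exists g, (n + i)%N; split=> //; [exact: leq_addl| |exact: ltW].
  have := dmono n (n + i)%N (leq_addr _ _).
  by move: dn; rewrite -/dd; move: (4^-1 ^+ i) (dk n) (dk _) => q a b; lra.
have gki i : almost_fixed i (g i) by have [ik h _ _] := gk i; exact: almost_fixed_le h.
exists g; split=> //; apply: ae_foralln => j.
have gL i : L1 mu (g i) by case: (gki i).
have gm i : dmeas (g i) by exact: L1_dmeas (gL i).
have gC i : {ae mu, forall w, `|g i w| <= C} by case: (gki i).
(* Both energies are at most [dd + 4^-1 ^+ i], and that of the midpoint is at least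
   [dd - 4^-1 ^+ i]; in the parallelogram identity the terms [4 * dd] cancel and the errors add up
   to [8 * 4^-1 ^+ i]. *)
have dE i : en (fun w => g i w - g i.+1 w) <= 8 * 4^-1 ^+ i.
  have [_ h1 h2 h3] := gk i; have [_ h1' h2' h3'] := gk i.+1.
  have := energy_parallelogram lX lb (gm i) (gm i.+1) (gC i) (gC i.+1).
  pose m := minn (k i) (k i.+1).
  have mf := almost_fixed_mid (almost_fixed_le (geq_minl (k i) (k i.+1)) h1)
    (almost_fixed_le (geq_minr (k i) (k i.+1)) h1').
  have := dle _ _ mf; rewrite -/m -/en.
  have qS : (4^-1 : R) ^+ i.+1 <= 4^-1 ^+ i by rewrite ler_wiXn2l// invf_le1// ler1n.
  have dm : dd - dk m <= 4^-1 ^+ i.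
    by rewrite /m /minn; case: ifP => _; lra.
  have := dkd (k i); have := dkd (k i.+1); move: qS dm h2 h3 h2' h3' => /=.
  by move: (4^-1 ^+ i) (4^-1 ^+ i.+1) => a b; lra.
(* From [|a| <= (2^-i + 2^i a^2) / 2] with [a] the increment of [l_ j (g i)], whose square has
   integral at most [2^j * 8 * 4^-i]. *)
pose B : R := 2^-1 * M + 4 * 2 ^+ j.
have B0 : 0 <= B by rewrite addr_ge0// mulr_ge0// ?invr_ge0// exprn_ge0.
have key i : (nrm mu setT (fun w => (l_ j (g i.+1 w) : R^o) - l_ j (g i w))%R <=
    (B * 2^-1 ^+ i)%:E)%E.
  have dm := dmeasB (gm i) (gm i.+1).
  have dC : {ae mu, forall w, `|g i w - g i.+1 w| <= C + C}.
    by apply: filterS2 (gC i) (gC i.+1) => w c1 c2; apply: le_trans (ler_normB _ _) _; exact: lerD.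
  have [eE _] := energyK lX lb dm dC.
  have lm : measurable_fun setT (fun w => l_ j (g i w - g i.+1 w)) by exact: dm.
  have am : measurable_fun setT (fun w => (l_ j (g i w - g i.+1 w) ^+ 2 : R)) by exact: measurable_funX.
  pose v w := 2^-1 * 2^-1 ^+ i + 2^-1 * 2 ^+ i * l_ j (g i w - g i.+1 w) ^+ 2.
  have v1m : measurable_fun setT (fun w => 2^-1 * 2 ^+ i * l_ j (g i w - g i.+1 w) ^+ 2).
    exact: measurable_funM.
  apply: (@le_trans _ _ (\int[mu]_w (v w)%:E)%E).
    apply: (le_nrm_ae (separable_real R) measurableT).
    - by apply: dmeasB; apply/dmeas_real; [exact: gm i.+1 _ (lX j)|exact: gm i _ (lX j)].
    - exact: measurable_funD.
    - apply: aeW => w _; rewrite distrC -(dualB _ _ (lX j)) /v.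
      move: (l_ j _) => a; rewrite exprVn; have : 0 < (2 : R) ^+ i by rewrite exprn_gt0.
      move: (2 ^+ i) => p p0; rewrite -(real_normK (num_real a)).
      have := mulr_ge0 (ltW p0) (sqr_ge0 (p^-1 - `|a|)).
      rewrite (_ : p * _ = p^-1 - 2 * `|a| + p * `|a| ^+ 2); first lra.
      by field; rewrite gt_eqF.
  under eq_integral do rewrite /v EFinD.
  have c0 (c : R) : 0 <= c -> (0 <= c%:E)%E by rewrite lee_fin.
  have p0 : 0 <= (2 : R) ^+ i by rewrite exprn_ge0.
  have r0 : 0 < (2^-1 : R) ^+ j by exact: half_pow_gt0.
  have a0 w : (0 <= (l_ j (g i w - g i.+1 w) ^+ 2)%:E)%E by rewrite lee_fin sqr_ge0.
  have amE := (measurable_EFinP _ _).2 am; have vmE := (measurable_EFinP _ _).2 v1m.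
  have p2 : (0 <= (2^-1 * 2 ^+ i : R)%:E)%E by rewrite lee_fin mulr_ge0// invr_ge0.
  have q2 : (0 <= (2^-1 * 2^-1 ^+ i : R)%:E)%E by rewrite lee_fin mulr_ge0// exprn_ge0// invr_ge0.
  rewrite ge0_integralD//; last by move=> w _; rewrite EFinM mule_ge0.
  under [X in (_ + X)%E]eq_integral do rewrite EFinM.
  rewrite (ge0_integralZl _ measurableT amE)/= => [|w _ //|//].
  have aE : (\int[mu]_w (l_ j (g i w - g i.+1 w) ^+ 2)%:E <= (2 ^+ j * (8 * 4^-1 ^+ i))%:E)%E.
    rewrite -[(2 ^+ j)]invrK -exprVn EFinM lee_pdivlMl//.
    rewrite -(ge0_integralZl _ measurableT amE)/= => [|w _ //|//].
    apply: le_trans (_ : ((en (fun w => g i w - g i.+1 w))%:E <= _)%E); last by rewrite lee_fin.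
    rewrite eE; apply: ge0_le_integral => //.
    - by move=> w _; rewrite mule_ge0// lee_fin ?sqr_ge0// ltW.
    - by apply: measurable_funeM; exact/measurable_EFinP.
    - exact: measurable_hnorm2.
    - by move=> w _; rewrite -EFinM; exact: hnorm2_term.
  rewrite (_ : (\int[mu]__ _)%E = ((2^-1 * 2^-1 ^+ i) * M)%:E); last first.
    by rewrite integral_cst// [RHS]EFinM fineK ?fin_num_measure.
  apply: le_trans (leeD2l _ (lee_wpmul2l _ aE)) _; first by rewrite lee_fin mulr_ge0// invr_ge0.
  rewrite -!EFinM -EFinD lee_fin /B !exprVn.
  have -> : (4 : R) ^+ i = 2 ^+ i * 2 ^+ i by rewrite -exprMn; congr (_ ^+ _); ring.
  have : 0 < (2 : R) ^+ i by rewrite exprn_gt0.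
  move: (2 ^+ i) (2 ^+ j) => p r p1.
  rewrite [leLHS](_ : _ = (2^-1 * M + 4 * r) * p^-1)//.
  by field; rewrite gt_eqF.
have [u [_ ul _]] := fast_cauchy_limit (separable_real R) B0
  (fun i => (dmeas_real (fun w => l_ j (g i w))).1 (gm i _ (lX j))) key.
by apply: filterS ul => w h; apply/cvg_ex; exists (u w).
Qed.

End Minimization.
End MeanErgodicDecomposition.

(** * The weak limit and the mean ergodic decomposition *)

Section MeanErgodicTheorem.
Context (R : realType) (X : completeNormedModType R).
Hypothesis X_separable : separable X.
Hypothesis X_reflexive : reflexive_space X.
Context d (T : measurableType d).
Variable mu : {finite_measure set T -> \bar R}.
Variable U : (T -> X) -> (T -> X).
Hypothesis U_op : L1_Linf_contraction mu U.
Implicit Types f g h : T -> X.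

Lemma nrm_le0_ae f : dmeas f -> (nrm mu setT f <= 0)%E -> {ae mu, forall w, f w = 0}.
Proof.
move=> fm f0; have mf := measurable_EFin_norm X_separable fm (D := setT).
have /(ae_eq_integral_abs _ measurableT mf) : (\int[mu]_w `|(`|f w|)%:E| = 0)%E.
  by apply/eqP; rewrite eq_le integral_ge0// andbT; under eq_integral do rewrite /= normr_id.
by apply: filterS => w /(_ Logic.I)[/normr0_eq0].
Qed.

Lemma functional_comp phi : L1_functional mu phi -> L1_functional mu (phi \o U).
Proof.
move=> phiL; split=> [a f g fL gL|f fL] /=.
  have UfL := contr_L1 U_op fL; have UgL := contr_L1 U_op gL.
  rewrite -phiL.1//; apply: (functional_ae X_separable phiL).
  - exact: (contr_L1 U_op (L1_lin X_separable a fL gL)).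
  - exact: (L1_lin X_separable).
  - exact: contr_lin.
have UfL := contr_L1 U_op fL; apply: le_trans (phiL.2 _ UfL) _.
by rewrite -lee_fin !(nrm1K X_separable)//; exact: (contr_nrm U_op fL).
Qed.

(** The limit is chosen separately at each point, yet its composition with any functional is a limit
    of measurable functions, and this is all that [dmeas] asks for. *)
Lemma weak_limit_function (l_ : nat -> X -> R) (g : nat -> T -> X) (C : R) :
  (forall j, dual (l_ j)) -> (forall x, (forall j, l_ j x <= 0) -> x = 0) ->
  (forall i, dmeas (g i)) -> (forall i, {ae mu, forall w, `|g i w| <= C}) ->
  {ae mu, forall w j, cvgn (fun i => l_ j (g i w) : R^o)} ->
  exists h, [/\ dmeas h, {ae mu, forall w, `|h w| <= C} &
    {ae mu, forall w l, dual l -> l (g i w) @[i --> \oo] --> l (h w)}].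
Proof.
move=> lX lsep gm gC gc.
have gC' : {ae mu, forall w i, `|g i w| <= C} by exact: ae_foralln.
have [N [mN N0 NP]] : {ae mu, forall w, (forall i, `|g i w| <= C) /\
    forall j, cvgn (fun i => l_ j (g i w) : R^o)} by apply: filterS2 gC' gc.
have good w : ~ N w -> (forall i, `|g i w| <= C) /\ forall j, cvgn (fun i => l_ j (g i w) : R^o).
  by move=> nN; apply: contrapT => h; apply: nN; exact: NP.
have /choice[h hP] w : exists y : X, (N w -> y = 0) /\ (~ N w -> `|y| <= C /\
    forall l, dual l -> l (g i w) @[i --> \oo] --> l y).
  have [Nw|nN] := pselect (N w); first by exists 0.
  have [h1 h2] := good w nN.
  by have [h hC hl] := reflexive_weak_limit X_reflexive lX lsep h1 h2; exists h.
have aeN : {ae mu, forall w, ~ N w} by exists N; split=> // w /contrapT.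
exists h; split.
- move=> l lX'.
  apply: (@measurable_fun_cvg _ _ _ _ (fun i => l \o (fun w => if w \in N then 0 else g i w))).
    by move=> i; apply: dmeas_if => //; exact: dmeas_cst.
  move=> w _ /=; have [Nw|nN] := pselect (N w).
    by rewrite mem_set// (hP w).1//; exact: cvg_cst.
  by rewrite memNset//; exact: ((hP w).2 nN).2.
- by apply: filterS aeN => w nN; case: ((hP w).2 nN).
- by apply: filterS aeN => w nN; case: ((hP w).2 nN).
Qed.

(** For a functional [phi] on L1 both [phi] and [phi \o U] converge along [g i] to their values at
    [h]; since [U (g i) - g i] is uniformly small, [phi] cannot distinguish [U h] from [h]. *)
Lemma mean_ergodic_bounded f (C : R) : L1 mu f -> 0 <= C ->
  {ae mu, forall w, `|f w| <= C} -> exists h, [/\ L1 mu h, {ae mu, forall w, U h w = h w} &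
    forall e : R, 0 < e -> exists2 z, coboundary mu U z &
      (nrm mu setT (fun w => (f w - h w) - z w)%R <= e%:E)%E].
Proof.
move=> fL C0 fC; have [l_ [lX lb ln]] := norming_sequence X_separable.
have lsep x : (forall j, l_ j x <= 0) -> x = 0.
  by move=> /ln; rewrite normr_le0 => /eqP.
have [g [gP gc]] := almost_fixed_cvg X_separable U_op fL C0 fC lX lb.
have gL i : L1 mu (g i) by case: (gP i).
have gm i : dmeas (g i) by exact: L1_dmeas (gL i).
have gC i : {ae mu, forall w, `|g i w| <= C} by case: (gP i).
have [h [hm hC hl]] := weak_limit_function lX lsep gm gC gc.
have hL : L1 mu h by exact: L1_bounded hC.
have dL i := L1B X_separable (gL i) hL.
have phi0 phi : L1_functional mu phi -> phi (fun w => g i w - h w) @[i --> \oo] --> (0 : R^o).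
  move=> phiL; apply: (functional_weak_cvg X_separable phiL (C := C + C)) => // [i|].
    by apply: filterS2 (gC i) hC => w c1 c2; apply: le_trans (ler_normB _ _) _; exact: lerD.
  apply: filterS hl => w hl l lX'.
  under eq_cvg do rewrite (dualB _ _ lX').
  have c : l (g i w) - l (h w) @[i --> \oo] --> (l (h w) - l (h w) : R^o).
    by apply: cvgB; [exact: hl|exact: cvg_cst].
  by rewrite subrr in c.
exists h; split=> //.
- have UhL := contr_L1 U_op hL; have dUL := L1B X_separable UhL hL.
  have L0 := L1_cst X_separable mu (0 : X).
  (* Separation from the subspace reduced to 0: a function annihilated by all functionals has norm
     0. *)
  have H : forall e : R, 0 < e -> exists2 z, [set fun=> 0 : X] z &
      (nrm mu setT (fun w => (U h w - h w) - z w)%R <= e%:E)%E.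
    apply: (functional_separation X_separable) => //.
    - by move=> _ ->.
    - by move=> a _ _ -> ->; apply/funext => w; rewrite scaler0 addr0.
    move=> phi phiL _; have psiL := functional_comp phiL.
    have c1 := phi0 _ phiL; have c2 := phi0 _ psiL.
    rewrite (functionalB phiL UhL hL); apply/eqP; rewrite -normr_le0.
    apply/ler_addgt0Pr => e e0; rewrite add0r; have e3 : 0 < e / 3 by rewrite divr_gt0.
    move/cvgrPdist_lt : c1 => /(_ _ e3) c1; move/cvgrPdist_lt : c2 => /(_ _ e3) c2.
    pose M := fine (mu setT); have M1 : 0 < M + 1 by rewrite ltr_wpDl// fine_ge0.
    have eM : 0 < e / 3 / (M + 1) by rewrite divr_gt0.
    have Ug i : `|phi (U (g i)) - phi (g i)| <= 2^-1 ^+ i * M.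
      have [_ _ Ugi _] := gP i; have UgL := contr_L1 U_op (gL i).
      apply: (functional_dist X_separable phiL UgL (gL i)).
      apply: (bounded_nrm X_separable) => //.
      by apply: dmeasB; [exact: L1_dmeas UgL|exact: gm].
    near \oo => i.
    have k1 : `|0 - phi (fun w => g i w - h w)| < e / 3 by near: i.
    have k2 : `|0 - (phi \o U) (fun w => g i w - h w)| < e / 3 by near: i.
    have k3 : (2^-1 : R) ^+ i < e / 3 / (M + 1) by near: i; exact: half_pow_lt.
    have k4 : 2^-1 ^+ i * M <= e / 3.
      apply: le_trans (_ : 2^-1 ^+ i * (M + 1) <= _).
        by apply: ler_wpM2l; [exact: ltW (half_pow_gt0 R i)|rewrite lerDl].
      by rewrite -ler_pdivlMr// ltW.
    move: k1 k2; rewrite (functionalB phiL (gL i) hL) (functionalB psiL (gL i) hL) !sub0r !normrN /=.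
    have := Ug i; move: (phi _) (phi _) (phi _) (phi _) => p1 p2 p3 p4.
    rewrite !ler_norml !ltr_norml => /andP[? ?] /andP[? ?] /andP[? ?].
    by apply/andP; split; lra.
  have : (nrm mu setT (fun w => U h w - h w)%R <= 0)%E.
    apply/lee_addgt0Pr => e e0; rewrite add0e; have [_ -> h1] := H e e0.
    by under eq_fun do rewrite -[_ - _]subr0.
  move=> /(nrm_le0_ae (L1_dmeas X_separable dUL)); apply: filterS => w /eqP.
  by rewrite subr_eq0 => /eqP.
- apply: (functional_separation X_separable) => //.
  + by move=> z [].
  + exact: coboundary0.
  + by move=> a z z'; exact: coboundary_lin.
  + exact: (L1B X_separable).
  move=> phi phiL phiZ.
  (* [f - g i] is a coboundary, so a [phi] that vanishes on coboundaries is constant along a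
     sequence that tends to 0. *)
  have E i : phi (fun w => g i w - h w) = phi (fun w => f w - h w).
    have [_ _ _ /phiZ] := gP i; rewrite (functionalB phiL fL (gL i)) (functionalB phiL (gL i) hL) (functionalB phiL fL hL).
    by move=> /eqP; rewrite subr_eq0 => /eqP ->.
  have c0 : limn (fun i => phi (fun w => g i w - h w) : R^o) = 0.
    by apply/cvg_lim => //; exact: phi0.
  by rewrite -c0; under [in RHS]eq_fun do rewrite E; rewrite lim_cst.
Unshelve. all: by end_near. Qed.

End MeanErgodicTheorem.

(** This allows the vector-valued ergodic theorem to be applied to the scalar dominating flow
    itself. *)
Lemma real_reflexive (R : realType) : reflexive_space (R^o : normedModType R).
Proof.
move=> phi [philin _]; exists (phi idfun) => l lX.
have lE x : l x = l 1 * x.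
  by rewrite -{1}[x]mulr1 -[x * 1]/(x *: (1 : R^o)) (dualZ _ _ lX) mulrC.
rewrite lE; have idX := dual_id R.
have z0 : dual ((fun=> 0) : R^o -> R).
  by split=> [a x y|]; [rewrite mulr0 addr0|exact: cst_continuous].
have phi0 : phi (fun=> 0) = 0.
  have := philin (-1) _ _ z0 z0; under eq_fun do rewrite mulr0 addr0.
  by rewrite mulN1r addNr.
have := philin (l 1) _ _ idX z0; rewrite phi0 [RHS]addr0 => <-; congr phi.
by apply/funext => x; rewrite addr0 lE.
Qed.

Section Truncation.
Context (R : realType) (X : completeNormedModType R).
Hypothesis X_separable : separable X.
Context d (T : measurableType d).
Variable mu : {finite_measure set T -> \bar R}.

Lemma L1_norm (f : T -> X) : L1 mu f -> L1 mu (fun w => `|f w| : R^o).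
Proof. by move=> fL; apply: integrable_L1; exact: (L1_norm_integrable X_separable fL). Qed.

Lemma L1_truncate (f : T -> X) (e : R) : L1 mu f -> 0 < e ->
  exists g C, [/\ L1 mu g, 0 <= C, {ae mu, forall w, `|g w| <= C} &
    (nrm mu setT (fun w => f w - g w)%R <= e%:E)%E].
Proof.
move=> fL e0; have fm := L1_dmeas X_separable fL.
pose A n := [set w | `|f w| <= n%:R].
have mA n : measurable (A n).
  have := measurable_fun_ler (measurable_norm_dmeas X_separable fm) (measurable_cst (n%:R : R)).
  by move=> /(_ measurableT [set true]); rewrite setTI; exact.
pose g n w := if w \in A n then f w else 0.
have gm n : dmeas (g n) by apply: dmeas_if => //; exact: dmeas_cst.
have gC n w : `|g n w| <= n%:R.
  by rewrite /g; case: ifPn => [/set_mem//|_]; rewrite normr0.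
have c0 : nrm mu setT (fun w => g n w - f w)%R @[n --> \oo] --> 0%E.
  apply: (nrm_dominated_cvg0 X_separable gm fm (L1_norm_integrable X_separable fL)).
    apply: aeW => w; apply/cvgrPdist_lt => r r0.
    have [n nf] : exists n : nat, `|f w| < n%:R.
      by eexists; apply: archi_boundP.
    exists n => // m nm; rewrite /g mem_set ?subrr ?normr0// /A/=.
    by apply: ltW; apply: lt_le_trans nf _; rewrite ler_nat.
  apply: aeW => w n; rewrite /g; case: ifPn => _; first by rewrite subrr normr0.
  by rewrite sub0r normrN.
move/cvge0P : c0 => /(_ (fun n => nrm_ge0 _ _ _) e e0)[n _ /(_ n (leqnn _)) h].
exists (g n), n%:R; split=> //; last by rewrite nrm_distC ltW.
  by apply: (L1_bounded X_separable (C := n%:R)) => //; exact: aeW.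
exact: aeW.
Qed.

End Truncation.

(** * The pointwise ergodic theorem in discrete time *)

Section PointwiseErgodic.
Context (R : realType) (X : completeNormedModType R).
Hypothesis X_separable : separable X.
Hypothesis X_reflexive : reflexive_space X.
Context d (T : measurableType d).
Variable mu : {finite_measure set T -> \bar R}.
Variable U : (T -> X) -> (T -> X).
Hypothesis U_op : L1_Linf_contraction mu U.
Variable Q : (T -> R^o) -> (T -> R^o).
Hypothesis Q_op : L1_Linf_contraction mu Q.
Hypothesis Q_pos : forall u : T -> R^o, L1 mu u -> {ae mu, forall w, 0 <= u w} ->
  {ae mu, forall w, 0 <= Q u w}.
Hypothesis UQ : forall f, L1 mu f -> {ae mu, forall w, `|U f w| <= Q (fun w => `|f w|) w}.
Implicit Types f g h : T -> X.

Lemma mean_ergodic_decomposition f (e : R) : L1 mu f -> 0 < e -> exists h z,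
  [/\ L1 mu h, {ae mu, forall w, U h w = h w}, coboundary mu U z &
   (nrm mu setT (fun w => f w - (h w + z w))%R <= e%:E)%E].
Proof.
move=> fL e0; have e2 : 0 < e / 2 by rewrite divr_gt0.
have [g [C [gL C0 gC fg]]] := L1_truncate X_separable fL e2.
have [h [hL Uh /(_ _ e2)[z zc ghz]]] := mean_ergodic_bounded X_separable X_reflexive U_op gL C0 gC.
exists h, z; split=> //.
have zL : L1 mu z by case: zc.
have hzL := L1D X_separable hL zL.
have D := L1_dmeas X_separable.
apply: le_trans (nrm_dist_trans _ X_separable measurableT (D _ _ _ _ fL) (D _ _ _ _ gL) (D _ _ _ _ hzL)) _.
rewrite [e]splitr EFinD leeD//.
rewrite (_ : (fun w => _) = (fun w => g w - h w - z w))//.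
by apply/funext => w; rewrite opprD addrA.
Qed.

Lemma dominated_partial_sum f (u : T -> R^o) n : L1 mu f -> L1 mu u ->
  {ae mu, forall w, `|f w| <= u w} ->
  {ae mu, forall w, `|partial_sum U f n w| <= partial_sum Q u n w}.
Proof.
move=> fL uL fu; elim: n => [|n IH] /=; first by apply: aeW => w; rewrite normr0.
have SL := partial_sum_L1 X_separable U_op n fL.
have h1 := UQ SL.
have h2 := pos_mono Q_op Q_pos (L1_norm X_separable SL)
  (partial_sum_L1 (separable_real R) Q_op n uL) IH.
apply: filterS3 fu h1 h2 => w k1 k2 k3; apply: le_trans (ler_normD _ _) _.
by apply: lerD => //; exact: le_trans k3.
Qed.

(** Write [f = h + z + r]: the averages of the invariant [h] are constant, those of the coboundary
    [z] tend to 0, and those of the remainder [r] are controlled off a small set by the maximal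
    inequality for [Q] at [|r|]. The limit is not identified; only the Cauchy property is proved. *)
Theorem pointwise_ergodic f : L1 mu f ->
  {ae mu, forall w, cvgn (fun n => n%:R^-1 *: partial_sum U f n w)}.
Proof.
move=> fL; pose A k n w := n%:R^-1 *: partial_sum U k n w.
have H : {ae mu, forall w (lam : R), 0 < lam -> exists N, forall n m,
    (N <= n)%N -> (N <= m)%N -> `|A f n w - A f m w| <= lam}.
  apply: ae_forall_small.
    by move=> lam lam' w ll [N NP]; exists N => n m Nn Nm; apply: le_trans (NP n m _ _) ll.
  move=> lam eps lam0 eps0.
  (* The averages of [r], and from [N] on those of [z], are each at most [lam / 4]; hence the
     averages of [f] stay within [lam / 2] of [h] and within [lam] of one another. *)
  have lam4 : 0 < lam / 4 by rewrite divr_gt0.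
  have e0 : 0 < eps * (lam / 4) by rewrite mulr_gt0.
  have [h [z [hL Uh zc fhz]]] := mean_ergodic_decomposition fL e0.
  have zL : L1 mu z by case: zc.
  have hzL := L1D X_separable hL zL; have rL := L1B X_separable fL hzL.
  set r := (fun w => f w - (h w + z w)) in rL fhz.
  have nrL := L1_norm X_separable rL.
  have [B [mB muB BP]] := maximal_ergodic Q_op Q_pos nrL (fun w => normr_ge0 _) lam4.
  exists B; split=> //.
    rewrite -(@lee_pmul2l _ (lam / 4)%:E)// ?lte_fin//; apply: le_trans muB _.
    rewrite muleC -EFinM; apply: le_trans fhz; rewrite le_eqVlt; apply/orP; left.
    by apply/eqP/eq_integral => w _; rewrite normr_id.
  have [_ [g [D [gL gD zg]]]] := zc.
  have SrB : {ae mu, forall w n, `|partial_sum U r n w| <= partial_sum Q (fun w => `|r w|) n w}.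
    by apply: ae_foralln => n; apply: dominated_partial_sum => //; exact: aeW.
  have Sh : {ae mu, forall w n, partial_sum U h n w = n%:R *: h w}.
    by apply: ae_foralln => n; exact: partial_sum_fixed.
  have Sz : {ae mu, forall w n, `|partial_sum U z n w| <= `|D| + `|D|}.
    apply: ae_foralln => n; have gUL := L1B X_separable gL (contr_L1 U_op gL).
    have h1 := partial_sum_ae X_separable U_op n zL gUL zg.
    have h2 := partial_sum_telescope X_separable U_op n gL.
    have D0 : 0 <= `|D| by [].
    have h3 : {ae mu, forall w, `|iter n U g w| <= `|D|}.
      apply: (iter_bound X_separable U_op n gL) => //.
      by apply: filterS gD => w k; apply: le_trans k _; exact: ler_norm.
    near=> w.
    have -> : partial_sum U z n w = partial_sum U (fun w => g w - U g w) n w by near: w.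
    have -> : partial_sum U (fun w => g w - U g w) n w = g w - iter n U g w by near: w.
    have k1 : `|g w| <= D by near: w.
    have k2 : `|iter n U g w| <= `|D| by near: w.
    apply: le_trans (ler_normB _ _) (lerD _ k2); exact: le_trans k1 (ler_norm _).
  have Sf : {ae mu, forall w n, partial_sum U f n w =
      partial_sum U r n w + (partial_sum U h n w + partial_sum U z n w)}.
    apply: ae_foralln => n.
    have e1 := partial_sum_lin X_separable U_op 1 n rL hzL.
    have e2 := partial_sum_lin X_separable U_op 1 n hL zL.
    have fE : f = (fun w => 1 *: r w + (h w + z w)).
      by apply/funext => w; rewrite scale1r subrK.
    have hzE : (fun w => h w + z w) = (fun w => 1 *: h w + z w).
      by apply/funext => w; rewrite scale1r.
    apply: filterS2 e1 e2 => w; rewrite -fE !scale1r => -> {}e2; congr (_ + _).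
    by rewrite hzE.
  near=> w => nB.
  have w1 : forall n, `|partial_sum U r n w| <= partial_sum Q (fun w => `|r w|) n w by near: w.
  have w2 : forall n, partial_sum U h n w = n%:R *: h w by near: w.
  have w3 : forall n, `|partial_sum U z n w| <= `|D| + `|D| by near: w.
  have w4 : forall n, partial_sum U f n w =
      partial_sum U r n w + (partial_sum U h n w + partial_sum U z n w) by near: w.
  have w5 : ~ B w -> forall n, partial_sum Q (fun w => `|r w|) n w <= n%:R * (lam / 4).
    by near: w.
  have D20 : 0 <= (`|D| + `|D|) / (lam / 4) by rewrite divr_ge0 ?addr_ge0// ltW.
  have [N DN] : exists N : nat, (`|D| + `|D|) / (lam / 4) < N%:R.
    by eexists; exact: archi_boundP D20.
  have N0 : 0 < N%:R :> R by exact: le_lt_trans DN.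
  have key n : (N <= n)%N -> `|A f n w - h w| <= lam / 2.
    move=> Nn; have Nn' : N%:R <= n%:R :> R by rewrite ler_nat.
    have n0 : 0 < n%:R :> R by exact: lt_le_trans Nn'.
    rewrite /A w4 w2 !scalerDr scalerA mulVf ?gt_eqF// scale1r addrCA addrAC subrr add0r.
    rewrite -scalerDr normrZ normfV normr_nat ler_pdivrMl//.
    apply: le_trans (ler_normD _ _) _.
    have k1 := le_trans (w1 n) (w5 nB n); have k2 := w3 n.
    have k3 : `|D| + `|D| <= n%:R * (lam / 4).
      by rewrite -ler_pdivrMr//; apply: le_trans Nn'; exact: ltW.
    have -> : n%:R * (lam / 2) = n%:R * (lam / 4) + n%:R * (lam / 4) by field.
    by apply: lerD k1 (le_trans k2 k3).
  exists N => n m /key k1 /key k2.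
  have := ler_distD (h w) (A f n w) (A f m w); rewrite (distrC (h w)); lra.
apply: filterS H => w H; apply/cauchy_cvgP/cauchyP => e e0.
have e2 : 0 < e / 2 by rewrite divr_gt0.
have [N NP] := H _ e2; exists (A f N w); exists N => // n /= Nn.
rewrite -ball_normE /=; have := NP N n (leqnn _) Nn; lra.
Unshelve. all: by end_near. Qed.

End PointwiseErgodic.

(** A positive [Q] dominates itself, so its averages converge almost everywhere; [Q^n u / n] is, up
    to a factor tending to 1, a difference of consecutive averages. *)
Lemma positive_iter_over_n (R : realType) d (T : measurableType d)
    (mu : {finite_measure set T -> \bar R}) (Q : (T -> R^o) -> (T -> R^o)) u :
  L1_Linf_contraction mu Q ->
  (forall u : T -> R^o, L1 mu u -> {ae mu, forall w, 0 <= u w} ->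
    {ae mu, forall w, 0 <= Q u w}) -> L1 mu u ->
  {ae mu, forall w, (n%:R^-1 : R) *: iter n Q u w @[n --> \oo] --> (0 : R^o)}.
Proof.
move=> Q_op Q_pos uL.
have QQ : forall v, L1 mu v -> {ae mu, forall w, `|Q v w| <= Q (fun w => `|v w|) w}.
  move=> v vL; have nL := L1_norm (separable_real R) vL.
  have h1 : {ae mu, forall w, Q v w <= Q (fun w => `|v w|) w}.
    by apply: (pos_mono Q_op Q_pos) => //; apply: aeW => w; exact: ler_norm.
  have NL := L1Z (separable_real R) (-1) vL.
  have h2 : {ae mu, forall w, Q (fun w => (-1) *: v w) w <= Q (fun w => `|v w|) w}.
    by apply: (pos_mono Q_op Q_pos) => //; apply: aeW => w; rewrite scaleN1r -normrN ler_norm.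
  have h3 := contrZ (separable_real R) Q_op (-1) vL.
  apply: filterS3 h1 h2 h3 => w k1 k2 k3; rewrite ler_norml k1 andbT lerNl.
  by move: k2; rewrite k3 scaleN1r.
have H := pointwise_ergodic (separable_real R) (@real_reflexive R) Q_op Q_op Q_pos QQ uL.
have S1 : {ae mu, forall w n, partial_sum Q u n.+1 w = partial_sum Q u n w + iter n Q u w}.
  by apply: ae_foralln => n; exact: (partial_sumSr (separable_real R) Q_op).
apply: filterS2 H S1 => w; set A := (fun n => _ : R^o) => cA S1.
have c1 : A n.+1 @[n --> \oo] --> (limn A : R^o) by rewrite (cvg_shiftS A); exact: cA.
have c2 : A n.+2 @[n --> \oo] --> (limn A : R^o) by rewrite (cvg_shiftS (fun n => A n.+1)).
pose v n : R^o := (n%:R^-1 : R) *: iter n Q u w.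
(* The factor is [(n + 2) / (n + 1)], as [harmonic n] is [1 / (n + 1)]. *)
have vE n : v n.+1 = (1 + harmonic n) * A n.+2 - A n.+1.
  rewrite /v /A (S1 n.+1).
  move: (partial_sum Q u n.+1 w) (iter n.+1 Q u w) => a b.
  rewrite /GRing.scale/= /harmonic -(natr1 n.+1).
  have : (0 : R) < n.+1%:R by []; move: (n.+1%:R : R) => m m0.
  have m1 : m + 1 != 0 by rewrite gt_eqF// addr_gt0.
  by field; rewrite m1 gt_eqF.
have c3 : (1 + harmonic n) * A n.+2 - A n.+1 @[n --> \oo] --> ((1 + 0) * limn A - limn A : R^o).
  by apply: cvgB => //; apply: cvgM => //; apply: cvgD; [exact: cvg_cst|exact: cvg_harmonic].
rewrite addr0 mul1r subrr in c3.
have c4 : [sequence v n.+1]_n @ \oo --> (0 : R^o).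
  by apply: cvg_trans c3; under [X in X @ _]eq_fun do rewrite vE.
by rewrite (cvg_shiftS v) in c4.
Qed.

(** * Flows and their time integrals *)

Section SectionIntegrals.
Context (R : realType) d (T : measurableType d).
Variable mu : {finite_measure set T -> \bar R}.
Local Notation lam := (@lebesgue_measure R).
Local Notation RT := (measurableTypeR R * T)%type.

Section Tonelli.
Local Open Scope ereal_scope.
Variables (D : set (measurableTypeR R)) (h : RT -> \bar R).
Hypothesis mD : measurable D.
Hypothesis hm : measurable_fun setT h.
Hypothesis h0 : forall p, 0 <= h p.

Let k (p : RT) := (h \_ (D `*` setT)) p.

Let km : measurable_fun setT k.
Proof.
apply/(measurable_restrictT h); first exact: measurableX.
exact: measurable_funS hm.
Qed.

Let k0 p : 0 <= k p.
Proof. by rewrite /k patchE; case: ifP. Qed.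

Let kE w : \int[lam]_t k (t, w) = \int[lam]_(t in D) h (t, w).
Proof.
rewrite [RHS]integral_mkcond; apply: eq_integral => t _; rewrite /k !patchE.
by congr (if _ then _ else _); apply/idP/idP => /set_mem H; apply/mem_set => //; case: H.
Qed.

Lemma measurable_section_integral : measurable_fun setT (fun w => \int[lam]_(t in D) h (t, w)).
Proof.
have := measurable_fun_fubini_tonelli_G (m1 := lam) k km k0.
by congr measurable_fun; apply/funext => w; rewrite /fubini_G kE.
Qed.

Lemma measurable_slice_integral : measurable_fun setT (fun t => \int[mu]_w h (t, w)).
Proof. exact: (measurable_fun_fubini_tonelli_F (m2 := mu) h hm h0). Qed.

Lemma section_tonelli :
  \int[mu]_w \int[lam]_(t in D) h (t, w) = \int[lam]_(t in D) \int[mu]_w h (t, w).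
Proof.
have := fubini_tonelli (m1 := lam) (m2 := mu) k km k0; rewrite /fubini_F /fubini_G.
under [RHS]eq_integral do rewrite kE; move=> <-.
rewrite [RHS]integral_mkcond; apply: eq_integral => t _; rewrite patchE.
case: ifPn => [/set_mem Dt|/negP nD].
  by apply: eq_integral => w _; rewrite /k patchE mem_set.
apply: integral0_eq => w _; rewrite /k patchE memNset// => -[Dt _].
by apply: nD; exact: mem_set.
Qed.

(** Tonelli's theorem exchanges a null set for each time [t] for a single null set of [w], outside
    of which [h] vanishes at almost all times. *)
Lemma ae_section : (forall t, D t -> {ae mu, forall w, h (t, w) = 0}) ->
  {ae mu, forall w, \int[lam]_(t in D) h (t, w) = 0}.
Proof.
move=> hD; have I0 : \int[mu]_w `|\int[lam]_(t in D) h (t, w)| = 0.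
  under eq_integral do rewrite gee0_abs ?integral_ge0//.
  rewrite section_tonelli; apply: integral0_eq => t Dt.
  apply/eqP; rewrite -(eqP (_ : \int[mu]_w (cst 0%E w) == 0)); last first.
    by rewrite integral0.
  apply/eqP; apply: ae_eq_integral => //.
    exact: (measurable_fun_pair2 t hm).
  by apply: filterS (hD t Dt) => w ->.
have := (ae_eq_integral_abs mu measurableT measurable_section_integral).1 I0.
by apply: filterS => w; exact.
Qed.

End Tonelli.

Section Vector.
Variable X : completeNormedModType R.
Hypothesis X_separable : separable X.
Variable J : RT -> X.
Hypothesis Jm : dmeas J.

Lemma dmeas_slice t : dmeas (fun w => J (t, w)).
Proof. by move=> l lX; exact: (measurable_fun_pair2 t (Jm lX)). Qed.

Lemma dmeas_section w : dmeas (fun t => J (t, w)).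
Proof. by move=> l lX; exact: (measurable_fun_pair1 w (Jm lX)). Qed.

Definition section_integral (D : set (measurableTypeR R)) (w : T) : X :=
  bochner_integral lam D (fun t => J (t, w)).

Lemma measurable_section_nrm D : measurable D ->
  measurable_fun setT (fun w => nrm lam D (fun t => J (t, w))).
Proof.
move=> mD; apply: (@measurable_section_integral D (fun p => (`|J p|)%:E)) => //.
exact: (measurable_EFin_norm X_separable Jm).
Qed.

(** Outside the measurable set [G] of integrable sections the Bochner integral takes its default
    value 0, so the function is defined and measurable everywhere. *)
Lemma dmeas_section_integral D : measurable D -> dmeas (section_integral D).
Proof.
move=> mD l lX; pose G := [set w | (nrm lam D (fun t => J (t, w)) < +oo)%E].
have mG : measurable G.
  have := measurable_fun_lte (measurable_section_nrm mD) (measurable_cst (+oo : \bar R)%E).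
  by move=> /(_ measurableT [set true]); rewrite setTI; exact.
have -> : l \o section_integral D = fun w => if w \in G then
    fine (\int[lam]_(t in D) (l (J (t, w)))%:E)%E else 0.
  apply/funext => w /=; case: ifPn => [/set_mem Gw|/negP nG].
    by rewrite (wint_bochner X_separable mD (dmeas_section w) Gw lX).
  rewrite /section_integral (bochner_integral_eq0 X_separable mD (dmeas_section w)) ?dual0//.
  by move=> Gw; apply: nG; exact: mem_set.
apply: measurable_fun_ifT => //.
  by apply: (measurable_fun_bool true); rewrite setTI preimage_mem_true.
have lm : measurable_fun setT (EFin \o (l \o J)) by apply/measurable_EFinP; exact: Jm.
apply: measurableT_comp; first exact: fine_measurable.
under eq_fun do rewrite integralE.
apply: emeasurable_funB.
- have := measurable_section_integral mD (measurable_funepos lm) (fun p => funepos_ge0 _ p).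
  by congr measurable_fun; apply/funext => w; apply: eq_integral => t _; rewrite !funeposE.
- have := measurable_section_integral mD (measurable_funeneg lm) (fun p => funeneg_ge0 _ p).
  by congr measurable_fun; apply/funext => w; apply: eq_integral => t _; rewrite !funenegE.
Qed.

Lemma section_integral_bound D w : measurable D ->
  (`|section_integral D w|%:E <= nrm lam D (fun t => J (t, w)))%E.
Proof.
move=> mD; have [foo|foo] := pselect ((nrm lam D (fun t => J (t, w)) < +oo)%E).
  apply: (wint_bound X_separable mD (dmeas_section w)).
  exact: (wint_bochner X_separable mD (dmeas_section w) foo).
rewrite /section_integral (bochner_integral_eq0 X_separable mD (dmeas_section w) foo).
by rewrite normr0; exact: nrm_ge0.
Qed.

Lemma nrm_section_integral D : measurable D ->
  (nrm mu setT (section_integral D) <= \int[lam]_(t in D) nrm mu setT (fun w => J (t, w)))%E.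
Proof.
move=> mD; have Jn := measurable_EFin_norm X_separable Jm (D := setT).
rewrite -(section_tonelli mD Jn) => [|p]; last by rewrite lee_fin.
apply: ge0_le_integral => //.
- exact: (measurable_EFin_norm X_separable (dmeas_section_integral mD)).
- exact: measurable_section_nrm.
- by move=> w _; exact: section_integral_bound.
Qed.

End Vector.
End SectionIntegrals.

(** * Jointly measurable representation of an orbit *)

Section JointRepresentation.
Context (R : realType) (X : completeNormedModType R).
Hypothesis X_separable : separable X.
Context d (T : measurableType d).
Variable mu : {finite_measure set T -> \bar R}.
Local Notation RT := (measurableTypeR R * T)%type.

Lemma dmeas_select (r : measurableTypeR R -> nat) (h : nat -> T -> X) :
  (forall i, measurable [set t | r t = i]) -> (forall i, dmeas (h i)) ->
  dmeas (fun p : RT => h (r p.1) p.2).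
Proof.
move=> rm hm l lX _ B mB; rewrite setTI.
rewrite (_ : _ @^-1` _ = \bigcup_i ([set t | r t = i] `*` ((l \o h i) @^-1` B))).
  apply: bigcupT_measurable => i; apply: measurableX => //.
  by have := hm i l lX measurableT B mB; rewrite setTI.
apply/seteqP; split=> [[t w] /= Bw|[t w] [i _ [/= <-]]//].
by exists (r t).
Qed.

Variable U : R -> (T -> X) -> (T -> X).
Hypothesis U_sg : strongly_continuous_semigroup mu U.
Variable f : T -> X.
Hypothesis fL : L1 mu f.

Lemma semigroup_L1 (t : R) : 0 <= t -> L1 mu (U t f).
Proof. by case: U_sg => h _ _ _ /h[h' _ _]; exact: h'. Qed.

Lemma semigroup_cvg (t e : R) : 0 < t -> 0 < e ->
  \forall s \near t, (nrm mu setT (fun w => U s f w - U t f w)%R < e%:E)%E.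
Proof.
move=> t0 e0; have [_ _ _ /(_ f t fL t0) h] := U_sg.
have {}h : nrm mu setT (fun w => U s f w - U t f w)%R @[s --> t] --> 0%E.
  by move: h; under eq_fun do rewrite Lnorm1_nrm.
by move/cvge0P : h; apply => // s; exact: nrm_ge0.
Qed.

(** For each [k] the half-line is partitioned into countably many measurable pieces, on the i-th of
    which [U t f] is replaced by [U (q i) f] with an L1 error below [2^-1 ^+ k]; strong continuity
    makes rational times sufficient. The limit is taken on the product space, and at each fixed [t]
    the rate identifies it with [U t f] almost everywhere. *)
Lemma joint_representation_exists : exists g, is_joint_representation mu U f g.
Proof.
pose q_ (i : nat) : R := ratr (odflt (1 : rat) (choice.unpickle i)).
(* An enumeration of the positive rationals, where all other codes stand for 1. *)
pose q i : R := if 0 < q_ i then q_ i else 1.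
have q0 i : 0 < q i by rewrite /q; case: ifP.
have UL (t : R) : 0 < t -> L1 mu (U t f) by move=> /ltW; exact: semigroup_L1.
have Ud (t : R) : 0 < t -> dmeas (U t f) by move=> /UL; exact: L1_dmeas.
pose A k i : set R := [set t | 0 < t /\
  (nrm mu setT (fun w => U (q i) f w - U t f w)%R < (2^-1 ^+ k)%:E)%E].
have mA k i : measurable (A k i : set (measurableTypeR R)).
  apply: open_measurable; rewrite openE => t [t0 h].
  have [e e0 he] : exists2 e : R, 0 < e & (nrm mu setT (fun w => U (q i) f w - U t f w)%R +
      e%:E < (2^-1 ^+ k)%:E)%E.
    move: h (nrm_ge0 mu setT (fun w => U (q i) f w - U t f w)%R).
    case: (nrm _ _ _) => [a| |]//; rewrite lte_fin => h _.
    exists ((2^-1 ^+ k - a) / 2); first by rewrite divr_gt0// subr_gt0.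
    by rewrite -EFinD lte_fin; lra.
  have h1 := semigroup_cvg t0 e0.
  have h2 : \forall s \near t, 0 < s by exact: lt_nbhsr.
  near=> s; have s0 : 0 < s by near: s.
  split=> //; apply: le_lt_trans he.
  apply: le_trans (nrm_dist_trans _ X_separable measurableT (Ud _ (q0 i)) (Ud _ t0) (Ud _ s0)) _.
  rewrite leeD2l// nrm_distC ltW//; near: s; exact: h1.
have cov k (t : R) : 0 < t -> exists i, A k i t.
  move=> t0; have := semigroup_cvg t0 (half_pow_gt0 R k).
  have h2 : \forall s \near t, 0 < s by exact: lt_nbhsr.
  move=> /(filterI h2)/nbhs_ballP[e /= e0 he].
  have te : t < t + e by rewrite ltrDl.
  have [r] := rat_in_itvoo te; rewrite in_itv/= => /andP[tr re].
  have [|r0 hr] := he (ratr r); first by rewrite -ball_normE/= distrC gtr0_norm ?subr_gt0// ltrBlDl.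
  by exists (choice.pickle r); split=> //; rewrite /q /q_ choice.pickleK/= r0.
pose r k (t : R) := xget 0%N [set i | seqDU (A k) i t].
have rS k (t : R) : (exists i, seqDU (A k) i t) -> seqDU (A k) (r k t) t.
  by move=> h; exact: (@xgetPex _ 0%N [set i | seqDU (A k) i t] h).
have rP k (t : R) : 0 < t -> A k (r k t) t.
  move=> /(cov k)[i Ait]; have : (\bigcup_i seqDU (A k) i) t.
    by rewrite -seqDU_bigcup_eq; exists i.
  by move=> [j _ jt]; case: (rS k t (ex_intro _ j jt)).
have mD k i : measurable (seqDU (A k) i : set (measurableTypeR R)).
  by apply: measurableD => //; exact: bigsetU_measurable.
have rm k i : measurable ([set t | r k t = i] : set (measurableTypeR R)).
  have uniq t j : seqDU (A k) j t -> r k t = j.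
    move=> jt; have rt := rS k t (ex_intro _ j jt).
    by apply: (@trivIset_seqDU _ (A k)) => //; exists t.
  (* Index 0 is also the default value of [r k], so its level set contains in addition all times
     outside the cover. *)
  have [->|i0] := eqVneq i 0%N.
    rewrite (_ : [set _ | _] = seqDU (A k) 0%N `|` ~` \bigcup_j seqDU (A k) j).
      by apply: measurableU => //; apply: measurableC; exact: bigcupT_measurable.
    apply/seteqP; split=> [t /= rt|t [/uniq//|nt]] /=.
      have [[j _ jt]|] := pselect ((\bigcup_j seqDU (A k) j) t); last by right.
      by left; rewrite -rt (uniq _ _ jt).
    by rewrite /r; case: xgetP => // j _ jt; exfalso; apply: nt; exists j.
  rewrite (_ : [set _ | _] = seqDU (A k) i)//.
  apply/seteqP; split=> [t /= rt|t /uniq//].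
  move: i0 (rt); rewrite -rt {1 2}/r; case: xgetP => [j _ jt _ _|_]; last by rewrite eqxx.
  by rewrite (uniq _ _ jt).
pose g_ k (p : RT) := U (q (r k p.1)) f p.2.
have gm k : dmeas (g_ k) by apply: (dmeas_select (rm k) (fun i => Ud _ (q0 i))).
have [g gd gl] := dmeas_seqlim X_separable gm.
exists g; split; first exact: dmeas_strongly_measurable.
move=> t t0.
have gU : {ae mu, forall w, g_ k (t, w) @[k --> \oo] --> U t f w}.
  apply: (@ae_cvg_fast R _ T mu X X_separable (fun k w => g_ k (t, w)) (U t f) 1) => //.
  - by move=> k; exact: (Ud _ (q0 (r k t))).
  - exact: (Ud _ t0).
  - by move=> k; rewrite mul1r /g_ /=; have [_ h] := rP k t t0; exact: ltW h.
apply: filterS gU => w h _.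
have c : cvgn (fun k => g_ k (t, w)) by apply/cvg_ex; exists (U t f w).
have e1 := cvg_lim (@norm_hausdorff _ _) (gl (t, w) c).
have e2 := cvg_lim (@norm_hausdorff _ _) h.
by rewrite -e1 -e2.
Unshelve. all: by end_near. Qed.

End JointRepresentation.

(** * Time integrals of the flow *)

Section FlowIntegral.
Context (R : realType) (X : completeNormedModType R).
Hypothesis X_separable : separable X.
Context d (T : measurableType d).
Variable mu : {finite_measure set T -> \bar R}.
Local Notation lam := (@lebesgue_measure R).
Variable U : R -> (T -> X) -> (T -> X).
Hypothesis U_sg : strongly_continuous_semigroup mu U.
Hypothesis U_op : forall t : R, 0 <= t -> L1_Linf_contraction mu (U t).
Implicit Types f g : T -> X.
Local Notation J := (joint_representation mu U).

Local Notation itv a b := (`]a%R, b%R]%classic : set (measurableTypeR R)).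

Definition flow_integral f (a b : R) (w : T) : X :=
  bochner_integral lam (itv a b) (fun t => J f (t, w)).

(** At such points no time integral is the default value 0, so that additivity over intervals and
    the norm bounds hold for all [a] and [b] at once. *)
Definition good_section f w := forall a b : R, 0 <= a ->
  (nrm lam (itv a b) (fun t => J f (t, w)) < +oo)%E.

Lemma lebesgue_itv (a b : R) : a <= b -> lam (itv a b) = (b - a)%:E.
Proof.
move=> ab; rewrite lebesgue_measure_itv/= lte_fin; case: ltP => // ba.
by rewrite (@le_anti _ _ a b) ?ab// subrr.
Qed.

Lemma joint_dmeas f : L1 mu f -> dmeas (J f).
Proof.
move=> fL; have := xgetPex (fun=> 0) (joint_representation_exists X_separable U_sg fL).
by case=> h _; exact: strongly_measurable_dmeas.
Qed.

Lemma joint_slice f t : L1 mu f -> 0 < t -> {ae mu, forall w, J f (t, w) = U t f w}.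
Proof.
move=> fL t0; have := xgetPex (fun=> 0) (joint_representation_exists X_separable U_sg fL).
by case=> _ /(_ t t0); apply: filterS => w; exact.
Qed.

Lemma joint_slice_nrm f t : L1 mu f -> 0 < t ->
  (nrm mu setT (fun w => J f (t, w)) <= nrm mu setT f)%E.
Proof.
move=> fL t0; have Ut := U_op (ltW t0).
apply: le_trans (contr_nrm Ut fL); rewrite le_eqVlt; apply/orP; left; apply/eqP.
apply: (eq_nrm_ae X_separable measurableT (dmeas_slice (joint_dmeas fL) t)).
  exact: (L1_dmeas X_separable (contr_L1 Ut fL)).
by apply: filterS (joint_slice fL t0) => w ->.
Qed.

Lemma joint_integral_le f a b : L1 mu f -> 0 <= a -> a <= b ->
  (\int[lam]_(t in (itv a b)) nrm mu setT (fun w => J f (t, w)) <=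
   (b - a)%:E * nrm mu setT f)%E.
Proof.
move=> fL a0 ab; rewrite -(lebesgue_itv ab) muleC -integral_cst//.
apply: ge0_le_integral => //.
- by move=> t _; exact: nrm_ge0.
- apply: measurable_funTS.
  apply: (measurable_slice_integral mu (h := fun p => (`|J f p|)%:E)) => //.
  exact: (measurable_EFin_norm X_separable (joint_dmeas fL)).
- move=> t; rewrite /= in_itv/= => /andP[at' _]; apply: joint_slice_nrm => //.
  exact: le_lt_trans a0 at'.
Qed.

Lemma ae_good_section f : L1 mu f -> {ae mu, forall w, good_section f w}.
Proof.
move=> fL; have Jm := joint_dmeas fL.
have H : {ae mu, forall w n, (nrm lam (itv 0 n%:R) (fun t => J f (t, w)) < +oo)%E}.
  apply: ae_foralln => n; pose k w := nrm lam (itv 0 n%:R) (fun t => J f (t, w)).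
  have km : measurable_fun setT k by exact: measurable_section_nrm.
  have ki : mu.-integrable setT k.
    apply/integrableP; split=> //.
    under eq_integral do rewrite gee0_abs ?nrm_ge0//.
    rewrite /k (section_tonelli mu (h := fun p => (`|J f p|)%:E))//; last first.
      exact: (measurable_EFin_norm X_separable Jm).
    apply: le_lt_trans (joint_integral_le fL (lexx 0) (ler0n _ n)) _.
    by apply: lte_mul_pinfty => //; rewrite ?subr0 ?lee_fin//; exact: (L1_nrm X_separable).
  apply: filterS (integrable_ae measurableT ki) => w /(_ Logic.I).
  by rewrite ge0_fin_numE// nrm_ge0.
apply: filterS H => w H a b a0; have [b0|b0] := leP 0 b.
  have bn := archi_boundP b0.
  apply: le_lt_trans (H (Num.bound b)); apply: (nrm_subset X_separable) => //.
    move=> t /=; rewrite !in_itv/= => /andP[at' tb].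
    by rewrite (le_lt_trans a0 at') (le_trans tb (ltW bn)).
  exact: dmeas_section Jm w.
rewrite (_ : (itv a b) = set0) /nrm ?integral_set0//.
by rewrite set_itv_ge// bnd_simp -leNgt (le_trans (ltW b0)).
Qed.

Lemma good_wint f a b w : L1 mu f -> good_section f w -> 0 <= a ->
  wint lam (itv a b) (fun t => J f (t, w)) (flow_integral f a b w).
Proof.
move=> fL gw a0; apply: (wint_bochner X_separable) => //; last exact: gw.
exact: dmeas_section (joint_dmeas fL) w.
Qed.

Lemma flow_integralD f a b c w : L1 mu f -> good_section f w -> 0 <= a -> a <= b -> b <= c ->
  flow_integral f a c w = flow_integral f a b w + flow_integral f b c w.
Proof.
move=> fL gw a0 ab bc; apply: dual_separated => l lX; rewrite (dualD _ _ lX).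
rewrite (good_wint _ fL gw a0 lX) (good_wint _ fL gw a0 lX).
rewrite (good_wint _ fL gw (le_trans a0 ab) lX).
have Js := dmeas_section (joint_dmeas fL) w.
have mI : measurable (itv a c) by [].
have Ji := integrable_dual X_separable mI Js (gw a c a0) lX.
have := @Rintegral_itvB R (fun t => l (J f (t, w))) (BRight a) (BRight c) b Ji.
by rewrite !bnd_simp => /(_ ab bc) <-; rewrite addrC subrK.
Qed.

Lemma flow_integral_L1 f a b : L1 mu f -> 0 <= a -> a <= b ->
  L1 mu (flow_integral f a b) /\
  (nrm mu setT (flow_integral f a b) <= (b - a)%:E * nrm mu setT f)%E.
Proof.
move=> fL a0 ab; have Jm := joint_dmeas fL.
have mI : measurable (itv a b) by [].
have Im := dmeas_section_integral X_separable Jm mI.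
have h := le_trans (nrm_section_integral mu X_separable Jm mI) (joint_integral_le fL a0 ab).
split=> //; apply/(L1P X_separable _ _); split=> //; apply: le_lt_trans h _.
by apply: lte_mul_pinfty => //; rewrite ?lee_fin ?subr_ge0//; exact: (L1_nrm X_separable).
Qed.

End FlowIntegral.

(** * Riemann sums and the shift of time integrals *)

Section RiemannSums.
Context (R : realType) (X : completeNormedModType R).
Hypothesis X_separable : separable X.
Context d (T : measurableType d).
Variable mu : {finite_measure set T -> \bar R}.
Local Notation lam := (@lebesgue_measure R).
Local Notation RT := (measurableTypeR R * T)%type.
Variable U : R -> (T -> X) -> (T -> X).
Hypothesis U_sg : strongly_continuous_semigroup mu U.
Hypothesis U_op : forall t : R, 0 <= t -> L1_Linf_contraction mu (U t).
Implicit Types f g : T -> X.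
Local Notation J := (joint_representation mu U).
Local Notation itv a b := (`]a%R, b%R]%classic : set (measurableTypeR R)).

Lemma L1_sum n (c : R) (F : 'I_n -> T -> X) : (forall i, L1 mu (F i)) ->
  L1 mu (fun w => \sum_(i < n) c *: F i w).
Proof.
move=> FL; elim: n F FL => [|n IH] F FL.
  by under eq_fun do rewrite big_ord0; exact: (L1_cst X_separable).
under eq_fun do rewrite big_ord_recl addrC; under eq_fun do rewrite addrC.
by apply: (L1_lin X_separable); [exact: FL|exact: IH].
Qed.

Lemma contr_sum V n (c : R) (F : 'I_n -> T -> X) : L1_Linf_contraction mu V ->
  (forall i, L1 mu (F i)) ->
  {ae mu, forall w, V (fun w => \sum_(i < n) c *: F i w) w = \sum_(i < n) c *: V (F i) w}.
Proof.
move=> V_op FL; elim: n F FL => [|n IH] F FL.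
  have L0 := L1_cst X_separable mu (0 : X).
  apply: filterS (contrB V_op L0 L0) => w /=.
  under [in LHS]eq_fun do rewrite subrr.
  rewrite (_ : (fun=> \sum_(i < 0) _) = fun=> 0); last by apply/funext => v; rewrite big_ord0.
  by move=> ->; rewrite subrr big_ord0.
have E : (fun w => \sum_(i < n.+1) c *: F i w) =
    (fun w => c *: F ord0 w + \sum_(i < n) c *: F (lift ord0 i) w).
  by apply/funext => w; rewrite big_ord_recl.
have GL : L1 mu (fun w => \sum_(i < n) c *: F (lift ord0 i) w) by apply: L1_sum.
apply: filterS2 (IH _ (fun i => FL (lift ord0 i))) (contr_lin V_op c (FL ord0) GL) => w h1 h2.
by rewrite E h2 h1 big_ord_recl.
Qed.

Section Sums.
Variables (f : T -> X) (a : R).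
Hypothesis fL : L1 mu f.
Hypothesis a0 : 0 <= a.

Definition mesh n i : R := a + i%:R / n.+1%:R.

Lemma mesh_gt0 n i : (0 < i)%N -> 0 < mesh n i.
Proof. by move=> i0; rewrite ltr_wpDl// divr_gt0// ltr0n. Qed.

(** Right endpoints keep all times positive even for [a = 0]: the semigroup law and strong
    continuity are given at positive times. *)
Definition riemann_sum n w := \sum_(i < n.+1) n.+1%:R^-1 *: U (mesh n i.+1) f w.

Let step n (p : RT) :=
  \sum_(i < n.+1) \1_(itv (mesh n i) (mesh n i.+1)) p.1 *: U (mesh n i.+1) f p.2.

Let UL n i : L1 mu (U (mesh n i.+1) f).
Proof. exact: (contr_L1 (U_op (ltW (mesh_gt0 n (ltn0Sn i)))) fL). Qed.

Let step_dmeas n : dmeas (step n).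
Proof.
apply: dmeas_sum => i _; apply: dmeasZf.
  apply: measurableT_comp (measurable_fst) => //; exact: measurable_indic.
by move=> l lX; apply: measurableT_comp (L1_dmeas X_separable (UL n i) lX) measurable_snd.
Qed.

Let mesh_le n i j : (i <= j)%N -> mesh n i <= mesh n j.
Proof. by move=> ij; rewrite lerD2l ler_pM2r ?invr_gt0// ler_nat. Qed.

Let stepE n t : itv a (a + 1) t -> exists c, [/\ t <= c, c - t <= n.+1%:R^-1 &
  forall w, step n (t, w) = U c f w].
Proof.
rewrite /= in_itv/= => /andP[at' t1].
have meshn : mesh n n.+1 = a + 1 by rewrite /mesh divff.
have ex : exists i, t <= mesh n i.+1 by exists n; rewrite meshn.
pose i := ex_minn ex; have [ti imin] : t <= mesh n i.+1 /\ forall j, t <= mesh n j.+1 -> (i <= j)%N.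
  by rewrite /i; case: ex_minnP.
have ii : (i < n.+1)%N by rewrite ltnS imin// meshn.
have it' : mesh n i < t.
  have [->|i0] := posnP i; first by rewrite /mesh mul0r addr0.
  rewrite ltNge; apply/negP => h; have := imin i.-1; rewrite prednK// => /(_ h).
  by rewrite leqNgt prednK// leqnn.
exists (mesh n i.+1); split=> // [|w].
  apply: le_trans (_ : mesh n i.+1 - mesh n i <= _); first by rewrite lerB// ltW.
  by rewrite /mesh opprD addrACA subrr add0r -mulrBl -natrB// subSnn mul1r.
rewrite /step (bigD1 (Ordinal ii))//= big1 ?addr0.
  by rewrite indicE mem_set ?scale1r//= in_itv/= it'.
move=> j ji; rewrite indicE memNset ?scale0r//= in_itv/= => /andP[jt tj].
have ij := imin _ tj; move: ji; rewrite -val_eqE/= neq_ltn => /orP[ji|ij'].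
  by move: ij; rewrite leqNgt ji.
by have := le_lt_trans (mesh_le n ij') jt; rewrite ltNge ti.
Qed.

Let step_wint n w : wint lam (itv a (a + 1)) (fun t => step n (t, w)) (riemann_sum n w) /\
  (nrm lam (itv a (a + 1)) (fun t => step n (t, w)) < +oo)%E.
Proof.
pose D := itv a (a + 1); have mD : measurable D by exact: measurable_itv.
pose A i := itv (mesh n i) (mesh n i.+1); pose x i := U (mesh n i.+1) f w.
have mA i : measurable (A i) by exact: measurable_itv.
have lD : lam D = 1%:E.
  by rewrite /D lebesgue_itv ?lerDl// addrC addKr.
have lA i : (i < n.+1)%N -> lam (A i `&` D) = (n.+1%:R^-1)%:E.
  move=> ii; rewrite setIidl.
    rewrite /A lebesgue_itv ?mesh_le//.
    by rewrite /mesh opprD addrACA subrr add0r -mulrBl -natrB// subSnn mul1r.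
  move=> t; rewrite /A /D /= !in_itv/= => /andP[t1 t2]; apply/andP; split.
    by apply: le_lt_trans t1; rewrite lerDl.
  apply: le_trans t2 _; rewrite lerD2l ler_pdivrMr ?ltr0n// mul1r ler_nat//.
have EA i (y : R) : (i < n.+1)%N -> \int[lam]_(t in D) (\1_(A i) t * y) = n.+1%:R^-1 * y.
  move=> ii; rewrite RintegralZr//; last first.
    have := integrable_indic_itv (mesh n i) (mesh n i.+1) false false.
    exact: integrableS.
  rewrite /Rintegral integral_indic//; congr (_ * _); exact: (congr1 fine (lA i ii)).
have em i : dmeas (fun t => \1_(A i) t *: x i).
  by apply: dmeasZf; [exact: measurable_indic|exact: dmeas_cst].
have ei i : (nrm lam D (fun t => \1_(A i) t *: x i) < +oo)%E.
  apply: (@le_lt_trans _ _ (nrm lam D (fun=> x i))).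
    apply: (le_nrm_ae X_separable mD (em i)); first exact: measurable_cst.
    apply: aeW => t _; rewrite normrZ indicE; case: (_ \in _) => /=.
      by rewrite normr1 mul1r.
    by rewrite normr0 mul0r.
  rewrite /nrm integral_cst//; apply: lte_mul_pinfty => //.
  exact: (eq_ind_r (fun z => z < +oo)%E (ltry 1) lD).
split.
  move=> l lX; rewrite /riemann_sum (dual_sum _ _ _ lX).
  under [RHS]eq_Rintegral do rewrite /step (dual_sum _ _ _ lX).
  rewrite Rintegral_sum//; last first.
    by move=> i; exact: (integrable_dual X_separable mD (em i) (ei i) lX).
  apply: eq_bigr => i _; rewrite (dualZ _ _ lX).
  under [RHS]eq_Rintegral do rewrite (dualZ _ _ lX).
  exact: (esym (EA i _ (ltn_ord i))).
apply: le_lt_trans (nrm_sum _ X_separable mD (index_enum 'I_n.+1) (fun i : 'I_n.+1 => em i)) _.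
by apply: lte_sum_pinfty => i _; exact: ei.
Qed.

(** The sum is the time integral of a step function, so the error is at most the integral over [t]
    of the L1 norm of [U c f - U t f], with [c] at most [1 / (n + 1)] to the right of [t]. It
    vanishes pointwise by strong continuity and is dominated by twice the norm of [f]. *)
Lemma riemann_sum_cvg :
  nrm mu setT (fun w => flow_integral mu U f a (a + 1) w - riemann_sum n w)%R @[n --> \oo] --> 0%E.
Proof.
have mI : measurable (itv a (a + 1)) by [].
have Jm := joint_dmeas X_separable U_sg fL.
pose h n t := nrm mu setT (fun w => J f (t, w) - step n (t, w)).
have dm n : dmeas (fun p => J f p - step n p) by exact: dmeasB.
have hm n : measurable_fun (itv a (a + 1)) (h n).
  apply: measurable_funTS.
  apply: (measurable_slice_integral mu (h := fun p => (`|J f p - step n p|)%:E)) => //.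
  exact: (measurable_EFin_norm X_separable (dm n)).
have nh n : (nrm mu setT (fun w => flow_integral mu U f a (a + 1) w - riemann_sum n w)%R <=
    \int[lam]_(t in itv a (a + 1)) h n t)%E.
  rewrite /h -(section_tonelli mu (h := fun p => (`|J f p - step n p|)%:E))//; last first.
    exact: (measurable_EFin_norm X_separable (dm n)).
  have IL := (flow_integral_L1 X_separable U_sg U_op fL a0 (_ : a <= a + 1)).1.
  have Im := L1_dmeas X_separable (IL _); have Rm : dmeas (riemann_sum n).
    by apply: (L1_dmeas X_separable (mu := mu)); apply: L1_sum => i; exact: UL.
  apply: ae_ge0_le_integral => //.
  - apply: (measurable_EFin_norm X_separable); apply: dmeasB Rm; apply: Im; by rewrite lerDl.
  - by move=> w _; apply: integral_ge0 => t _; rewrite lee_fin.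
  - exact: (measurable_section_nrm X_separable (dm n) mI).
  apply: filterS (ae_good_section X_separable U_sg U_op fL) => w gw _.
  have [sw soo] := step_wint n w.
  apply: (wint_dist_bound X_separable mI) => //.
  - exact: dmeas_section.
  - exact: (dmeas_section (step_dmeas n)).
  - exact: gw.
  - exact: good_wint.
have t0 t : itv a (a + 1) t -> 0 < t.
  by rewrite /= in_itv/= => /andP[at' _]; exact: le_lt_trans at'.
have hU n t : itv a (a + 1) t -> exists c, [/\ t <= c, c - t <= n.+1%:R^-1 &
    h n t = nrm mu setT (fun w => U c f w - U t f w)].
  move=> tI; have [c [tc ct cE]] := stepE n tI; exists c; split=> //.
  have c0 : 0 <= c by apply: le_trans tc; exact: ltW (t0 _ tI).
  have mc := L1_dmeas X_separable (contr_L1 (U_op c0) fL).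
  have mt := L1_dmeas X_separable (contr_L1 (U_op (ltW (t0 _ tI))) fL).
  rewrite nrm_distC; apply: (eq_nrm_ae X_separable measurableT).
  - exact: dmeas_slice (dm n) t.
  - exact: dmeasB.
  - by apply: filterS (joint_slice X_separable U_sg fL (t0 _ tI)) => w e _; rewrite e cE.
have hle n t : itv a (a + 1) t -> (h n t <= nrm mu setT f + nrm mu setT f)%E.
  move=> tI; have [c [tc _ ->]] := hU n t tI.
  have c0 : 0 <= c by apply: le_trans tc; exact: ltW (t0 _ tI).
  have oc := U_op c0; have ot := U_op (ltW (t0 _ tI)).
  apply: le_trans (nrmB _ X_separable measurableT (L1_dmeas X_separable (contr_L1 oc fL))
    (L1_dmeas X_separable (contr_L1 ot fL))) _.
  by apply: leeD; [exact: contr_nrm oc _ fL|exact: contr_nrm ot _ fL].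
have h0 t : itv a (a + 1) t -> h n t @[n --> \oo] --> 0%E.
  move=> tI; apply/cvge0P => [n|e e0]; first exact: nrm_ge0.
  have /nbhs_ballP[r /= r0 rP] := semigroup_cvg U_sg fL (t0 _ tI) e0.
  near=> n; have [c [tc ct ->]] := hU n t tI; apply: rP.
  rewrite -ball_normE/= distrC ger0_norm ?subr_ge0//; apply: le_lt_trans ct _.
  near: n; exact: (near_infty_natSinv_lt (PosNum r0)).
have fi : (nrm mu setT f + nrm mu setT f)%E \is a fin_num.
  by rewrite fin_numD -(nrm1K X_separable fL).
have [||||| _ _ c3] := @dominated_convergence _ _ R lam (itv a (a + 1)) mI h (cst 0%E)
    (cst (nrm mu setT f + nrm mu setT f)%E).
- exact: hm.
- exact: measurable_cst.
- by apply: aeW => t; exact: h0.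
- apply/integrableP; split=> //; rewrite integral_cst//= lebesgue_itv ?lerDl//.
  by rewrite lte_mul_pinfty// ?abse_ge0 ?abse_fin_num// ltry.
- by apply: aeW => t n tI; rewrite gee0_abs ?nrm_ge0//; exact: hle.
rewrite integral_cst// mul0e in c3.
move/cvge0P : c3 => c3; apply/cvge0P => [n|e e0]; first exact: nrm_ge0.
apply: filterS (c3 _ e e0) => [n|n]; first by apply: le_lt_trans; exact: nh.
by apply: integral_ge0 => t _; exact: nrm_ge0.
Unshelve. all: by end_near. Qed.

End Sums.

Lemma flow_shift f (a s : R) : L1 mu f -> 0 <= a -> 0 < s ->
  {ae mu, forall w, U s (flow_integral mu U f a (a + 1)) w =
    flow_integral mu U f (a + s) (a + s + 1) w}.
Proof.
move=> fL a0 s0; have as0 : 0 <= a + s by rewrite addr_ge0// ltW.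
have a1 : a <= a + 1 by rewrite lerDl.
have as1 : a + s <= a + s + 1 by rewrite lerDl.
have [IL _] := flow_integral_L1 X_separable U_sg U_op fL a0 a1.
have [IL' _] := flow_integral_L1 X_separable U_sg U_op fL as0 as1.
have s_op := U_op (ltW s0); have UIL := contr_L1 s_op IL.
have ML b n i : 0 <= b -> L1 mu (U (mesh b n (lift ord0 i)) f).
  move=> b0; exact: (contr_L1 (U_op (ltW (mesh_gt0 b0 n (ltn0Sn i)))) fL).
have c1 := riemann_sum_cvg fL a0; have c2 := riemann_sum_cvg fL as0.
pose Rs b n := riemann_sum f b n.
have RL b n : 0 <= b -> L1 mu (Rs b n).
  by move=> b0; apply: L1_sum => i; exact: (contr_L1 (U_op (ltW (mesh_gt0 b0 n (ltn0Sn i)))) fL).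
have URs n : {ae mu, forall w, U s (Rs a n) w = Rs (a + s) n w}.
  have FL i : L1 mu (U (mesh a n (i : 'I_n.+1).+1) f).
    exact: (contr_L1 (U_op (ltW (mesh_gt0 a0 n (ltn0Sn i)))) fL).
  have h1 := contr_sum n.+1%:R^-1 s_op FL.
  have h2 : {ae mu, forall w, forall i : 'I_n.+1,
      U s (U (mesh a n i.+1) f) w = U (mesh (a + s) n i.+1) f w}.
    apply: ae_forall_count => i; have [_ _ sg _] := U_sg.
    apply: filterS (sg s (mesh a n i.+1) f s0 (mesh_gt0 a0 n (ltn0Sn i)) fL) => w -> //.
    by rewrite /mesh addrA [s + a]addrC.
  by apply: filterS2 h1 h2 => w e1 e2; rewrite e1; apply: eq_bigr => i _; rewrite e2.
have Dm := L1_dmeas X_separable.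
have le n : (nrm mu setT (fun w => U s (flow_integral mu U f a (a + 1)) w -
    flow_integral mu U f (a + s) (a + s + 1) w)%R <=
    nrm mu setT (fun w => flow_integral mu U f a (a + 1) w - Rs a n w)%R +
    nrm mu setT (fun w => flow_integral mu U f (a + s) (a + s + 1) w - Rs (a + s) n w)%R)%E.
  have RLa := RL a n a0; have RLs := RL (a + s) n as0.
  have URL := contr_L1 s_op RLa.
  apply: le_trans (nrm_dist_trans _ X_separable measurableT (Dm _ _ _ _ UIL) (Dm _ _ _ _ URL) (Dm _ _ _ _ IL')) _.
  apply: leeD; first exact: contr_nrm_dist.
  rewrite nrm_distC le_eqVlt; apply/orP; left; apply/eqP.
  apply: (eq_nrm_ae X_separable measurableT).
  - exact: dmeasB (Dm _ _ _ _ IL') (Dm _ _ _ _ URL).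
  - exact: dmeasB (Dm _ _ _ _ IL') (Dm _ _ _ _ RLs).
  - by apply: filterS (URs n) => w -> _.
have z : (nrm mu setT (fun w => U s (flow_integral mu U f a (a + 1)) w -
    flow_integral mu U f (a + s) (a + s + 1) w)%R <= 0)%E.
  apply/lee_addgt0Pr => e e0; rewrite add0e; have e2 : 0 < e / 2 by rewrite divr_gt0.
  move/cvge0P : c1 => /(_ (fun n => nrm_ge0 _ _ _) _ e2) c1.
  move/cvge0P : c2 => /(_ (fun n => nrm_ge0 _ _ _) _ e2) c2.
  near \oo => n; apply: le_trans (le n) _; rewrite [e]splitr EFinD.
  by apply: leeD; apply: ltW; near: n.
apply: filterS (nrm_le0_ae X_separable (Dm _ _ _ _ (L1B X_separable UIL IL')) z) => w /eqP.
by rewrite subr_eq0 => /eqP.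
Unshelve. all: by end_near. Qed.

End RiemannSums.

Section FlowIteration.
Context (R : realType) (X : completeNormedModType R).
Hypothesis X_separable : separable X.
Context d (T : measurableType d).
Variable mu : {finite_measure set T -> \bar R}.
Variable U : R -> (T -> X) -> (T -> X).
Hypothesis U_sg : strongly_continuous_semigroup mu U.
Hypothesis U_op : forall t : R, 0 <= t -> L1_Linf_contraction mu (U t).
Variable f : T -> X.
Hypothesis fL : L1 mu f.
Local Notation I := (flow_integral mu U f).

Lemma flow_integral_unit_L1 n : L1 mu (I n%:R (n%:R + 1)).
Proof. by apply: (flow_integral_L1 X_separable U_sg U_op fL _ _).1; rewrite ?lerDl. Qed.

Lemma flow_iter : {ae mu, forall w n, iter n (U 1) (I 0 1) w = I n%:R (n%:R + 1) w}.
Proof.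
have U1 := U_op ler01.
have I01 : L1 mu (I 0 1) by have := flow_integral_unit_L1 0; rewrite add0r.
apply: ae_foralln; elim=> [|n IH]; first by apply: aeW => w; rewrite add0r.
have := contr_ae U1 (iter_L1 U1 n I01) (flow_integral_unit_L1 n) IH.
apply: filterS2 (flow_shift X_separable U_sg U_op fL (ler0n R n) ltr01) => w e1 e2.
by rewrite iterS e2 e1 -natr1.
Qed.

Lemma flow_integralxx a w : good_section mu U f w -> 0 <= a -> I a a w = 0.
Proof.
move=> gw a0; have := flow_integralD X_separable U_sg fL gw a0 (lexx a) (lexx a).
by move=> /eqP; rewrite -[X in X == _]addr0 (inj_eq (addrI _)) eq_sym => /eqP.
Qed.

Lemma flow_partial_sum : {ae mu, forall w n, partial_sum (U 1) (I 0 1) n w = I 0 n%:R w}.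
Proof.
have U1 := U_op ler01.
have I01 : L1 mu (I 0 1) by have := flow_integral_unit_L1 0; rewrite add0r.
have H : {ae mu, forall w n, partial_sum (U 1) (I 0 1) n.+1 w =
    partial_sum (U 1) (I 0 1) n w + iter n (U 1) (I 0 1) w}.
  by apply: ae_foralln => n; exact: partial_sumSr.
apply: filterS3 (ae_good_section X_separable U_sg U_op fL) flow_iter H => w gw h1 h2.
elim=> [|n IH]; first by rewrite flow_integralxx.
rewrite h2 IH h1 -natr1 -flow_integralD// ?lerDl//.
Qed.

End FlowIteration.

(** * Comparison with the dominating flow *)

Section FlowDomination.
Context (R : realType) (X : completeNormedModType R).
Hypothesis X_separable : separable X.
Context d (T : measurableType d).
Variable mu : {finite_measure set T -> \bar R}.
Local Notation lam := (@lebesgue_measure R).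
Local Notation RT := (measurableTypeR R * T)%type.
Local Notation X_sep := (separable_real R).
Local Notation itv a b := (`]a%R, b%R]%classic : set (measurableTypeR R)).
Variable U : R -> (T -> X) -> (T -> X).
Hypothesis U_sg : strongly_continuous_semigroup mu U.
Hypothesis U_op : forall t : R, 0 <= t -> L1_Linf_contraction mu (U t).
Variable P : R -> (T -> R^o) -> (T -> R^o).
Hypothesis P_sg : strongly_continuous_semigroup mu P.
Hypothesis P_op : forall t : R, 0 <= t -> L1_Linf_contraction mu (P t).
Hypothesis P_pos : forall (t : R) (u : T -> R^o), 0 <= t -> L1 mu u ->
  {ae mu, forall w, 0 <= u w} -> {ae mu, forall w, 0 <= P t u w}.
Hypothesis UP : positively_dominated mu U P.
Implicit Types (f g : T -> X) (u : T -> R^o).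
Local Notation JP := (joint_representation mu P).

(** The hypothesis has a null set for each time. The excess of [|K|] over the bound is integrated in
    time and vanishes by [ae_section], which leaves one null set of [w] for all intervals. *)
Lemma section_domination (K : RT -> X) u (C : R) : dmeas K -> L1 mu u ->
  (forall t : R, 0 < t -> {ae mu, forall w, `|K (t, w)| <= C + JP u (t, w)}) ->
  {ae mu, forall w a b, 0 <= a -> a <= b ->
    (nrm lam (itv a b) (fun t => K (t, w)) <=
     (C * (b - a) + flow_integral mu P u a b w)%:E)%E}.
Proof.
move=> Km uL KP; have Jm := joint_dmeas X_sep P_sg uL.
pose h p := (Num.max 0 (`|K p| - (C + (JP u p : R))))%:E.
have hm : measurable_fun setT h.
  apply/measurable_EFinP; apply: measurable_maxr => //; apply: measurable_funB.
    exact: (measurable_norm_dmeas X_separable Km).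
  by apply: measurable_funD => //; exact/dmeas_real.
have h0 p : (0 <= h p)%E by rewrite lee_fin le_max lexx.
have mD : measurable (`]0, +oo[%classic : set (measurableTypeR R)) by [].
have H := ae_section (mu := mu) mD hm h0.
have {}H : {ae mu, forall w, (\int[lam]_(t in `]0%R, +oo[%classic) h (t, w))%E = 0%E}.
  apply: H => t; rewrite /= in_itv/= andbT => /KP; apply: filterS => w hw.
  by rewrite /h max_l// subr_le0.
apply: filterS2 H (ae_good_section X_sep P_sg P_op uL) => w hw gw a b a0 ab.
have hs : measurable_fun setT (fun t => h (t, w)) by exact: (measurable_fun_pair1 w hm).
have hI : (\int[lam]_(t in `]0%R, +oo[%classic) `|h (t, w)|)%E = 0%E.
  by rewrite -[RHS]hw; apply: eq_integral => t _; rewrite gee0_abs.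
have hae := (ae_eq_integral_abs lam mD (measurable_funTS hs)).1 hI.
have mI : measurable (itv a b) by [].
have Js := dmeas_section Jm w.
have Ji := integrable_dual X_sep mI Js (gw a b a0) (dual_id R).
have Ci : lam.-integrable (itv a b) (EFin \o (fun=> C)).
  apply/integrableP; split; first exact: measurable_cst.
  rewrite integral_cst//; apply: lte_mul_pinfty; rewrite ?abse_ge0 ?abse_fin_num//.
  exact: (eq_ind_r (fun z => z < +oo)%E (ltry _) (lebesgue_itv ab)).
have -> : (C * (b - a) + flow_integral mu P u a b w)%:E =
    (\int[lam]_(t in itv a b) (C + (JP u (t, w) : R))%:E)%E.
  rewrite EFinD (good_wint X_sep P_sg b uL gw a0 (dual_id R)) /= /Rintegral fineK; last first.
    exact: integrable_fin_num Ji.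
  under [RHS]eq_integral do rewrite EFinD.
  rewrite (integralD mI Ci Ji); congr (_ + _)%E; rewrite integral_cst// EFinM.
  by congr (_ * _)%E; rewrite [RHS](lebesgue_itv ab).
apply: (le_nrm_ae X_separable mI (dmeas_section Km w)).
  by apply: measurable_funD => //; exact/dmeas_real.
apply: filterS hae => t ht /=; rewrite in_itv/= => /andP[at' _].
have /ht[] : `]0, +oo[%classic t by rewrite /= in_itv/= andbT (le_lt_trans a0).
by move=> /max_idPl; rewrite subr_le0.
Qed.

Lemma flow_dominated f u : L1 mu f -> L1 mu u -> {ae mu, forall w, `|f w| <= u w} ->
  {ae mu, forall w a b, 0 <= a -> a <= b ->
    `|flow_integral mu U f a b w| <= flow_integral mu P u a b w}.
Proof.
move=> fL uL fu; have Jm := joint_dmeas X_separable U_sg fL.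
have H : {ae mu, forall w a b, 0 <= a -> a <= b ->
    (nrm lam (itv a b) (fun t => joint_representation mu U f (t, w)) <=
     (0 * (b - a) + flow_integral mu P u a b w)%:E)%E}.
  apply: section_domination => // t t0; have t0' := ltW t0.
  have h1 := joint_slice X_separable U_sg fL t0; have h2 := joint_slice X_sep P_sg uL t0.
  have h3 := pos_mono (P_op t0') (fun v => @P_pos t v t0') (L1_norm X_separable fL) uL fu.
  near=> w; have -> : joint_representation mu U f (t, w) = U t f w by near: w.
  have -> : JP u (t, w) = P t u w by near: w.
  rewrite add0r; apply: (@le_trans _ _ (P t (fun w => `|f w|) w)); near: w; [exact: UP|exact: h3].
apply: filterS2 H (ae_good_section X_separable U_sg U_op fL) => w hw gw a b a0 ab.
have := hw a b a0 ab; rewrite mul0r add0r => hab; rewrite -lee_fin; apply: le_trans hab.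
apply: (wint_bound X_separable) => //; first exact: dmeas_section Jm w.
exact: good_wint.
Unshelve. all: by end_near. Qed.

(** The constant part of the majorant survives the flow because [P t 1 <= 1]; over an interval it
    contributes [C] times the length. *)
Lemma flow_dist_dominated f g u (C : R) : L1 mu f -> L1 mu g -> L1 mu u -> 0 <= C ->
  {ae mu, forall w, `|f w - g w| <= C + u w} ->
  {ae mu, forall w a b, 0 <= a -> a <= b ->
    `|flow_integral mu U f a b w - flow_integral mu U g a b w| <=
    C * (b - a) + flow_integral mu P u a b w}.
Proof.
move=> fL gL uL C0 fu; have Jf := joint_dmeas X_separable U_sg fL.
have Jg := joint_dmeas X_separable U_sg gL; have dL := L1B X_separable fL gL.
have L1c := L1_cst X_sep mu (1 : R^o); have CL := L1Z X_sep C L1c.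
have CuL := L1D X_sep CL uL.
have H : {ae mu, forall w a b, 0 <= a -> a <= b -> (nrm lam (itv a b)
    (fun t => joint_representation mu U f (t, w) - joint_representation mu U g (t, w))%R <=
     (C * (b - a) + flow_integral mu P u a b w)%:E)%E}.
  apply: (section_domination (dmeasB Jf Jg)) => // t t0; have t0' := ltW t0.
  have h1 := joint_slice X_separable U_sg fL t0; have h2 := joint_slice X_sep P_sg uL t0.
  have h1' := joint_slice X_separable U_sg gL t0; have Pt := P_op t0'.
  have Ppos := fun v => @P_pos t v t0'.
  have fu' : {ae mu, forall w, `|f w - g w| <= C *: (1 : R^o) + u w}.
    by apply: filterS fu => w; rewrite /GRing.scale/= mulr1.
  have h3 := pos_mono Pt Ppos (L1_norm X_separable dL) CuL fu'.
  have h4 := contrB (U_op t0') fL gL; have h5 := contrD Pt CL uL.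
  have h6 := contrZ X_sep Pt C L1c; have h7 := pos_one_le1 Pt.
  near=> w; have -> : joint_representation mu U f (t, w) = U t f w by near: w.
  have -> : joint_representation mu U g (t, w) = U t g w by near: w.
  have -> : JP u (t, w) = P t u w by near: w.
  have <- : U t (fun w => f w - g w) w = U t f w - U t g w by near: w.
  have k : P t (fun w => C *: (1 : R^o) + u w) w <= C + P t u w.
    have -> : P t (fun w => C *: (1 : R^o) + u w) w = P t (fun w => C *: (1 : R^o)) w + P t u w.
      by near: w.
    have -> : P t (fun w => C *: (1 : R^o)) w = C *: P t (fun=> 1) w by near: w.
    rewrite lerD2r /GRing.scale/= -[leRHS]mulr1 ler_wpM2l//; near: w; exact: h7.
  apply: le_trans k; apply: (@le_trans _ _ (P t (fun w => `|f w - g w|) w)); near: w; last exact: h3.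
  exact: (@UP (fun w => f w - g w)).
apply: filterS3 H (ae_good_section X_separable U_sg U_op fL)
  (ae_good_section X_separable U_sg U_op gL) => w hw gw gw' a b a0 ab.
rewrite -lee_fin; apply: le_trans (hw a b a0 ab).
apply: (wint_dist_bound X_separable) => //.
- exact: dmeas_section Jf w.
- exact: dmeas_section Jg w.
- exact: gw.
- exact: gw'.
- exact: good_wint.
- exact: good_wint.
Unshelve. all: by end_near. Qed.

(** Domination of the zero function: the majorant of a norm is nonnegative. *)
Lemma flow_positive u : L1 mu u -> {ae mu, forall w, 0 <= u w} ->
  {ae mu, forall w a b, 0 <= a -> a <= b -> 0 <= flow_integral mu P u a b w}.
Proof.
move=> uL u0; have L0 := L1_cst X_separable mu (0 : X).
have : {ae mu, forall w, `|0 : X| <= u w} by apply: filterS u0 => w; rewrite normr0.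
move=> /(flow_dominated L0 uL); apply: filterS => w h a b a0 ab.
exact: le_trans (normr_ge0 _) (h a b a0 ab).
Qed.

(* The factor [2] comes from [truncn t + 1 <= 2 t]. *)
Lemma maximal_flow u (c : R) : L1 mu u -> {ae mu, forall w, 0 <= u w} -> 0 < c ->
  exists B, [/\ measurable B, (c%:E * mu B <= nrm mu setT u)%E &
    {ae mu, forall w, ~ B w -> forall t : R, 1 <= t ->
      t^-1 * flow_integral mu P u 0 t w <= 2 * c}].
Proof.
move=> uL u0 c0; pose v : T -> R^o := flow_integral mu P u 0 1.
have [vL vn] := flow_integral_L1 X_sep P_sg P_op uL (lexx 0) ler01.
have nL := L1_norm X_sep vL; have P1 := P_op ler01.
have P1pos := fun v => @P_pos 1 v ler01.
have [B [mB Bc BP]] := maximal_ergodic P1 P1pos nL (fun w => normr_ge0 _) c0.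
exists B; split=> //.
  apply: le_trans Bc _; rewrite subr0 mul1e in vn; apply: le_trans vn.
  by rewrite /nrm; under eq_integral do rewrite normr_id.
have h1 : {ae mu, forall w n, partial_sum (P 1) v n w <= partial_sum (P 1) (fun w => `|v w|) n w}.
  apply: ae_foralln => n; apply: (partial_sum_mono P1 P1pos) => //.
  by apply: aeW => w; exact: ler_norm.
have h2 := flow_partial_sum X_sep P_sg P_op uL.
have h3 := flow_positive uL u0; have h4 := ae_good_section X_sep P_sg P_op uL.
near=> w => nB t t1.
have k1 : forall n, partial_sum (P 1) v n w <= partial_sum (P 1) (fun w => `|v w|) n w by near: w.
have k2 : forall n, partial_sum (P 1) v n w = flow_integral mu P u 0 n%:R w by near: w.
have k3 : forall a b, 0 <= a -> a <= b -> 0 <= flow_integral mu P u a b w by near: w.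
have k4 : good_section mu P u w by near: w.
have k5 : ~ B w -> forall n, partial_sum (P 1) (fun w => `|v w|) n w <= n%:R * c by near: w.
have t0 : 0 < t by exact: lt_le_trans t1.
have := truncn_itv (ltW t0); set n := Num.truncn t => /andP[nt tn].
rewrite ler_pdivrMl//.
have e := flow_integralD X_sep P_sg uL k4 (lexx 0) (ltW t0) (ltW tn).
have le1 : flow_integral mu P u 0 t w <= flow_integral mu P u 0 n.+1%:R w.
  by rewrite e lerDl; apply: k3; exact: ltW.
apply: le_trans le1 _; rewrite -k2; apply: le_trans (k1 _) _; apply: le_trans (k5 nB _) _.
rewrite mulrA ler_pM2r// -natr1 mulr_natr mulr2n; exact: lerD.
Unshelve. all: by end_near. Qed.

End FlowDomination.

(** For [n <= t <= n + 1] the average at [t] is [n / t] times the average at [n], plus [I n t / t],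
    whose norm is at most [b n / n]. *)
Lemma average_interpolation (R : realType) (X : normedModType R) (I : R -> R -> X)
    (b : nat -> R) (l : X) :
  (forall s t : R, 0 <= s -> s <= t -> I 0 t = I 0 s + I s t) ->
  (forall (n : nat) (t : R), n%:R <= t -> t <= n.+1%:R -> `|I n%:R t| <= b n) ->
  (n%:R^-1 *: I 0 n%:R) @[n --> \oo] --> l ->
  (n%:R^-1 * b n : R) @[n --> \oo] --> (0 : R^o) ->
  (t^-1 *: I 0 t) @[t --> +oo] --> l.
Proof.
move=> ID Ib cl cb; apply/cvgrPdist_lt => e e0; have e3 : 0 < e / 3 by rewrite divr_gt0.
move/cvgrPdist_lt : (cl) => /(_ _ e3)[N1 _ h1]; move/cvgrPdist_lt : cb => /(_ _ e3)[N2 _ h2].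
move/cvgrPdist_lt : (cl) => /(_ _ ltr01)[N3 _ h3].
(* Averages at large integers have norm below [|l| + 1], and [1 - n / t <= 1 / n]; this threshold
   for [n] makes the product at most [e / 3]. *)
have M0 : 0 <= (`|l| + 1) / (e / 3) by rewrite divr_ge0 ?addr_ge0// ltW.
have hM := archi_boundP M0; set N4 := Num.bound _ in hM.
near=> t; have tN : (maxn (maxn N1 N2) (maxn N3 N4)).+1%:R <= t.
  by near: t; exact: nbhs_pinfty_ge.
have t0 : 0 < t by apply: lt_le_trans tN.
have := truncn_itv (ltW t0); set n := Num.truncn t => /andP[nt tn].
have nN : (maxn (maxn N1 N2) (maxn N3 N4) < n.+1)%N.
  by rewrite -(ltr_nat R); apply: lt_trans tn; apply: lt_le_trans tN; rewrite ltr_nat.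
have nN' : (maxn (maxn N1 N2) (maxn N3 N4) < n)%N.
  have : (maxn (maxn N1 N2) (maxn N3 N4)).+1%:R < n.+1%:R :> R by exact: le_lt_trans tN tn.
  by rewrite ltr_nat.
move: nN'; rewrite gtn_max !gtn_max => /andP[/andP[nN1 nN2] /andP[nN3 nN4]].
have n0 : 0 < n%:R :> R by rewrite ltr0n; exact: leq_ltn_trans nN1.
have := h1 n (ltnW nN1); have := h2 n (ltnW nN2); have := h3 n (ltnW nN3) => /=.
rewrite sub0r normrN; set A := _ *: I 0 n%:R => k3 k2 k1.
have AN : `|A| < `|l| + 1.
  by have := ler_distD l 0 A; rewrite !sub0r !normrN; lra.
have nA : `|A| / n%:R <= e / 3.
  rewrite ler_pdivrMr//; apply: le_trans (ltW AN) _.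
  rewrite mulrC -ler_pdivrMr//; apply: le_trans (ltW hM) _.
  by rewrite ler_nat ltnW.
have E : t^-1 *: I 0 t = A + ((n%:R / t - 1) *: A + t^-1 *: I n%:R t).
  rewrite addrA -[X in X + _ + _]scale1r -scalerDl addrCA subrr addr0.
  rewrite (ID n%:R t)// ?ltW// scalerDr /A scalerA; congr (_ *: _ + _).
  by rewrite mulrAC divff ?mul1r ?gt_eqF.
rewrite E opprD addrA; apply: le_lt_trans (ler_normB _ _) _.
have j1 : `|(n%:R / t - 1) *: A| <= e / 3.
  apply: le_trans nA; rewrite normrZ mulrC ler_wpM2l// distrC ger0_norm; last first.
    by rewrite subr_ge0 ler_pdivrMr// mul1r.
  have -> : 1 - n%:R / t = (t - n%:R) / t by rewrite mulrBl divff// gt_eqF.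
  rewrite ler_pdivrMr//; apply: (@le_trans _ _ 1); last by rewrite ler_pdivlMl// mulr1.
  by rewrite lerBlDl natr1 ltW.
have j2 : `|t^-1 *: I n%:R t| < e / 3.
  apply: le_lt_trans k2; rewrite normrZ gtr0_norm ?invr_gt0//.
  apply: (@le_trans _ _ (n%:R^-1 * b n)); last exact: ler_norm.
  apply: ler_pM => //; first by rewrite invr_ge0 ltW.
    by rewrite lef_pV2 ?posrE.
  by apply: Ib => //; exact: ltW.
have := ler_normD ((n%:R / t - 1) *: A) (t^-1 *: I n%:R t); lra.
Unshelve. all: by end_near. Qed.

(** * The ergodic theorem for the flow *)

Section ContinuousErgodic.
Context (R : realType) (X : completeNormedModType R).
Hypothesis X_separable : separable X.
Hypothesis X_reflexive : reflexive_space X.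
Context d (T : measurableType d).
Variable mu : {finite_measure set T -> \bar R}.
Local Notation X_sep := (separable_real R).
Variable U : R -> (T -> X) -> (T -> X).
Hypothesis U_sg : strongly_continuous_semigroup mu U.
Hypothesis U_op : forall t : R, 0 <= t -> L1_Linf_contraction mu (U t).

Lemma ergodic_average_L1 f t : L1 mu f -> 0 < t ->
  L1 mu (ergodic_average mu U f t) /\
  (nrm mu setT (ergodic_average mu U f t) <= nrm mu setT f)%E.
Proof.
move=> fL t0; have [IL In] := flow_integral_L1 X_separable U_sg U_op fL (lexx 0) (ltW t0).
split; first exact: (L1Z X_separable t^-1 IL).
apply: le_trans (_ : (`|t^-1|%:E * nrm mu setT (flow_integral mu U f 0 t) <= _)%E).
  by rewrite -(nrmZ _ X_separable measurableT _ (L1_dmeas X_separable IL)).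
by rewrite gtr0_norm ?invr_gt0// lee_pdivrMl// ; rewrite subr0 in In.
Qed.

Variable P : R -> (T -> R^o) -> (T -> R^o).
Hypothesis P_sg : strongly_continuous_semigroup mu P.
Hypothesis P_op : forall t : R, 0 <= t -> L1_Linf_contraction mu (P t).
Hypothesis P_pos : forall (t : R) (u : T -> R^o), 0 <= t -> L1 mu u ->
  {ae mu, forall w, 0 <= u w} -> {ae mu, forall w, 0 <= P t u w}.
Hypothesis UP : positively_dominated mu U P.

(** The discrete theorem for [U 1] settles integer times. The part of the integral between [n] and
    [t] is at most the integral of the dominating flow over a unit interval; this is the n-th
    iterate of [P 1] at one fixed function, hence negligible against [n]. Fatou's lemma makes the
    limit integrable. *)
Theorem ergodic_average_cvg f : L1 mu f -> exists2 l, L1 mu l &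
  {ae mu, forall w, ergodic_average mu U f t w @[t --> +oo] --> l w}.
Proof.
move=> fL; have U1 := U_op ler01; have P1 := P_op ler01.
have P1pos := fun v => @P_pos 1 v ler01.
have uL := L1_norm X_separable fL; set u := (fun w => `|f w|) in uL.
have u0 : {ae mu, forall w, 0 <= u w} by apply: aeW => w; exact: normr_ge0.
have fu : {ae mu, forall w, `|f w| <= u w} by exact: aeW.
have [IL _] := flow_integral_L1 X_separable U_sg U_op fL (lexx 0) ler01.
have [BL _] := flow_integral_L1 X_sep P_sg P_op uL (lexx 0) ler01.
have UP1 : forall g, L1 mu g -> {ae mu, forall w, `|U 1 g w| <= P 1 (fun w => `|g w|) w}.
  by move=> g gL; exact: UP.
have h1 := pointwise_ergodic X_separable X_reflexive U1 P1 P1pos UP1 IL.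
have h2 := positive_iter_over_n P1 P1pos BL.
have h3 := flow_partial_sum X_separable U_sg U_op fL.
have h4 := flow_iter X_sep P_sg P_op uL.
have h5 := ae_good_section X_separable U_sg U_op fL.
have h6 := ae_good_section X_sep P_sg P_op uL.
have h7 := flow_dominated X_separable U_sg U_op P_sg P_op P_pos UP fL uL fu.
have h8 := flow_positive X_separable U_sg U_op P_sg P_op P_pos UP uL u0.
have [A AE] : {A : nat -> T -> X | forall n, A n = ergodic_average mu U f n.+1%:R}.
  by exists (fun n => ergodic_average mu U f n.+1%:R).
have AL n : L1 mu (A n) /\ (nrm mu setT (A n) <= nrm mu setT f)%E.
  by rewrite AE; exact: ergodic_average_L1.
have [l lm lP] := dmeas_seqlim X_separable (fun n => L1_dmeas X_separable (AL n).1).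
have Al : {ae mu, forall w, A n w @[n --> \oo] --> l w /\
    (n%:R^-1 *: flow_integral mu U f 0 n%:R w) @[n --> \oo] --> l w}.
  apply: filterS2 h1 h3 => w /cvg_ex[y cy] e.
  have c : (n%:R^-1 *: flow_integral mu U f 0 n%:R w) @[n --> \oo] --> y.
    by apply: cvg_trans cy; under [X in _ `=>` X @ _]eq_fun do rewrite e.
  have cA : A n w @[n --> \oo] --> y.
    under eq_cvg do rewrite AE.
    by rewrite -(cvg_shiftS (fun n => n%:R^-1 *: flow_integral mu U f 0 n%:R w)) in c.
  have cc : cvgn (fun n => A n w) by apply/cvg_ex; exists y.
  have e1 := cvg_lim (@norm_hausdorff _ _) (lP w cc).
  have e2 := cvg_lim (@norm_hausdorff _ _) cA.
  by have -> : l w = y by rewrite -e1 -e2.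
exists l.
  apply/(L1P X_separable _ _); split=> //.
  apply: le_lt_trans (L1_nrm X_separable fL).
  apply: (nrm_fatou X_separable (fun n => L1_dmeas X_separable (AL n).1) lm) => [|n].
    by apply: filterS Al => w [].
  exact: (AL n).2.
near=> w.
have [_ cl] : A n w @[n --> \oo] --> l w /\
    (n%:R^-1 *: flow_integral mu U f 0 n%:R w) @[n --> \oo] --> l w by near: w.
have k2 : (n%:R^-1 : R) *: iter n (P 1) (flow_integral mu P u 0 1) w @[n --> \oo] --> (0 : R^o).
  by near: w.
have k4 : forall n, iter n (P 1) (flow_integral mu P u 0 1) w =
  flow_integral mu P u n%:R (n%:R + 1) w by near: w.
have k5 : good_section mu U f w by near: w.
have k6 : good_section mu P u w by near: w.
have k7 : forall a b, 0 <= a -> a <= b ->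
  `|flow_integral mu U f a b w| <= flow_integral mu P u a b w by near: w.
have k8 : forall a b, 0 <= a -> a <= b -> 0 <= flow_integral mu P u a b w by near: w.
apply: (average_interpolation (I := fun a b => flow_integral mu U f a b w)
  (b := fun n => flow_integral mu P u n%:R (n%:R + 1) w)) => //.
- by move=> s t s0 st; exact: flow_integralD.
- move=> n t nt tn; apply: le_trans (k7 _ _ (ler0n _ n) nt) _.
  rewrite natr1 (flow_integralD X_sep P_sg uL k6 (ler0n _ n) nt tn) lerDl.
  by apply: k8 => //; exact: le_trans nt.
- by apply: cvg_trans k2; under [X in _ `=>` X @ _]eq_fun do rewrite k4.
Unshelve. all: by end_near. Qed.

End ContinuousErgodic.

(** * Joint limits *)

Section Majorants.
Context (R : realType) d (T : measurableType d).
Variable mu : {finite_measure set T -> \bar R}.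
Local Notation X_sep := (separable_real R).

Lemma small_integral (phi : T -> R^o) (e : R) : L1 mu phi -> 0 < e ->
  exists2 eta : R, 0 < eta & forall B, measurable B -> (mu B <= eta%:E)%E ->
    (nrm mu B phi <= e%:E)%E.
Proof.
move=> phiL e0; have e2 : 0 < e / 2 by rewrite divr_gt0.
have [g [C [gL C0 gC phig]]] := L1_truncate X_sep phiL e2.
have C1 : 0 < C + 1 by rewrite ltr_wpDl.
exists (e / 2 / (C + 1)); first by rewrite divr_gt0.
move=> B mB muB; have pm := L1_dmeas X_sep phiL; have gm := L1_dmeas X_sep gL.
have -> : nrm mu B phi = nrm mu B (fun w => (phi w - g w) + g w).
  by apply: eq_integral => w _; rewrite subrK.
apply: le_trans (nrmD _ X_sep mB (dmeasB pm gm) gm) _.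
rewrite [e]splitr EFinD; apply: leeD.
  by apply: le_trans phig; apply: (nrm_subset X_sep) => //; exact: dmeasB.
apply: (@le_trans _ _ (\int[mu]_(w in B) C%:E)%E).
  by apply: (le_nrm_ae X_sep mB gm) => //; apply: filterS gC.
rewrite integral_cst//; apply: le_trans (lee_wpmul2l _ muB) _; first by rewrite lee_fin.
rewrite -EFinM lee_fin mulrCA ger_pMr//.
by rewrite ler_pdivrMr// mul1r lerDl.
Qed.

(** [v] is [phi] cut off to the exceptional set, where its integral is small by absolute
    continuity. *)
Lemma au_majorant (X : completeNormedModType R) (I : Type) (E : nat -> set I)
    (u : I -> T -> X) (l : T -> X) (phi : T -> R^o) (lam e : R) :
  L1 mu phi -> (forall w, 0 <= phi w) -> au_cvg mu E u l ->
  (forall N i, E N i -> {ae mu, forall w, `|u i w - l w| <= phi w}) -> 0 < lam -> 0 < e ->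
  exists N (v : T -> R^o), [/\ L1 mu v, forall w, 0 <= v w, (nrm mu setT v <= e%:E)%E &
    forall i, E N i -> {ae mu, forall w, `|u i w - l w| <= lam + v w}].
Proof.
move=> phiL phi0 ul uphi lam0 e0; have [eta eta0 etaP] := small_integral phiL e0.
have [N [B [mB muB BP]]] := ul _ _ lam0 eta0.
pose v w : R^o := if w \in B then phi w else 0.
have vm : dmeas v by apply: dmeas_if => //; [exact: (L1_dmeas X_sep phiL)|exact: dmeas_cst].
have vB : (nrm mu setT v <= e%:E)%E.
  apply: le_trans (etaP B mB muB); rewrite /nrm [leRHS]integral_mkcond.
  rewrite le_eqVlt; apply/orP; left; apply/eqP/eq_integral => w _.
  by rewrite patchE /v; case: ifP => // _; rewrite normr0.
exists N, v; split=> //.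
- by apply/(L1P X_sep _ _); split=> //; apply: le_lt_trans vB _; rewrite ltry.
- by move=> w; rewrite /v; case: ifP.
move=> i Ni; apply: filterS2 (BP i Ni) (uphi N i Ni) => w h1 h2; rewrite /v.
case: ifPn => [_|/negP nB]; first by rewrite ler_wpDl// ltW.
by rewrite addr0; apply: h1 => Bw; apply: nB; exact: mem_set.
Qed.

Lemma sup_majorant (X : normedModType R) (I : Type) (D : set I) (u : I -> T -> X) :
  D !=set0 ->
  mu.-integrable setT (fun w => ereal_sup [set (`|u i w|)%:E | i in D]) ->
  exists phi : T -> R^o, [/\ L1 mu phi, forall w, 0 <= phi w &
    {ae mu, forall w i, D i -> `|u i w| <= phi w}].
Proof.
move=> [i0 Di0]; set S := (fun w => _) => Si.
have S0 w : (0 <= S w)%E.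
  by apply: (@le_trans _ _ (`|u i0 w|)%:E); [rewrite lee_fin|apply: ereal_sup_ubound; exists i0].
have Sf := integrable_ae measurableT Si.
exists (fun w => fine (S w)); split.
- apply: integrable_L1; apply: (integrableS measurableT) => //.
  have Sm := measurable_int _ Si.
  apply: le_integrable Si => //.
    by apply/measurable_EFinP; apply: measurableT_comp Sm; exact: fine_measurable.
  move=> w _ /=; rewrite gee0_abs// ger0_norm ?fine_ge0//.
  by case: (S w) (S0 w) => //= r _; rewrite leey.
- by move=> w; rewrite fine_ge0.
- apply: filterS Sf => w /(_ Logic.I) Sw i Di; rewrite -lee_fin fineK//.
  by apply: ereal_sup_ubound; exists i.
Qed.

Lemma rexp_addc (G : set (set T)) (u v : T -> R) (c : R) : sigma_algebra setT G ->
  G `<=` measurable -> mu.-integrable setT (EFin \o u) -> rexp mu G u v ->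
  rexp mu G (fun w => c + u w) (fun w => c + v w).
Proof.
move=> Gs Gm ui [vm vi uv]; have ci := finite_measure_integrable_cst mu c measurableT.
split=> [||B GB].
- by apply: measurable_funD => //; exact: measurable_cst.
- rewrite (_ : _ \o _ = (EFin \o (fun=> c)) \+ (EFin \o v))%E//.
  by have := integrableD measurableT ci vi.
have mB := Gm _ GB; have sub := integrableS measurableT mB (@subsetT _ _).
by rewrite !RintegralD ?uv//; exact: sub.
Qed.

End Majorants.

Section PositiveDomination.
Context (R : realType) (X : completeNormedModType R).
Hypothesis X_separable : separable X.
Context d (T : measurableType d).
Variable mu : {finite_measure set T -> \bar R}.
Local Notation X_sep := (separable_real R).

Definition positive_flow (P : R -> (T -> R^o) -> (T -> R^o)) :=
  forall (t : R) (u : T -> R^o), 0 <= t -> L1 mu u ->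
  {ae mu, forall w, 0 <= u w} -> {ae mu, forall w, 0 <= P t u w}.

(* When [X] is trivial, nothing forces the dominating flow to be positive, and
   the trivial flow can be used instead. *)
Lemma positive_domination (U : R -> (T -> X) -> (T -> X)) (P : R -> (T -> R^o) -> (T -> R^o)) :
  strongly_continuous_semigroup mu P -> (forall t, 0 <= t -> L1_Linf_contraction mu (P t)) ->
  positively_dominated mu U P -> exists Q, [/\ strongly_continuous_semigroup mu Q,
    forall t : R, 0 <= t -> L1_Linf_contraction mu (Q t), positive_flow Q &
    positively_dominated mu U Q].
Proof.
move=> P_sg P_op UP; have [[x x0]|X0] := pselect (exists x : X, x != 0).
  (* A unit vector embeds scalar functions: for [u >= 0], the norm of [U t (u e)] is nonnegative and
     at most [P t |u e| = P t u]. *)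
  exists P; split=> // t u t0 uL u0; pose e := `|x|^-1 *: x.
  have e1 : `|e| = 1 by rewrite normrZ normfV normr_id mulVf// normr_eq0.
  have um := L1_dmeas X_sep uL.
  have fL : L1 mu (fun w => (u w : R) *: e).
    apply/(L1P X_separable _ _); split.
      by apply: dmeasZf; [exact/dmeas_real|exact: dmeas_cst].
    rewrite /nrm; under eq_integral do rewrite normrZ e1 mulr1.
    exact: (L1_nrm X_sep uL).
  have nL : L1 mu (fun w => `|(u w : R) *: e| : R^o) by exact: (L1_norm X_separable fL).
  have uu : {ae mu, forall w, `|(u w : R) *: e| = u w}.
    by apply: filterS u0 => w uw; rewrite normrZ e1 mulr1 ger0_norm.
  have h := contr_ae (P_op t t0) nL uL uu.
  by apply: filterS2 h (UP _ t fL t0) => w <-; apply: le_trans.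
have lin0 : @L1_linear_operator _ T R R^o mu id by split=> // a f g fL gL; apply: aeW.
exists (fun _ u => u); split=> //.
- split=> [//|f _|t1 t2 f _ _ _|f t2 _ _]; [exact: aeW|exact: aeW|].
  rewrite (_ : (fun t1 : R => _) = fun=> 0%E); first exact: cvg_cst.
  apply/funext => t1; rewrite Lnorm1_nrm; apply: integral0_eq => w _.
  by rewrite subrr normr0.
- move=> f t fL t0; apply: aeW => w.
  have Ux : U t f w = 0 by apply: contrapT => /eqP h; apply: X0; exists (U t f w).
  by rewrite Ux normr0.
Qed.

End PositiveDomination.

Section PairTails.
Context (R : realType).

(** Strict in time and weak in the filtration index, so that already the tail at 0 lies in the index
    set [0 < t], [0 <= s]. *)
Definition pair_tail (N : nat) := [set p : R * R | N%:R < p.1 /\ N%:R <= p.2].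

Lemma pair_tail_near N :
  \forall p \near filter_prod (pinfty_nbhs R) (pinfty_nbhs R), pair_tail N p.
Proof.
exists ([set t | N%:R < t], [set s | N%:R <= s]) => /=; last by move=> [t s].
by split; [exact: nbhs_pinfty_gt|exact: nbhs_pinfty_ge].
Qed.

Lemma pair_tail_anti N p : pair_tail N.+1 p -> pair_tail N p.
Proof.
have h : N%:R <= N.+1%:R :> R by rewrite ler_nat.
by move=> [h1 h2]; split; [exact: le_lt_trans h1|exact: le_trans h2].
Qed.

Lemma pair_tail_le N M p : (N <= M)%N -> pair_tail M p -> pair_tail N p.
Proof.
rewrite -(ler_nat R) => h [h1 h2].
by split; [exact: le_lt_trans h1|exact: le_trans h2].
Qed.

Lemma pair_tail_ge0 N p : pair_tail N p -> 0 < p.1 /\ 0 <= p.2.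
Proof.
by move=> [h1 h2]; split; [exact: le_lt_trans h1|exact: le_trans h2].
Qed.

End PairTails.

(** * The two joint limits *)

Section MixedTheorem.
Context (R : realType) (X : completeNormedModType R).
Hypothesis X_separable : separable X.
Hypothesis X_reflexive : reflexive_space X.
Context d (T : measurableType d).
Variable mu : {finite_measure set T -> \bar R}.
Local Notation X_sep := (separable_real R).
Variable U : R -> (T -> X) -> (T -> X).
Hypothesis U_sg : strongly_continuous_semigroup mu U.
Hypothesis U_op : forall t : R, 0 <= t -> L1_Linf_contraction mu (U t).
Variable P : R -> (T -> R^o) -> (T -> R^o).
Hypothesis P_sg : strongly_continuous_semigroup mu P.
Hypothesis P_op : forall t : R, 0 <= t -> L1_Linf_contraction mu (P t).
Hypothesis P_pos : positive_flow mu P.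
Hypothesis UP : positively_dominated mu U P.
Variable F : R -> set (set T).
Hypothesis F_filtration : filtration F.
Variable f : T -> X.
Hypothesis fL : L1 mu f.
Local Notation A g t := (ergodic_average mu U g t).
Local Notation tail := (fun N : nat => [set s : R | N%:R <= s]).

Lemma nonneg_nrm (v : T -> R^o) : (forall w, 0 <= v w) ->
  (\int[mu]_w (v w)%:E)%E = nrm mu setT v.
Proof. by move=> v0; apply: eq_integral => w _; rewrite ger0_norm. Qed.

Lemma average_au_cvg g l : L1 mu g -> L1 mu l ->
  {ae mu, forall w, A g t w @[t --> +oo] --> l w} ->
  au_cvg mu (fun N => [set t : R | N%:R < t]) (fun t => A g t) l.
Proof.
move=> gL lL c; apply: (au_cvg_of_ae_cvg X_separable (Fi := pinfty_nbhs R)) => //.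
- move=> B [M [_ MB]]; exists (Num.bound `|M|) => t /= ht; apply: MB.
  apply: le_lt_trans ht; apply: le_trans (ler_norm _) _.
  by apply: ltW; exact: archi_boundP.
- by move=> N t /=; apply: le_lt_trans; rewrite ler_nat.
- by move=> t /= t0; apply: (L1_dmeas X_separable (mu := mu)); exact: (ergodic_average_L1 X_separable U_sg U_op gL t0).1.
- exact: L1_dmeas lL.
Qed.

Lemma conditional_averages :
  mu.-integrable setT (fun w =>
      ereal_sup [set (`|A f t w|)%:E | t in [set t : R | 0 < t]]) ->
  exists f_infty f_star : T -> X,
    [/\ L1 mu f_infty,
        {ae mu, forall w, A f t w @[t --> +oo] --> f_infty w},
        cvg_ae_versions mu [set s | 0 <= s] (pinfty_nbhs R)
          (fun s => [set u | is_cond_exp mu (F s) f_infty u]) f_star &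
        cvg_ae_versions mu [set p : R * R | 0 < p.1 /\ 0 <= p.2]
          (filter_prod (pinfty_nbhs R) (pinfty_nbhs R))
          (fun p => [set u | is_cond_exp mu (F p.2) (A f p.1) u]) f_star].
Proof.
move=> Si; have [phi [phiL phi0 phiA]] : exists phi : T -> R^o, [/\ L1 mu phi,
    forall w, 0 <= phi w & {ae mu, forall w t, 0 < t -> `|A f t w| <= phi w}].
  by apply: (sup_majorant (D := [set t : R | 0 < t])) Si; exists 1 => /=.
have [l lL lc] := ergodic_average_cvg X_separable X_reflexive U_sg U_op P_sg P_op P_pos UP fL.
have AL t : 0 < t -> L1 mu (A f t).
  by move=> t0; exact: (ergodic_average_L1 X_separable U_sg U_op fL t0).1.
have lphi : {ae mu, forall w, `|l w| <= phi w}.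
  apply: filterS2 lc phiA => w c h.
  have cn : `|A f t w| @[t --> +oo] --> `|l w| by exact: cvg_norm.
  apply: (cvgr_to_le cn); apply: filterS (nbhs_pinfty_gt (num_real (0 : R))) => t; exact: h.
(* Both the averages and their limit are bounded by [phi], hence their difference by [2 phi]. *)
have psiL := L1D X_sep phiL phiL; set psi := (fun w => phi w + phi w) in psiL.
have psi0 w : 0 <= psi w by rewrite addr_ge0.
have lm := L1_dmeas X_separable lL; have lf := L1_nrm X_separable lL.
have Fs := filtration_sigma F_filtration; have Fm := filtration_sub F_filtration.
have auA := average_au_cvg fL lL lc.
have /choice[M MP] s : exists M, 0 <= s -> cexp mu (F s) l M.
  have [s0|] := leP 0 s; last by exists (fun=> 0).
  by have [M h] := cexp_exists (mu := mu) (Fs _ s0) (Fm _ s0) X_separable lm lf; exists M.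
have Ls := @filtration_limit_sigma R d T F; have Lm := filtration_limit_sub F_filtration.
have [g gP] := cexp_exists (mu := mu) Ls Lm X_separable lm lf.
have gm := cexp_dmeas Ls Lm gP.
have auM := martingale_au_cvg F_filtration X_separable lm lf gP MP.
have /choice[u uP] (p : R * R) : exists u, 0 < p.1 /\ 0 <= p.2 -> cexp mu (F p.2) (A f p.1) u.
  have [p1|] := leP p.1 0; first by exists (fun=> 0) => -[].
  have [p2 p1|] := leP 0 p.2; last by exists (fun=> 0) => -[].
  have [u h] := cexp_exists (mu := mu) (Fs _ p2) (Fm _ p2) X_separable
    (L1_dmeas X_separable (AL _ p1)) (L1_nrm X_separable (AL _ p1)).
  by exists u.
exists l, g; split=> //.
  apply: (au_cvg_ae_versions (E := tail) (u := M)) => //.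
    by move=> N; exact: nbhs_pinfty_ge.
  move=> s s0 Z mZ Z0 /=; apply: (cexp_is_cond_exp X_separable (Fs _ s0) (Fm _ s0) lL (MP s s0)).
    by apply: dmeas_if => //; exact: (cexp_dmeas (Fs _ s0) (Fm _ s0) (MP s s0)).
  exists Z; split=> // w /= h; apply: contrapT => nZ; apply: h; by rewrite memNset.
apply: (au_cvg_ae_versions (E := @pair_tail R) (u := u)); first exact: pair_tail_near.
  apply: (au_cvg_trans (v := fun p => M p.2)); last 2 first.
  - by move=> N p; exact: pair_tail_anti.
  - move=> lam eps lam0 eps0; have [N [B [mB muB BP]]] := auM _ _ lam0 eps0.
    by exists N, B; split=> // p [_ Np]; exact: BP.
  move=> lam eps lam0 eps0; have lam2 : 0 < lam / 2 by rewrite divr_gt0.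
  (* Doob's inequality for [v] at level [lam / 2] then has an exceptional set of measure at most
     [eps]; the other [lam / 2] is the constant part of the majorant. *)
  have e0 : 0 < eps * (lam / 2) by rewrite mulr_gt0.
  have bd N t : [set t : R | N%:R < t] t -> {ae mu, forall w, `|A f t w - l w| <= psi w}.
    move=> /= Nt; apply: filterS2 phiA lphi => w h1 h2.
    by apply: le_trans (ler_normB _ _) (lerD (h1 t _) h2); exact: le_lt_trans Nt.
  have [N [v [vL v0 vn vP]]] := au_majorant psiL psi0 auA bd lam2 e0.
  have vi := L1_integrable vL.
  have [B [mB muB BP]] := doob_maximal F_filtration lam2 vi v0.
  exists N, B; split=> //.
    rewrite -(@lee_pmul2l _ (lam / 2)%:E) ?lte_fin//; apply: le_trans muB _.
    by rewrite (nonneg_nrm v0) muleC -EFinM.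
  move=> p Np; have [p1 p2] := pair_tail_ge0 Np.
  have [r rP] := rexp_exists (mu := mu) (Fs _ p2) (Fm _ p2) vi.
  have rP' := rexp_addc (lam / 2) (Fs _ p2) (Fm _ p2) vi rP.
  have Am := L1_dmeas X_separable (AL _ p1); have Af := L1_nrm X_separable (AL _ p1).
  have dP := cexp_lin (Fs _ p2) (Fm _ p2) X_separable (-1) lm Am lf Af (MP _ p2) (uP p (conj p1 p2)).
  have dL := L1_lin X_separable (-1) lL (AL _ p1).
  have cv := integrableD measurableT (finite_measure_integrable_cst mu (lam / 2) measurableT) vi.
  have dv : {ae mu, forall w, `|-1 *: l w + A f p.1 w| <= lam / 2 + v w}.
    by apply: filterS (vP p.1 Np.1) => w; rewrite scaleN1r addrC.
  have h := cexp_norm_le (Fs _ p2) (Fm _ p2) X_separable (L1_dmeas X_separable dL)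
    (L1_nrm X_separable dL) cv dv dP rP'.
  apply: filterS2 h (BP _ _ p2 rP) => w h1 h2 nB; have := h2 nB; move: h1.
  by rewrite scaleN1r addrC; lra.
move=> p [p1 p2] Z mZ Z0 /=.
apply: (cexp_is_cond_exp X_separable (Fs _ p2) (Fm _ p2) (AL _ p1) (uP p (conj p1 p2))).
  by apply: dmeas_if => //; exact: (cexp_dmeas (Fs _ p2) (Fm _ p2) (uP p (conj p1 p2))).
exists Z; split=> // w /= h; apply: contrapT => nZ; apply: h; by rewrite memNset.
Qed.

Lemma averaged_martingale (M : R -> T -> X) :
  (forall s, 0 <= s -> is_cond_exp mu (F s) f (M s)) ->
  mu.-integrable setT (fun w =>
      ereal_sup [set (`|M s w|)%:E | s in [set s : R | 0 <= s]]) ->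
  exists M_infty f_star : T -> X,
    [/\ is_cond_exp mu (filtration_limit F) f M_infty,
        {ae mu, forall w, A M_infty t w @[t --> +oo] --> f_star w} &
        cvg_ae_versions mu [set p : R * R | 0 < p.1 /\ 0 <= p.2]
          (filter_prod (pinfty_nbhs R) (pinfty_nbhs R))
          (fun p => [set u | u = A (M p.2) p.1 %[ae mu]]) f_star].
Proof.
move=> MP Si; have [phi [phiL phi0 phiM]] : exists phi : T -> R^o, [/\ L1 mu phi,
    forall w, 0 <= phi w & {ae mu, forall w s, 0 <= s -> `|M s w| <= phi w}].
  by apply: (sup_majorant (D := [set s : R | 0 <= s])) Si; exists 1 => /=.
have fm := L1_dmeas X_separable fL; have ff := L1_nrm X_separable fL.
have Fs := filtration_sigma F_filtration; have Fm := filtration_sub F_filtration.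
have Ls := @filtration_limit_sigma R d T F; have Lm := filtration_limit_sub F_filtration.
have [g gP] := cexp_exists (mu := mu) Ls Lm X_separable fm ff.
have gm := cexp_dmeas Ls Lm gP.
have gC : is_cond_exp mu (filtration_limit F) f g.
  by apply: (cexp_is_cond_exp X_separable Ls Lm fL gP) => //; exact: aeW.
have gL : L1 mu g by case: gC.
have ML s : 0 <= s -> L1 mu (M s) by move=> /MP[].
have [l lL lc] := ergodic_average_cvg X_separable X_reflexive U_sg U_op P_sg P_op P_pos UP gL.
(* The given [M s] need only agree almost everywhere with an [F s]-measurable function. The
   martingale theorem is applied to such functions [m s] and carried back to [M], with null sets
   that depend on [s]. *)
have /choice[m mP] s : exists m, 0 <= s ->
    cexp mu (F s) f m /\ {ae mu, forall w, M s w = m w}.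
  have [s0|] := leP 0 s; last by exists (fun=> 0).
  by have [m h1 h2] := is_cond_exp_cexp X_separable (Fs _ s0) (Fm _ s0) fL (MP s s0); exists m.
have auM : au_cvg mu tail M g.
  have := martingale_au_cvg F_filtration X_separable fm ff gP (fun s s0 => (mP s s0).1).
  move=> H lam eps lam0 eps0; have [N [B [mB muB BP]]] := H _ _ lam0 eps0.
  exists N, B; split=> // s Ns; have s0 : 0 <= s by exact: le_trans Ns.
  by apply: filterS2 (BP s Ns) (mP s s0).2 => w h ->.
exists g, l; split=> //.
have psiL := L1D X_sep phiL (L1_norm X_separable gL).
set psi := (fun w => phi w + `|g w|) in psiL.
have psi0 w : 0 <= psi w by rewrite addr_ge0.
have bd N s : tail N s -> {ae mu, forall w, `|M s w - g w| <= psi w}.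
  move=> /= Ns; apply: filterS phiM => w h; apply: le_trans (ler_normB _ _) _.
  by rewrite lerD2r; apply: h; exact: le_trans Ns.
apply: (au_cvg_ae_versions (E := @pair_tail R) (u := fun p => A (M p.2) p.1)).
- exact: pair_tail_near.
- apply: (au_cvg_trans (v := fun p => A g p.1)); last 2 first.
  + by move=> N p; exact: pair_tail_anti.
  + move=> lam eps lam0 eps0; have [N [B [mB muB BP]]] := average_au_cvg gL lL lc lam0 eps0.
    by exists N, B; split=> // p [Np _]; exact: BP.
  move=> lam eps lam0 eps0; have lam2 : 0 < lam / 2 by rewrite divr_gt0.
  (* [maximal_flow] loses a factor 2, so level [lam / 4] bounds the averages of [v] by [lam / 2]. *)
  have lam4 : 0 < lam / 4 by rewrite divr_gt0.
  have e0 : 0 < eps * (lam / 4) by rewrite mulr_gt0.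
  have [N [v [vL v0 vn vP]]] := au_majorant psiL psi0 auM bd lam2 e0.
  have [B [mB muB BP]] := maximal_flow X_separable U_sg U_op P_sg P_op P_pos UP vL
    (aeW _ v0) lam4.
  (* The maximal inequality for the flow controls the averages only from [t = 1] on. *)
  exists (maxn N 1), B; split=> //.
    rewrite -(@lee_pmul2l _ (lam / 4)%:E) ?lte_fin//; apply: le_trans muB _.
    by rewrite muleC -EFinM.
  move=> p Np; have [p1 p2] := pair_tail_ge0 Np.
  have [_ Np2] := pair_tail_le (leq_maxl N 1) Np.
  have [/ltW p11 _] := pair_tail_le (leq_maxr N 1) Np.
  have h := flow_dist_dominated X_separable U_sg U_op P_sg P_op P_pos UP (ML _ p2) gL vL
    (ltW lam2) (vP _ Np2).
  apply: filterS2 h BP => w h1 h2 nB; have k2 := h2 nB _ p11.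
  have k1 := h1 0 p.1 (lexx 0) (ltW p1).
  rewrite /ergodic_average -scalerBr normrZ gtr0_norm ?invr_gt0//.
  apply: (@le_trans _ _ (p.1^-1 * (lam / 2 * (p.1 - 0) + flow_integral mu P v 0 p.1 w))).
    by apply: ler_wpM2l => //; rewrite invr_ge0 ltW.
  rewrite mulrDr subr0 mulrCA mulVf ?gt_eqF// mulr1.
  rewrite [leRHS]splitr lerD2l; apply: le_trans k2 _.
  by rewrite le_eqVlt; apply/orP; left; apply/eqP; field.
move=> p _ Z mZ Z0 /=; exists Z; split=> // w /= h.
by apply: contrapT => nZ; apply: h => _; rewrite memNset.
Qed.

End MixedTheorem.

Theorem theorem3p2 (R : realType) (X : completeNormedModType R)
    (d : measure_display) (Omega : measurableType d)
    (mu : {finite_measure set Omega -> \bar R})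
    (T : R -> (Omega -> X) -> (Omega -> X))
    (P : R -> (Omega -> R^o) -> (Omega -> R^o))
    (F : R -> set (set Omega)) (f : Omega -> X)
    (X_separable : separable X) (X_reflexive : reflexive_space X)
    (T_semigroup : strongly_continuous_semigroup mu T)
    (T_contraction : forall t, 0 <= t -> L1_Linf_contraction mu (T t))
    (P_semigroup : strongly_continuous_semigroup mu P)
    (P_contraction : forall t, 0 <= t -> L1_Linf_contraction mu (P t))
    (T_dominated : positively_dominated mu T P)
    (F_filtration : filtration F)
    (f_L1 : L1 mu f) :
  (mu.-integrable setT (fun w =>
      ereal_sup [set (`|ergodic_average mu T f t w|)%:E
                | t in [set t : R | 0 < t]]) ->
    exists f_infty f_star : Omega -> X,
      [/\ L1 mu f_infty,
          {ae mu, forall w,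
             ergodic_average mu T f t w @[t --> +oo] --> f_infty w},
          cvg_ae_versions mu [set s | 0 <= s] (pinfty_nbhs R)
            (fun s => [set u | is_cond_exp mu (F s) f_infty u]) f_star &
          cvg_ae_versions mu [set p : R * R | 0 < p.1 /\ 0 <= p.2]
            (filter_prod (pinfty_nbhs R) (pinfty_nbhs R))
            (fun p => [set u |
               is_cond_exp mu (F p.2) (ergodic_average mu T f p.1) u])
            f_star]) /\
  (forall M : R -> Omega -> X,
    (forall s, 0 <= s -> is_cond_exp mu (F s) f (M s)) ->
    mu.-integrable setT (fun w =>
      ereal_sup [set (`|M s w|)%:E | s in [set s : R | 0 <= s]]) ->
    exists M_infty f_star : Omega -> X,
      [/\ is_cond_exp mu (filtration_limit F) f M_infty,
          {ae mu, forall w,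
             ergodic_average mu T M_infty t w @[t --> +oo] --> f_star w} &
          cvg_ae_versions mu [set p : R * R | 0 < p.1 /\ 0 <= p.2]
            (filter_prod (pinfty_nbhs R) (pinfty_nbhs R))
            (fun p => [set u |
               u = ergodic_average mu T (M p.2) p.1 %[ae mu]])
            f_star]).

Proof.
have [Q [Q_sg Q_op Q_pos TQ]] :=
  positive_domination X_separable P_semigroup P_contraction T_dominated.
split=> [|M MP].
  exact: (conditional_averages X_separable X_reflexive T_semigroup T_contraction
    Q_sg Q_op Q_pos TQ F_filtration f_L1).
exact: (averaged_martingale X_separable X_reflexive T_semigroup T_contraction
  Q_sg Q_op Q_pos TQ F_filtration f_L1 MP).
Qed.
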